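(* Let $k>n$ be positive integers, and let $\Omega$ be an open subset of $\mathbb{R}^k$. If $p>k$ and $f\in W^{1,p}_{\mathrm{loc}}(\Omega;\mathbb{R}^{2n+1})$ (identified with its continuous representative) satisfies the weak contact equation $$\operatorname{im}\,\operatorname{wk}df_x\subset\ker\alpha(f(x))\quad\text{for }\mathcal{H}^k\text{-almost every }x\in\Omega,$$ then $\mathcal{H}^k_{\mathbb{H}^n}(f(\Omega))=0$.
   Context: The Heisenberg group $\mathbb{H}^n$ is $\mathbb{C}^n\times\mathbb{R}=\mathbb{R}^{2n+1}$, with points $(z,t)=(x_1,y_1,\ldots,x_n,y_n,t)$, $z_j=x_j+iy_j$, and group law $(z,t)*(z',t')=\left(z+z',\,t+t'+2\,\mathrm{Im}\sum_{j=1}^n z_j\overline{z_j'}\right)$. The left-invariant horizontal vector fields are $X_j=\frac{\partial}{\partial x_j}+2y_j\frac{\partial}{\partial t}$, $Y_j=\frac{\partial}{\partial y_j}-2x_j\frac{\partial}{\partial t}$ ($j=1,\ldots,n$). The horizontal space at $p$ is $H_p\mathbb{H}^n=\mathrm{span}\{X_1(p),\ldots,X_n(p),Y_1(p),\ldots,Y_n(p)\}$, equipped with the inner product making these $2n$ vectors orthonormal; it equals $\ker\alpha(p)$, the kernel at $p$ of the standard contact form $\alpha=dt+2\sum_{j=1}^n(x_j\,dy_j-y_j\,dx_j)$. An absolutely continuous curve $\gamma\colon[a,b]\to\mathbb{R}^{2n+1}$ is horizontal if $\gamma'(s)\in H_{\gamma(s)}\mathbb{H}^n$ for almost every $s$;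 its length is the integral of the norm of $\gamma'$ with respect to this inner product. The Carnot–Carathéodory metric $d_{cc}(p,q)$ is the infimum of lengths of horizontal curves joining $p$ to $q$. $\mathcal{H}^k_{\mathbb{H}^n}$ is the $k$-dimensional Hausdorff measure on $\mathbb{H}^n$ with respect to $d_{cc}$; $\mathcal{H}^k$ is Lebesgue measure on $\mathbb{R}^k$. $W^{1,p}_{\mathrm{loc}}(\Omega;\mathbb{R}^{2n+1})$ is the Sobolev space of locally $p$-integrable mappings with locally $p$-integrable weak derivative, denoted $\operatorname{wk}df$. Since $p>k$, every such mapping has a unique continuous representative. *)

(* Defs.v *)
From HB Require Import structures.
From mathcomp Require Import all_boot all_order all_algebra.
From mathcomp Require Import all_classical all_reals all_analysis.
From mathcomp Require Import ring.

Set Implicit Arguments.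
Unset Strict Implicit.
Unset Printing Implicit Defensive.

Import Order.TTheory GRing.Theory Num.Theory.
Import numFieldNormedType.Exports.

Local Open Scope classical_set_scope.
Local Open Scope ring_scope.

(* As for [n.-tuple T]: the product sigma-algebra, which on 'rV[R]_n is the
   Borel sigma-algebra. *)
Section measurable_rV.
Context {d} {T : measurableType d}.
Variable n : nat.

Let coors : 'I_n -> 'rV[T]_n -> T := fun i v => v 0 i.

Let rV_set0 : g_sigma_preimage coors set0.
Proof. exact: sigma_algebra0. Qed.

Let rV_setC A : g_sigma_preimage coors A -> g_sigma_preimage coors (~` A).
Proof. exact: sigma_algebraC. Qed.

Let rV_bigcup (F : (set 'rV[T]_n)^nat) :
  (forall i, g_sigma_preimage coors (F i)) ->
  g_sigma_preimage coors (\bigcup_i (F i)).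
Proof. exact: sigma_algebra_bigcup. Qed.

HB.instance Definition _ := @isMeasurable.Build (measure_tuple_display d)
  'rV[T]_n (g_sigma_preimage coors) rV_set0 rV_setC rV_bigcup.

End measurable_rV.

Section measurable_rV_theory.
Context {d} {T : measurableType d}.

Lemma measurable_rV_coord n (i : 'I_n) :
  measurable_fun [set: 'rV[T]_n] (fun v => v 0 i).
Proof.
move=> _ Y mY; rewrite setTI; apply: sub_sigma_algebra => /=.
rewrite -bigcup_seq/=; exists i => /=; first by rewrite mem_index_enum.
by exists Y => //; rewrite setTI.
Qed.

Lemma measurable_fun_rV d' (S : measurableType d') n (f : S -> 'rV[T]_n) :
  (forall i, measurable_fun [set: S] (fun s => f s 0 i)) ->
  measurable_fun [set: S] f.
Proof.
move=> mf; suff prefS : g_sigma_preimage (fun i s => f s 0 i) `<=` measurable.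
    move=> _ A mA; apply: prefS.
  by rewrite (g_sigma_preimage_comp (fun i (v : 'rV[T]_n) => v 0 i) f); exists A.
apply: smallest_sub; first exact: sigma_algebra_measurable.
rewrite -bigcup_seq => A [i _ [B mB <-]].
exact: mf.
Qed.

Definition rV_cons n (xv : T * 'rV[T]_n) : 'rV[T]_n.+1 :=
  \row_i (if unlift ord0 i is Some j then xv.2 0 j else xv.1).

Definition rV_uncons n (v : 'rV[T]_n.+1) : T * 'rV[T]_n :=
  (v 0 ord0, \row_j v 0 (lift ord0 j)).

Lemma rV_consK n : cancel (@rV_cons n) (@rV_uncons n).
Proof.
move=> [x v]; congr pair; first by rewrite mxE unlift_none.
by apply/rowP => j; rewrite !mxE liftK.
Qed.

Lemma measurable_rV_cons n : measurable_fun [set: T * 'rV[T]_n] (@rV_cons n).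
Proof.
apply: measurable_fun_rV => i; under eq_fun do rewrite mxE.
case: unliftP => [j _|_]; last exact: measurable_fst.
exact: (measurableT_comp (measurable_rV_coord j) measurable_snd).
Qed.

Lemma measurable_rV_uncons n : measurable_fun [set: 'rV[T]_n.+1] (@rV_uncons n).
Proof.
apply: measurable_fun_pair; first exact: measurable_rV_coord.
apply: measurable_fun_rV => j; under eq_fun do rewrite mxE.
exact: measurable_rV_coord.
Qed.

End measurable_rV_theory.

Section lebesgue_rV_succ.
Context {R : realType} (n : nat).
Variable mu : {sigma_finite_measure set 'rV[R]_n -> \bar R}.

Definition lebesgue_rV_succ : set 'rV[R]_n.+1 -> \bar R :=
  pushforward (lebesgue_measure \x mu)%E (@rV_cons _ R n).

Let succ0 : lebesgue_rV_succ set0 = 0%E.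
Proof. by rewrite /lebesgue_rV_succ /pushforward preimage_set0 measure0. Qed.

Let succ_ge0 A : (0 <= lebesgue_rV_succ A)%E.
Proof. exact: (measure_ge0 (lebesgue_measure \x mu)%E). Qed.

Let mpre A : measurable A -> measurable (@rV_cons _ R n @^-1` A).
Proof.
by move=> mA; rewrite -[X in measurable X]setTI; exact: measurable_rV_cons.
Qed.

Let succ_semi_sigma_additive : semi_sigma_additive lebesgue_rV_succ.
Proof.
move=> F mF tF mUF; rewrite /lebesgue_rV_succ /pushforward preimage_bigcup.
apply: measure_semi_sigma_additive.
- by move=> i; exact: mpre.
- apply/trivIsetP => /= i j _ _ ij; rewrite -preimage_setI.
  by move/trivIsetP : tF => /(_ _ _ _ _ ij) ->//; rewrite preimage_set0.
- by rewrite -preimage_bigcup; exact: mpre.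
Qed.

HB.instance Definition _ := isMeasure.Build _ _ _ lebesgue_rV_succ
  succ0 succ_ge0 succ_semi_sigma_additive.

Let succ_sigma_finite : sigma_finite setT lebesgue_rV_succ.
Proof.
have /sigma_finiteP[F [TF ndF Foo]] := sigma_finiteT (@lebesgue_measure R).
have /sigma_finiteP[G [TG ndG Goo]] := sigma_finiteT mu.
exists (fun i => @rV_uncons _ R n @^-1` (F i `*` G i)).
  rewrite -preimage_bigcup; apply/esym.
  rewrite -[RHS](preimage_setT (@rV_uncons _ R n)).
  congr (_ @^-1` _); rewrite -subTset => -[x y] _.
  have : [set: measurableTypeR R] x by [].
  have : [set: 'rV[R]_n] y by [].
  rewrite TF TG => -[k _ Gky] [i _ Fix]; exists (maxn i k) => //; split.
  - by move: x Fix; exact/subsetPset/ndF/leq_maxl.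
  - by move: y Gky; exact/subsetPset/ndG/leq_maxr.
move=> i; have [mF Fi] := Foo i; have [mG Gi] := Goo i; split.
  rewrite -[X in measurable X]setTI; apply: measurable_rV_uncons => //.
  exact: measurableX.
rewrite /lebesgue_rV_succ /pushforward -comp_preimage.
rewrite (_ : _ \o _ = idfun); last by apply/funext => xv; exact: rV_consK.
by rewrite preimage_id product_measure1E// lte_mul_pinfty// ge0_fin_numE.
Qed.

HB.instance Definition _ := Measure_isSigmaFinite.Build _ _ _ lebesgue_rV_succ
  succ_sigma_finite.

End lebesgue_rV_succ.

Fixpoint lebesgue_rV (R : realType) (n : nat) :
    {sigma_finite_measure set 'rV[R]_n -> \bar R} :=
  match n with
  | 0 => \d_(0 : 'rV[R]_0)
  | n.+1 => lebesgue_rV_succ (lebesgue_rV R n)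
  end.

Lemma lebesgue_rV_box (R : realType) n (A : 'I_n -> set R) :
  (forall i, measurable (A i)) ->
  lebesgue_rV R n [set v | forall i, A i (v 0 i)]
  = (\prod_(i < n) lebesgue_measure (A i))%E.
Proof.
elim: n => [|n IHn] in A * => mA /=.
  by rewrite big_ord0 diracE mem_set//= => -[].
rewrite big_ord_recl -IHn; last by move=> i; exact: mA.
have mB : measurable [set v : 'rV[R]_n | forall i, A (lift ord0 i) (v 0 i)].
  have -> : [set v : 'rV[R]_n | forall i, A (lift ord0 i) (v 0 i)] =
      \bigcap_(i in [set: 'I_n]) [set v | A (lift ord0 i) (v 0 i)].
    by apply/seteqP; split=> v Av i => [_|]; exact: Av.
  apply: fin_bigcap_measurable => // i _; rewrite -[X in measurable X]setTI.
  exact: (measurable_rV_coord i) (mA _).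
rewrite /lebesgue_rV_succ /pushforward -product_measure1E//; last exact: mA.
congr (_ _); apply/seteqP; split=> [[x v] /= Axv|[x v] /= [Ax Av] i].
  split; first by have := Axv ord0; rewrite mxE unlift_none.
  by move=> i; have := Axv (lift ord0 i); rewrite mxE liftK.
by rewrite mxE; case: unliftP => [j ->|->].
Qed.

Section sobolev.
Context {R : realType} {k : nat}.
Implicit Types (Omega : set 'rV[R]_k) (u g phi : 'rV[R]_k -> R) (p : \bar R).

Local Notation lambda := (lebesgue_rV R k).
Local Notation partial i phi := ('D_(delta_mx 0 i : 'rV[R]_k) phi).

Fixpoint Ck (m : nat) phi : Prop :=
  match m with
  | 0 => continuous phi
  | m.+1 => continuous phi /\ forall i : 'I_k,
      (forall x, derivable phi x (delta_mx 0 i)) /\ Ck m (partial i phi)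
  end.

Definition test_function Omega phi :=
  (forall m, Ck m phi) /\
  exists K : set 'rV[R]_k,
    [/\ compact K, K `<=` Omega & forall x, ~ K x -> phi x = 0].

(* [Lnorm] at [+oo] is the essential supremum, so [p = +oo] is covered. *)
Definition locally_Lp Omega p u :=
  measurable_fun Omega u /\
  forall K, compact K -> K `<=` Omega ->
    ('N[lambda]_p [EFin \o (u \_ K)] < +oo)%E.

Definition weak_partial Omega (i : 'I_k) u g :=
  forall phi, test_function Omega phi ->
    \int[lambda]_(x in Omega) (u x * partial i phi x) =
    - \int[lambda]_(x in Omega) (g x * phi x).

(* [f] is in W^{1,p}_loc(Omega; R^m) and [Df] represents its weak derivative.
   As for ['J f x], the derivative at [x] is the map [v |-> v *m Df x], so
   [Df x i j] is the [i]-th weak partial derivative of the [j]-th component. *)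
Definition sobolev_loc m Omega p
    (f : 'rV[R]_k -> 'rV[R]_m) (Df : 'rV[R]_k -> 'M[R]_(k, m)) :=
  (forall j, locally_Lp Omega p (fun x => f x 0 j)) /\
  (forall i j, locally_Lp Omega p (fun x => Df x i j) /\
    weak_partial Omega i (fun x => f x 0 j) (fun x => Df x i j)).

End sobolev.

Definition absolutely_continuous (R : realType) (V : normedModType R)
    (a b : R) (gamma : R -> V) :=
  forall e : R, 0 < e -> exists2 d : R, 0 < d &
    forall (m : nat) (u v : 'I_m -> R),
      (forall i, [/\ a <= u i, u i <= v i & v i <= b]) ->
      trivIset [set: 'I_m] (fun i => `]u i, v i[%classic) ->
      \sum_i (v i - u i) < d ->
      \sum_i `|gamma (v i) - gamma (u i)| < e.

(* Points are ordered as (x_1, y_1, ..., x_n, y_n, t). *)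
Notation heis R n := 'rV[R]_(n.*2.+1).

Definition ix n (j : 'I_n) : 'I_n.*2.+1 := inord j.*2.
Definition iy n (j : 'I_n) : 'I_n.*2.+1 := inord j.*2.+1.
Definition it n : 'I_n.*2.+1 := ord_max.

Section heisenberg.
Context {R : realType} {n : nat}.
Implicit Types (p q v w : heis R n) (gamma : R -> heis R n).

Definition contact_form p w : R :=
  w 0 (it n) +
  2 * \sum_(j < n) (p 0 (ix j) * w 0 (iy j) - p 0 (iy j) * w 0 (ix j)).

Definition vfX p (j : 'I_n) : heis R n :=
  delta_mx 0 (ix j) + (2 * p 0 (iy j)) *: delta_mx 0 (it n).
Definition vfY p (j : 'I_n) : heis R n :=
  delta_mx 0 (iy j) - (2 * p 0 (ix j)) *: delta_mx 0 (it n).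

Definition hframe p : (n + n).-tuple (heis R n) :=
  [tuple match fintype.split i with inl j => vfX p j | inr j => vfY p j end
  | i < n + n].

Definition horizontal_space p : {vspace heis R n} := <<hframe p>>%VS.

(* The norm on the horizontal space for which [hframe p] is orthonormal;
   only meaningful for horizontal [v]. *)
Definition horizontal_norm p v : R :=
  Num.sqrt (\sum_(i < n + n) coord (hframe p) i v ^+ 2).

(* Absolute continuity gives differentiability almost everywhere; it is
   repeated because [derive1 gamma] has a junk value elsewhere. *)
Definition horizontal_curve (a b : R) gamma :=
  absolutely_continuous a b gamma /\
  {ae lebesgue_measure, forall s : R, s \in `[a, b] ->
    derivable gamma s 1 /\ derive1 gamma s \in horizontal_space (gamma s)}.

Definition curve_length (a b : R) gamma : \bar R :=
  (\int[lebesgue_measure]_(s in `[a, b])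
    (horizontal_norm (gamma s) (derive1 gamma s))%:E)%E.

Definition dcc p q : \bar R :=
  ereal_inf [set l | exists a b gamma,
    [/\ a < b, horizontal_curve a b gamma, gamma a = p, gamma b = q
      & l = curve_length a b gamma]].

End heisenberg.

Section heisenberg_theory.
Context {R : realType} {n : nat}.
Implicit Types p v : heis R n.

Let ixE (j : 'I_n) : ix j = j.*2 :> nat.
Proof. by rewrite inordK// ltnS leq_double ltnW. Qed.

Let iyE (j : 'I_n) : iy j = j.*2.+1 :> nat.
Proof. by rewrite inordK// ltnS ltn_double. Qed.

Let ix_eq (i j : 'I_n) : (ix i == ix j) = (i == j).
Proof. by rewrite -val_eqE/= !ixE (inj_eq double_inj). Qed.

Let iy_eq (i j : 'I_n) : (iy i == iy j) = (i == j).
Proof. by rewrite -val_eqE/= !iyE eqSS (inj_eq double_inj). Qed.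

Let ix_iy (i j : 'I_n) : (ix i == iy j) = false.
Proof.
by apply/eqP => /(congr1 val)/(congr1 odd); rewrite /= ixE iyE/= !odd_double.
Qed.

Let iy_ix (i j : 'I_n) : (iy i == ix j) = false.
Proof. by rewrite eq_sym ix_iy. Qed.

Let ix_it (i : 'I_n) : (ix i == it n) = false.
Proof. by rewrite -val_eqE/= ixE (inj_eq double_inj) ltn_eqF. Qed.

Let iy_it (i : 'I_n) : (iy i == it n) = false.
Proof.
by apply/eqP => /(congr1 val)/(congr1 odd); rewrite /= iyE/= !odd_double.
Qed.

Let nth_hframe p (i : 'I_(n + n)) : (hframe p)`_i =
  match fintype.split i with inl j => vfX p j | inr j => vfY p j end.
Proof. by rewrite -(tnth_nth 0 (hframe p)) tnth_mktuple. Qed.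

Lemma hframe_sumE p (c : 'I_(n + n) -> R) :
  \sum_i c i *: (hframe p)`_i =
  \sum_(j < n) (c (lshift n j) *: vfX p j + c (rshift n j) *: vfY p j).
Proof.
rewrite big_split_ord/= big_split/=; congr (_ + _); apply: eq_bigr => j _.
  by rewrite (nth_hframe p (lshift n j)) (unsplitK (inl j)).
by rewrite (nth_hframe p (rshift n j)) (unsplitK (inr j)).
Qed.

Let sum_ix p (c : 'I_(n + n) -> R) j :
  (\sum_i c i *: (hframe p)`_i) 0 (ix j) = c (lshift n j).
Proof.
rewrite hframe_sumE summxE (bigD1 j)//= big1 ?addr0 => [|i /negPf ij];
  rewrite !mxE/= !(ix_eq, ix_iy, ix_it) ?eqxx ?[j == _]eq_sym ?ij;
  by rewrite !(mulr0, mulr1, addr0, subr0).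
Qed.

Let sum_iy p (c : 'I_(n + n) -> R) j :
  (\sum_i c i *: (hframe p)`_i) 0 (iy j) = c (rshift n j).
Proof.
rewrite hframe_sumE summxE (bigD1 j)//= big1 ?addr0 => [|i /negPf ij];
  rewrite !mxE/= !(iy_eq, iy_ix, iy_it);
  rewrite ?eqxx ?[j == _]eq_sym ?ij;
  by rewrite !(oppr0, mulr0, mulr1, addr0, subr0, add0r).
Qed.

Let sum_it p (c : 'I_(n + n) -> R) :
  (\sum_i c i *: (hframe p)`_i) 0 (it n) =
  2 * \sum_(j < n) (p 0 (iy j) * c (lshift n j) - p 0 (ix j) * c (rshift n j)).
Proof.
rewrite hframe_sumE summxE mulr_sumr; apply: eq_bigr => j _.
rewrite !mxE/= !(eq_sym (it n)) !(ix_it, iy_it) eqxx/=.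
by rewrite !(mulr0, mulr1, add0r, sub0r); ring.
Qed.

Lemma hframe_free p : free (hframe p).
Proof.
apply/freeP => c c0 i; rewrite -(splitK i); case: (fintype.split i) => j /=.
  by rewrite -(sum_ix p) c0 mxE.
by rewrite -(sum_iy p) c0 mxE.
Qed.

Lemma horizontal_spaceE p v :
  (v \in horizontal_space p) = (contact_form p v == 0).
Proof.
apply/idP/eqP => [/coord_span->|v0].
  rewrite /contact_form sum_it -mulrDr -big_split/= big1 ?mulr0// => j _.
  by rewrite sum_ix sum_iy; ring.
pose c i := match fintype.split i with
  inl j => v 0 (ix j) | inr j => v 0 (iy j) end.
suff -> : v = \sum_i c i *: (hframe p)`_i.
  by apply: memv_suml => i _; apply/memvZ/memv_span/mem_nth; rewrite size_tuple.
have cl j : c (lshift n j) = v 0 (ix j) by rewrite /c (unsplitK (inl j)).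
have cr j : c (rshift n j) = v 0 (iy j) by rewrite /c (unsplitK (inr j)).
apply/rowP => i; have := ltn_ord i; rewrite ltnS leq_eqVlt => /orP[/eqP iE|iE].
  have -> : i = it n by apply/val_inj.
  rewrite sum_it; move/eqP: v0; rewrite addr_eq0 => /eqP ->.
  rewrite -mulrN -sumrN; congr (_ * _); apply: eq_bigr => j _.
  by rewrite opprB cl cr.
have i2 : (i./2 < n)%N by rewrite ltn_half_double.
case oi : (odd i).
  have -> : i = iy (Ordinal i2).
    by apply/val_inj; rewrite /= iyE/= -[LHS]odd_double_half oi.
  by rewrite sum_iy cr.
have -> : i = ix (Ordinal i2).
  by apply/val_inj; rewrite /= ixE/= -[LHS]odd_double_half oi.
by rewrite sum_ix cl.
Qed.

Lemma horizontal_normE p v : contact_form p v = 0 ->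
  horizontal_norm p v =
  Num.sqrt (\sum_(j < n) (v 0 (ix j) ^+ 2 + v 0 (iy j) ^+ 2)).
Proof.
move=> /eqP; rewrite -horizontal_spaceE => /coord_span vE.
rewrite /horizontal_norm big_split_ord/= -big_split/=; congr Num.sqrt.
apply: eq_bigr => j _.
have -> : v 0 (ix j) = coord (hframe p) (lshift n j) v.
  by rewrite [in LHS]vE sum_ix.
suff -> : v 0 (iy j) = coord (hframe p) (rshift n j) v by [].
by rewrite [in LHS]vE sum_iy.
Qed.

End heisenberg_theory.

(* Without a normalizing constant: the classical normalizations differ from it
   by a positive finite factor. *)
Section hausdorff_measure.
Context {R : realType} {T : Type}.
Variables (d : T -> T -> \bar R) (k : nat).
Local Open Scope ereal_scope.

Definition diameter (A : set T) : \bar R :=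
  ereal_sup [set r | r = 0 \/ exists x y, [/\ A x, A y & r = d x y]].

(* The empty set weighs 0 also when [k = 0], so that finite covers can be
   padded. *)
Definition hausdorff_weight (A : set T) : \bar R :=
  if `[< A = set0 >] then 0 else diameter A ^+ k.

Definition hausdorff_content (delta : R) (A : set T) : \bar R :=
  ereal_inf [set r | exists C : nat -> set T,
    [/\ A `<=` \bigcup_i C i, forall i, diameter (C i) <= delta%:E
      & r = \sum_(i <oo) hausdorff_weight (C i)]].

Definition hausdorff_measure (A : set T) : \bar R :=
  ereal_sup [set hausdorff_content delta A | delta in [set r : R | (0 < r)%R]].

End hausdorff_measure.

(* Main.v *)
(* Let [Q] be a dyadic cell of side [r], [A] a matrix with entries at most [a],
   and [M] the [L^q] mean over [Q] of [Df - A], where [q > k].  Morrey's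
   inequality shows that [f] is affine with slope [A] on [Q] up to [C r M].  By
   the contact equation the weak gradient of [y |-> t (f x ^-1 * f y)] is
   [-2 omega (f y - f x, Df y)], so that this function is at most
   [C r^2 M (a + M)] on [Q]; and since weak derivatives commute, the rows of [A]
   satisfy [|omega (A_b, A_c)| <= C M (a + M)].  The range of [A] is thus nearly
   isotropic and, because [k > n], there is a direction [v] along which [A]
   nearly vanishes.  Cut [Q] into at most [(3 N)^(k-1)] slabs of thickness
   [r / N] parallel to [v]: their images have Carnot-Caratheodory diameter at
   most [C r (a / N + N M)], hence
   [sum diam^k <= C r^k (a^k / N + N^(2 k - 1) M^k)].  Summed over the cells of
   a fine subdivision, with [A] read off a dyadic step function close to [Df] in
   [L^q], this is as small as we want: choose [N] first, then the step
   function. *)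

Require Import Defs.
From HB Require Import structures.
From mathcomp Require Import all_boot all_order all_algebra.
From mathcomp Require Import all_classical all_reals all_analysis.
From mathcomp Require Import measurable_realfun ess_sup_inf.
From mathcomp Require Import ring lra zify.

Set Implicit Arguments.
Unset Strict Implicit.
Unset Printing Implicit Defensive.

Import Order.TTheory GRing.Theory Num.Theory.
Import numFieldNormedType.Exports.

Local Open Scope classical_set_scope.
Local Open Scope ring_scope.

(** * Smooth cut-off functions *)

Section smooth1.
Context {R : realType}.
Implicit Types (f g h : R -> R) (m : nat).

(** On a cell only an [L^q] mean of [Df - A] is given, and the gradient of [y |-> gap (f x) (f y)]
    is known only through an almost everywhere bound. Morrey's inequality is therefore stated for
    gradients whose [L^1] averages over subcells grow at most like [rho ^ l]: this passes to
    dominated functions, and an [L^q] mean yields it with [rho = 2 ^ (k / q)], which is below 2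
    because [q > k]. The direction along which [A] nearly vanishes does not come from the rank of
    [A], which is unstable, but from an exact linear system for a pair [v], [w]: if the horizontal
    part of [v A] is that of [w A] rotated by the complex structure, then [omega (w A) (v A)] is a
    square norm, and near isotropy makes it small. The resulting bound [sqrt (M (a + M))] is the
    geometric mean of [(a + M) / N] and [N M], hence the form [a / N + N M] of the diameters. In the
    final sum [q > k] serves again: [M ^ k] is at most a small constant plus a multiple of
    [M ^ q]. *)

Fixpoint C1 m h : Prop :=
  if m is m'.+1 then
    exists2 h' : R -> R, (forall x : R, is_derive x (1 : R) h (h' x)) & C1 m' h'
  else continuous h.

Definition smooth h := forall m, C1 m h.

Lemma is_derive_continuous h h' :
  (forall x : R, is_derive x (1 : R) h (h' x)) -> continuous h.
Proof.
by move=> hh' x; apply/differentiable_continuous/derivable1_diffP.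
Qed.

Lemma C1_weaken m h : C1 m.+1 h -> C1 m h.
Proof.
elim: m => [|m IHm] in h *; first by case=> h' + _; exact: is_derive_continuous.
by case=> h' hh' /IHm C1h'; exists h'.
Qed.

Lemma smooth_continuous h : smooth h -> continuous h.
Proof. by move/(_ 0). Qed.

Lemma smooth_is_derive h x : smooth h -> is_derive x (1 : R) h (derive1 h x).
Proof. by move=> /(_ 1)[h' hh' _]; rewrite derive1E; apply: derivableP. Qed.

Lemma smooth_derive h : smooth h -> smooth (derive1 h).
Proof.
move=> sh m; have [h' hh' C1h'] := sh m.+1.
suff -> : derive1 h = h' by [].
by apply/funext => x; rewrite derive1E derive_val.
Qed.

Lemma C1D m f g : C1 m f -> C1 m g -> C1 m (fun x => f x + g x).
Proof.
elim: m => [|m IHm] in f g *.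
  by move=> cf cg x; apply: continuousD; [exact: cf|exact: cg].
move=> [f' ff' C1f'] [g' gg' C1g'].
exists (fun x => f' x + g' x); last exact: IHm.
by move=> x; apply: is_deriveD.
Qed.

Lemma C1M m f g : C1 m f -> C1 m g -> C1 m (fun x => f x * g x).
Proof.
elim: m => [|m IHm] in f g *.
  by move=> cf cg x; apply: continuousM; [exact: cf|exact: cg].
move=> C1f C1g; have [f' ff' C1f'] := C1f; have [g' gg' C1g'] := C1g.
exists (fun x => f x * g' x + g x * f' x).
  by move=> x; apply: is_deriveM.
by apply: C1D; apply: IHm => //; exact: C1_weaken.
Qed.

Lemma C1_cst m c : C1 m (fun=> c).
Proof.
elim: m => [|m IHm] in c *; first exact: cst_continuous.
by exists (fun=> 0) => // x; exact: is_derive_cst.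
Qed.

Lemma C1_affine m a b : C1 m (fun x => a * x + b).
Proof.
case: m => [|m].
  by move=> x; apply: continuousD; [exact: mulrl_continuous|exact: cst_continuous].
exists (fun=> a); last exact: C1_cst.
move=> x; have -> : a = a *: (1 : R) + 0 by rewrite addr0 /GRing.scale/= mulr1.
rewrite /GRing.scale/= mulr1 addr0.
have := @is_deriveD _ _ _ (a \*: id) (cst b) x 1 _ _ (is_deriveZ a (is_derive_id x 1)) (is_derive_cst b x 1).
by rewrite /GRing.scale/= mulr1 addr0.
Qed.

Lemma C1_comp m f g : C1 m f -> C1 m g -> C1 m (fun x => f (g x)).
Proof.
elim: m => [|m IHm] in f g *.
  by move=> cf cg x; apply: continuous_comp; [exact: cg|exact: cf].
move=> [f' ff' C1f'] C1g; have [g' gg' C1g'] := C1g.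
exists (fun x => f' (g x) * g' x).
  by move=> x; exact: (@is_derive1_comp R f g).
by apply: C1M => //; apply: IHm => //; exact: C1_weaken.
Qed.

Lemma C1V m f : (forall x, f x != 0) -> C1 m f -> C1 m (fun x => (f x)^-1).
Proof.
move=> f0; elim: m => [|m IHm] in f f0 *.
  by move=> cf x; apply: continuousV; [exact: f0|exact: cf].
move=> C1f; have [f' ff' C1f'] := C1f.
have C1V : C1 m (fun x => (f x)^-1) by apply: IHm => //; exact: C1_weaken.
exists (fun x => (-1) * (((f x)^-1 * (f x)^-1) * f' x)).
  move=> x; have := is_deriveV (f0 x) (ff' x).
  by rewrite /GRing.scale/= expr2 invfM mulN1r mulNr.
by apply: C1M; [exact: C1_cst|apply: C1M => //; exact: C1M].
Qed.

(** This family is closed under differentiation, which only replaces [P] by X^2 (P - P'); a single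
    induction over all [P] then gives smoothness. *)
Let E (P : {poly R}) (x : R) : R := if 0 < x then P.[x^-1] * expR (- x^-1) else 0.

(** The inequality exp (y / n) >= 1 + y / n >= y / n, raised to the power [n]. *)
Lemma exprn_expRN n (y : R) : 0 <= y -> y ^+ n * expR (- y) <= n%:R ^+ n.
Proof.
case: n => [|n] y0; first by rewrite !expr0 mul1r -expR0 ler_expR oppr_le0.
have n0 : 0 < n.+1%:R :> R by [].
rewrite expRN -ler_pdivlMr ?invr_gt0 ?expR_gt0// invrK.
have -> : expR y = expR (y / n.+1%:R) ^+ n.+1.
  by rewrite -expRM_natl mulrC divfK ?gt_eqF.
rewrite -exprMn lerXn2r ?nnegrE ?mulr_ge0 ?expR_ge0//.
have := expR_ge1Dx (y / n.+1%:R); rewrite -ler_pdivrMl//.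
by rewrite mulrC; apply: le_trans; rewrite lerDr.
Qed.

Let E_bounded P : exists2 C : R, 0 <= C & forall x, `|E P x| <= C.
Proof.
exists (\sum_(i < size P) `|P`_i| * i%:R ^+ i).
  by apply: sumr_ge0 => i _; rewrite mulr_ge0// exprn_ge0.
move=> x; rewrite /E; case: ltP => [x0|_]; last first.
  by rewrite normr0; apply: sumr_ge0 => i _; rewrite mulr_ge0// exprn_ge0.
rewrite horner_coef mulr_suml (le_trans (ler_norm_sum _ _ _))//.
apply: ler_sum => i _; rewrite -mulrA normrM ler_wpM2l//.
have xV0 : 0 <= x^-1 by rewrite invr_ge0 ltW.
by rewrite ger0_norm ?mulr_ge0 ?exprn_ge0 ?expR_ge0// exprn_expRN.
Qed.

Let E_derive P x : is_derive x (1 : R) (E P) (E ('X^2 * (P - P^`())) x).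
Proof.
have [x0|x0|->] := ltrgtP x 0.
- have -> : E ('X^2 * (P - P^`())) x = 0 by rewrite /E ltNge (ltW x0).
    have nE : {near x, cst 0 =1 E P}.
    by near=> y; rewrite /E ltNge ltW//=; near: y; exact: lt_nbhsl.
  have dE : derivable (E P) x 1.
    by apply: (near_eq_derivable nE); exact: derivable_cst.
  apply: DeriveDef => //.
  by rewrite -(near_eq_derive _ nE) derive_cst.
- have nE : {near x, (fun y => P.[y^-1] * expR (- y^-1)) =1 E P}.
    by near=> y; rewrite /E ifT//; near: y; exact: lt_nbhsr.
  have x0' : x != 0 by rewrite gt_eqF.
  have dV : is_derive x 1 (fun y : R => y^-1) (- x ^- 2).
    apply: is_derive_eq; first exact: is_deriveV.
    by rewrite /GRing.scale/= mulr1.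
  have dP : is_derive x 1 (fun y : R => P.[y^-1]) (P^`().[x^-1] * (- x ^- 2)).
    exact: (@is_derive1_comp R (horner P) (fun y => y^-1)).
  have de : is_derive x 1 (fun y : R => expR (- y^-1))
      (expR (- x^-1) * - (- x ^- 2)).
    exact: (@is_derive1_comp R expR (fun y => - y^-1)).
  have dF := is_deriveM dP de.
  have dE : derivable (E P) x 1.
    by apply: (near_eq_derivable nE); exact: ex_derive.
  apply: DeriveDef => //.
  rewrite -(near_eq_derive _ nE) derive_val /E x0 !hornerE.
  by rewrite /GRing.scale/= exprVn; ring.
(* At the origin, boundedness of the member of the family attached to X^2 P means that [E P] is
   quadratically small, so the difference quotient tends to 0. *)
- have [C C0 EC] := E_bounded ('X^2 * P).
  have {}EC y : `|E P y| <= C * y ^+ 2.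
    have := EC y; rewrite /E; case: ifP => [y0|_ _]; last first.
      by rewrite normr0 mulr_ge0// sqr_ge0.
    rewrite hornerM hornerXn -mulrA normrM exprVn ger0_norm ?invr_ge0 ?sqr_ge0//.
    by rewrite ler_pdivrMl ?exprn_gt0// [C * _]mulrC.
  have E0 Q : E Q 0 = 0 by rewrite /E ltxx.
  rewrite E0.
  suff cv : h^-1 *: (E P (h *: 1 + 0) - E P 0) @[h --> 0^'] --> (0 : R).
    apply: DeriveDef; first by apply/cvg_ex; exists 0.
    exact: cvg_lim cv.
  apply/cvgrPdist_le => e e0; near=> h.
  have h0 : h != 0 by near: h; exact: nbhs_dnbhs_neq.
  rewrite sub0r normrN E0 subr0 addr0 /GRing.scale/= mulr1 normrM normfV.
  rewrite ler_pdivrMl ?normr_gt0// (le_trans (EC h))//.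
  rewrite -[h ^+ 2]real_normK ?num_real// expr2 mulrA [leRHS]mulrC.
  rewrite ler_pM2r ?normr_gt0// (@le_trans _ _ ((C + 1) * `|h|))//.
    by rewrite ler_wpM2r// lerDl.
  rewrite -ler_pdivlMl; last by rewrite ltr_wpDl.
  near: h; apply: dnbhs0_le; rewrite mulr_gt0// invr_gt0 ltr_wpDl//.
Unshelve. all: by end_near.
Qed.


Let E_smooth P : smooth (E P).
Proof.
move=> m; elim: m => [|m IHm] in P *.
  by apply: is_derive_continuous => x; exact: E_derive.
by exists (E ('X^2 * (P - P^`()))) => // x; exact: E_derive.
Qed.

(** The quotient [e / (e + e')], where [e] vanishes for [x <= 1/4] and [e'] for [x >= 3/4], but
    never both at once. The margin of 1/4 on each side later keeps the rescaled bumps away from the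
    faces of their cells. *)
Lemma smooth_step_exists : exists N : R -> R, [/\ smooth N,
  forall x, x <= 4^-1 -> N x = 0, forall x, 3 / 4 <= x -> N x = 1
  & forall x, 0 <= N x <= 1].
Proof.
pose e x := E 1 (x - 4^-1); pose e' x := E 1 (3 / 4 - x).
have se : smooth e.
  move=> m; apply: C1_comp; first exact: E_smooth.
  by have := @C1_affine m 1 (- 4^-1); under eq_fun do rewrite mul1r.
have se' : smooth e'.
  move=> m; apply: C1_comp; first exact: E_smooth.
  by have := @C1_affine m (-1) (3 / 4); under eq_fun do rewrite mulN1r addrC.
have E1_ge0 x : 0 <= E 1 x.
  by rewrite /E; case: ifP => // _; rewrite hornerC mul1r expR_ge0.
have E1_gt0 x : 0 < x -> 0 < E 1 x.
  by rewrite /E => ->; rewrite hornerC mul1r expR_gt0.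
have E1_0 x : x <= 0 -> E 1 x = 0 by rewrite /E ltNge => ->.
have ee'_gt0 x : 0 < e x + e' x.
  have [x1|x1] := ltP 4^-1 x.
    by rewrite ltr_pwDl// ?E1_ge0// E1_gt0// subr_gt0.
  by rewrite ltr_wpDl// ?E1_ge0// E1_gt0// subr_gt0; lra.
exists (fun x => e x * (e x + e' x)^-1); split.
- move=> m; apply: C1M; first exact: se.
  apply: C1V; first by move=> x; rewrite gt_eqF.
  by apply: C1D; [exact: se|exact: se'].
- by move=> x x1; rewrite /e E1_0 ?mul0r// subr_le0.
- move=> x x3; have := ee'_gt0 x.
  by rewrite /e' E1_0 ?subr_le0// addr0 => ex; rewrite divff// gt_eqF.
- move=> x; rewrite divr_ge0 ?E1_ge0 ?(ltW (ee'_gt0 x))//=.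
  by rewrite ler_pdivrMr// mul1r lerDl E1_ge0.
Qed.

End smooth1.

(** * Weak derivatives tested on products of bumps *)

Section compactly_supported1.
Context {R : realType}.
Implicit Types (a b x : R) (f h : R -> R).
Notation mu := (@lebesgue_measure R).

Definition supp_itv a b f := forall x, ~~ (a <= x <= b) -> f x = 0.

Lemma supp_itv_bounded a b f : continuous f -> supp_itv a b f ->
  exists2 C : R, 0 <= C & forall x, `|f x| <= C.
Proof.
move=> cf sf; have [ab|ba] := leP a b; last first.
  exists 0 => // x; rewrite sf ?normr0//.
  by apply/negP => /andP[/le_trans/[apply]]; rewrite leNgt ba.
have cnf : {within `[a, b], continuous (fun x => `|f x|)}.
  apply: continuous_subspaceT => x.
  by apply: continuous_comp; [exact: cf|exact: norm_continuous].
have [c _ fc] := EVT_max ab cnf.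
exists `|f c| => // x; have [xab|xab] := boolP (a <= x <= b).
  by apply: fc; rewrite in_itv.
by rewrite sf// normr0.
Qed.

Lemma supp_itv_integrable a b f : continuous f -> supp_itv a b f ->
  mu.-integrable setT (EFin \o f).
Proof.
move=> cf sf.
have iab : mu.-integrable `[a, b] (EFin \o f).
  apply: continuous_compact_integrable; first exact: segment_compact.
  exact: continuous_subspaceT.
have -> : EFin \o f = (EFin \o f) \_ `[a, b].
  apply/funext => x; rewrite /patch/=; case: ifPn => //; rewrite notin_setE/= in_itv/= => /negP xab.
  by rewrite sf.
by rewrite -integrable_mkcond//; exact: measurable_itv.
Qed.

Lemma supp_itv_FTC a b f F : a < b -> continuous f -> supp_itv a b f ->
  (forall x, is_derive x (1 : R) F (f x)) ->
  \int[mu]_x f x = F b - F a.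
Proof.
move=> ab cf sf Ff.
have -> : \int[mu]_x f x = \int[mu]_(x in `[a, b]) f x.
  rewrite [RHS]Rintegral_mkcond; apply: eq_Rintegral => x _.
  rewrite /patch; case: ifPn => //; rewrite notin_setE/= in_itv/= => /negP xab.
  by rewrite sf.
have cF : continuous F by exact: is_derive_continuous.
rewrite /Rintegral (@continuous_FTC2 _ f F)//.
- exact: continuous_subspaceT.
- split.
  + by move=> x _; exact: ex_derive.
  + exact/cvg_at_right_filter/cF.
  + exact/cvg_at_left_filter/cF.
- by move=> x _; rewrite derive1E derive_val.
Qed.

Definition bump1 a b h := smooth h /\ supp_itv a b h.

Lemma bump_derive a b h : bump1 a b h -> bump1 a b (derive1 h).
Proof.
move=> [sh zh]; split; first exact: smooth_derive.
move=> x xab; rewrite derive1E -(@near_eq_derive _ _ _ (cst 0)) ?derive_cst//.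
move: xab; rewrite negb_and -!ltNge => /orP[xa|bx].
- near=> y; rewrite zh// negb_and -ltNge; apply/orP; left.
  by near: y; exact: lt_nbhsl.
- near=> y; rewrite zh// negb_and -!ltNge; apply/orP; right.
  by near: y; exact: lt_nbhsr.
Unshelve. all: by end_near.
Qed.

Lemma supp_itvW a b a' b' f : a' <= a -> b <= b' ->
  supp_itv a b f -> supp_itv a' b' f.
Proof.
move=> aa bb sf x xab; apply: sf; apply: contra xab => /andP[ax xb].
by rewrite (le_trans aa)//= (le_trans xb).
Qed.

(** Widening provides [a' < b'] even if [b <= a], and makes the boundary terms of the fundamental
    theorem of calculus vanish. *)
Let wide a b h : supp_itv a b h -> exists a' b', [/\ a' < b', supp_itv a' b' h,
  h a' = 0 & h b' = 0].
Proof.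
move=> sh; exists (Num.min a b - 1), (Num.max a b + 1).
have aa : Num.min a b - 1 < a by rewrite ltrBlDr ltr_pwDr// ge_min lexx.
have bb : b < Num.max a b + 1 by rewrite ltr_pwDr// le_max lexx orbT.
split.
- rewrite ltrBlDr -addrA ltr_pwDr//.
  by rewrite ge_min le_max lexx.
- by apply: supp_itvW sh; exact: ltW.
- by apply: sh; rewrite negb_and -ltNge aa.
- by apply: sh; rewrite negb_and -!ltNge bb orbT.
Qed.

Lemma Rintegral_bump_derive a b h : bump1 a b h -> \int[mu]_x derive1 h x = 0.
Proof.
move=> bh; have [sh _] := bh; have [sh' zh'] := bump_derive bh.
have [a' [b' [ab' s0 ha hb]]] := wide bh.2.
have s1 := (@bump_derive a' b' h (conj sh s0)).2.
rewrite (supp_itv_FTC ab' _ s1 (fun x => smooth_is_derive x sh)) ?ha ?hb ?subrr//.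
exact: smooth_continuous.
Qed.

Lemma Rintegral_id_bump_derive a b h : bump1 a b h ->
  \int[mu]_x (x * derive1 h x) = - \int[mu]_x h x.
Proof.
move=> bh; have [sh zh] := bh; have [sh' zh'] := bump_derive bh.
have ch := smooth_continuous sh; have ch' := smooth_continuous sh'.
have [a' [b' [ab' s0 ha hb]]] := wide bh.2.
have s1 := (@bump_derive a' b' h (conj sh s0)).2.
have cxh' : continuous (fun x => x * derive1 h x).
  by move=> x; apply: continuousM; [exact: cvg_id|exact: ch'].
have sxh' : supp_itv a b (fun x => x * derive1 h x).
  by move=> x xab; rewrite zh' ?mulr0.
apply/eqP; rewrite -addr_eq0 -RintegralD//; last 2 first.
- exact: supp_itv_integrable sxh'.
- exact: supp_itv_integrable zh.
have E := @supp_itv_FTC a' b' (fun x => x * derive1 h x + h x) (fun x => x * h x) ab'.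
apply/eqP; rewrite [LHS](_ : _ = b' * h b' - a' * h a'); last apply: E.
- by rewrite ha hb !mulr0 subrr.
- by move=> x; exact: (@continuousD _ _ _ (fun x => x * derive1 h x) h x (cxh' x) (ch x)).
- by move=> x xab; rewrite s0// s1// mulr0 addr0.
- move=> x; have := is_deriveM (is_derive_id x (1 : R)) (smooth_is_derive x sh).
  by rewrite /GRing.scale/= mulr1.
Qed.

End compactly_supported1.

Section product_functions.
Context {R : realType} {k : nat}.
Implicit Types (h : 'I_k -> R -> R) (a b : 'I_k -> R).

Definition prodf h (x : 'rV[R]_k) : R := \prod_i h i (x 0 i).

(** The factors of the [i]-th partial derivative of [prodf h]: product functions are closed under
    partial differentiation. *)
Definition dfam (i : 'I_k) h := fun j => if j == i then derive1 (h j) else h j.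

Definition bumps a b h := forall i, bump1 (a i) (b i) (h i).

Definition cbox a b := [set x : 'rV[R]_k | forall i, a i <= x 0 i <= b i].

Lemma bumps_dfam a b h i : bumps a b h -> bumps a b (dfam i h).
Proof. by move=> bh j; rewrite /dfam; case: eqP => // _; exact: bump_derive. Qed.

Lemma prodf_supp a b h x : bumps a b h -> ~ cbox a b x -> prodf h x = 0.
Proof.
move=> bh /existsNP[i /negP xi]; rewrite /prodf (bigD1 i)//=.
by rewrite (bh i).2// mul0r.
Qed.

Lemma continuous_prodf h : (forall i, continuous (h i)) -> continuous (prodf h).
Proof.
move=> ch x; rewrite /prodf; elim: (index_enum _) => [|i s IHs].
  under eq_fun do rewrite big_nil; exact: cst_continuous.
under eq_fun do rewrite big_cons.
apply: continuousM => //.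
apply: (@continuous_comp _ _ _ (fun x : 'rV[R]_k => x 0 i) (h i)).
  exact: coord_continuous.
exact: ch.
Qed.

Lemma is_derive_prodf h (i : 'I_k) x : smooth (h i) ->
  is_derive x (delta_mx 0 i : 'rV[R]_k) (prodf h) (prodf (dfam i h) x).
Proof.
move=> sh; set v := delta_mx _ _.
pose P := \prod_(j | j != i) h j (x 0 j).
have prodfE t : prodf h (t *: v + x) = P * h i (t + x 0 i).
  rewrite /prodf (bigD1 i)//= mulrC; congr (_ * _).
    apply: eq_bigr => j ji; congr (h j _).
    by rewrite !mxE eqxx (negbTE ji) mulr0 add0r.
  by rewrite !mxE !eqxx mulr1.
have dfamE : prodf (dfam i h) x = P * derive1 (h i) (x 0 i).
  rewrite /prodf (bigD1 i)//= mulrC /dfam eqxx; congr (_ * _).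
  by apply: eq_bigr => j /negbTE ->.
have D : is_derive (0 : R) (1 : R) (fun t => prodf h (t *: v + x)) (prodf (dfam i h) x).
  rewrite dfamE; under eq_fun do rewrite prodfE.
  have dsh : is_derive (0 : R) (1 : R) (fun t => t + x 0 i) 1.
    have := is_deriveD (is_derive_id (0 : R) (1 : R)) (is_derive_cst (x 0 i) (0 : R) (1 : R)).
    by rewrite addr0.
  have dh : is_derive ((0 : R) + x 0 i) (1 : R) (h i) (derive1 (h i) (x 0 i)).
    by rewrite add0r; exact: smooth_is_derive.
  have := is_deriveZ P (@is_derive1_comp R (h i) (fun t => t + x 0 i) 0 _ _ dh dsh).
  by rewrite mulr1.
have [dD eD] := D.
apply: DeriveDef; first exact/derivable1P.
rewrite -eD /derive; apply: (congr1 (fun F : R -> R => lim (F @ (0 : R)^'))).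
apply/funext => t /=.
by rewrite scale0r addr0 /GRing.scale/= mulr1 add0r.
Qed.

Lemma derive_prodf h (i : 'I_k) : smooth (h i) ->
  'D_(delta_mx 0 i : 'rV[R]_k) (prodf h) = prodf (dfam i h).
Proof.
by move=> sh; apply/funext => x; have [_ ->] := is_derive_prodf x sh.
Qed.

Lemma prodf_Ck h m : (forall i, smooth (h i)) -> Ck m (prodf h).
Proof.
elim: m => [|m IHm] in h * => sh /=.
  by apply: continuous_prodf => i; exact: smooth_continuous.
split; first by apply: continuous_prodf => i; exact: smooth_continuous.
move=> i; split; first by move=> x; have [] := is_derive_prodf x (sh i).
rewrite derive_prodf//; apply: IHm => j.
by rewrite /dfam; case: eqP => // _; exact: smooth_derive.
Qed.

Lemma compact_cbox a b : compact (cbox a b).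
Proof.
have -> : cbox a b = [set v | forall i, `[a i, b i]%classic (v ord0 i)].
  by apply/seteqP; split => x /= xab i; have := xab i; rewrite /= in_itv.
apply: (@rV_compact R k (fun i => `[a i, b i]%classic)) => i.
exact: segment_compact.
Qed.

Lemma test_function_prodf Omega a b h : bumps a b h -> cbox a b `<=` Omega ->
  test_function Omega (prodf h).
Proof.
move=> bh abO; split; first by move=> m; apply: prodf_Ck => i; have [] := bh i.
exists (cbox a b); split => //; first exact: compact_cbox.
by move=> x; exact: prodf_supp.
Qed.

Lemma prodf_bounded a b h : bumps a b h ->
  exists2 C : R, 0 <= C & forall x, `|prodf h x| <= C.
Proof.
move=> bh.
have /choice[C hC] : forall i, exists C : R, 0 <= C /\ forall x, `|h i x| <= C.
  move=> i; have [/smooth_continuous ch sh] := bh i.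
  by have [C ? ?] := supp_itv_bounded ch sh; exists C.
exists (\prod_i C i); first by apply: prodr_ge0 => i _; have [] := hC i.
move=> x; rewrite /prodf normr_prod; apply: ler_prod => i _.
by rewrite normr_ge0; have [_ ->] := hC i.
Qed.

Lemma measurable_prodf h : (forall i, measurable_fun setT (h i)) ->
  measurable_fun [set: 'rV[R]_k] (prodf h).
Proof.
move=> ch; rewrite /prodf; elim: (index_enum _) => [|i s IHs].
  by under eq_fun do rewrite big_nil; exact: measurable_cst.
under eq_fun do rewrite big_cons.
apply: measurable_funM => //.
exact: (measurableT_comp (ch i) (measurable_rV_coord i)).
Qed.

End product_functions.

Section product_integral.
Context {R : realType}.
Notation mu := (@lebesgue_measure R).

(** Induction on [k]: each further coordinate enters [lebesgue_rV] through a push-forward of a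
    product measure, and Fubini's theorem splits off its factor. Integrability is carried along
    because Fubini's theorem asks for it. *)
Lemma integral_prodf k (h : 'I_k -> R -> R) :
  (forall i, measurable_fun setT (h i)) ->
  (forall i, mu.-integrable setT (EFin \o h i)) ->
  (lebesgue_rV R k).-integrable setT (EFin \o prodf h) /\
  \int[lebesgue_rV R k]_x prodf h x = \prod_i \int[mu]_x h i x.
Proof.
elim: k => [|k IHk] in h *.
  move=> _ _; have -> : prodf h = cst 1.
    by apply/funext => x; rewrite /prodf big_ord0.
  rewrite big_ord0; split.
    apply: measurable_bounded_integrable => //.
    + by rewrite /= diracT ltry.
    + exact: bounded_cst.
  rewrite Rintegral_cst// mul1r.
  exact: (congr1 fine (@diracT _ _ R (0 : 'rV[R]_0))).
move=> mh ih.
pose h' (i : 'I_k) := h (lift ord0 i).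
have [ih' Ih'] := IHk h' (fun i => mh _) (fun i => ih _).
pose f : (R * 'rV[R]_k)%type -> R := fun xv => h ord0 xv.1 * prodf h' xv.2.
have prodfE : prodf h \o (@rV_cons _ R k) = f.
  apply/funext => -[x v]; rewrite /prodf /f /= big_ord_recl mxE unlift_none.
  by congr (_ * _); apply: eq_bigr => i _; rewrite mxE liftK.
have mp : measurable_fun setT (prodf h').
  by have /measurable_EFinP := measurable_int _ ih'.
have mf : measurable_fun setT f.
  apply: measurable_funM; first exact: measurableT_comp (mh _) measurable_fst.
  exact: measurableT_comp mp measurable_snd.
have mph : measurable_fun setT (prodf h) by exact: measurable_prodf.
have /integrableP[_ ih0] := ih ord0.
have /integrableP[_ iph'] := ih'.
have mf' : measurable_fun setT (EFin \o f) by exact/measurable_EFinP.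
have m0 : measurable_fun setT (EFin \o h ord0) by exact/measurable_EFinP.
have mp' : measurable_fun setT (EFin \o prodf h') by exact/measurable_EFinP.
have intf : (lebesgue_measure \x lebesgue_rV R k)%E.-integrable setT (EFin \o f).
  apply/integrable12ltyP => //=.
  have E x : (\int[lebesgue_rV R k]_y `|(h ord0 x * prodf h' y)%:E| =
      `|h ord0 x|%:E * \int[lebesgue_rV R k]_y `|(EFin \o prodf h') y|)%E.
    under eq_integral => y _ do rewrite abse_EFin normrM EFinM.
    rewrite ge0_integralZl//; by apply/measurable_EFinP; exact: measurableT_comp.
  under eq_integral => x _ do rewrite E.
  rewrite ge0_integralZr//; last 2 first.
  - by apply/measurable_EFinP; exact: measurableT_comp (mh _).
  - exact: integral_ge0.
  apply: lte_mul_pinfty => //; first exact: integral_ge0.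
  by rewrite ge0_fin_numE//; exact: integral_ge0.
have intph : (lebesgue_rV R k.+1).-integrable setT (EFin \o prodf h).
  apply: integrable_pushforward => //.
  - exact: measurable_rV_cons.
  - exact/measurable_EFinP.
  - by rewrite preimage_setT -compA prodfE.
split => //.
rewrite big_ord_recl -Ih' /Rintegral /= /lebesgue_rV_succ.
rewrite integral_pushforward//; last 3 first.
- exact: measurable_rV_cons.
- exact/measurable_EFinP.
- by rewrite preimage_setT -compA prodfE.
rewrite preimage_setT -[(_ \o _ : _ -> \bar R)]/(EFin \o (prodf h \o _)) prodfE.
rewrite -integral12_prod_meas1// /fubini_F.
have E x : (\int[lebesgue_rV R k]_y (EFin \o f) (x, y) =
    (h ord0 x)%:E * \int[lebesgue_rV R k]_y (prodf h' y)%:E)%E.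
  by rewrite -integralZl//; apply: eq_integral => y _; rewrite /= EFinM.
under eq_integral => x _ do rewrite E.
have fp : (\int[lebesgue_rV R k]_y (prodf h' y)%:E)%E \is a fin_num.
  exact: (integrable_fin_num _ ih').
set c := (\int[lebesgue_rV R k]_y (prodf h' y)%:E)%E in fp *.
have -> : (\int[lebesgue_measure]_x ((h ord0 x)%:E * c) =
    \int[lebesgue_measure]_x (h ord0 x)%:E * c)%E.
  rewrite -(fineK fp) [RHS]muleC -integralZl//; last exact: (ih ord0).
  by apply: eq_integral => x _; rewrite muleC.
rewrite fineM//; exact: (integrable_fin_num _ (ih ord0)).
Qed.

End product_integral.

Section weak_partials.
Context {R : realType} {k : nat}.
Implicit Types (D Omega : set 'rV[R]_k) (u v g : 'rV[R]_k -> R).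
Implicit Types (h : 'I_k -> R -> R) (a b : 'I_k -> R).
Notation lam := (lebesgue_rV R k).

Lemma measurable_bumps a b h : bumps a b h -> measurable_fun setT (prodf h).
Proof.
move=> bh; apply: measurable_prodf => i; apply: continuous_measurable_fun.
by apply: smooth_continuous; have [] := bh i.
Qed.

Lemma integrable_mul_bumps D a b h u : measurable D ->
  lam.-integrable D (EFin \o u) -> bumps a b h ->
  lam.-integrable D (EFin \o (fun x => u x * prodf h x)).
Proof.
move=> mD iu bh; have [C C0 hC] := prodf_bounded bh.
have -> : EFin \o (fun x => u x * prodf h x) =
   ((EFin \o u) \* (EFin \o prodf h))%E by apply/funext => x; rewrite /= EFinM.
apply: integrableMl => //; first exact: measurable_funTS (measurable_bumps bh).
by exists C; split; [exact: num_real|move=> M CM x _ /=; exact: le_trans (hC x) (ltW CM)].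
Qed.

Lemma Rintegral_supp D D' (F : 'rV[R]_k -> R) : D `<=` D' ->
  (forall x, ~ D x -> F x = 0) ->
  \int[lam]_(x in D') F x = \int[lam]_(x in D) F x.
Proof.
move=> DD' F0; rewrite Rintegral_mkcond [RHS]Rintegral_mkcond.
apply: eq_Rintegral => x _; rewrite /patch.
case: ifPn => [_|]; case: ifPn => //.
  by rewrite notin_setE => /F0.
by move=> /set_mem /DD' /mem_set -> .
Qed.

(* Products of bumps are enough test functions here, and are those to which
   Fubini's theorem applies directly. *)
Definition wk D (i : 'I_k) u g :=
  [/\ lam.-integrable D (EFin \o u), lam.-integrable D (EFin \o g) &
   forall h a b, bumps a b h -> cbox a b `<=` D ->
   \int[lam]_(x in D) (u x * prodf (dfam i h) x) =
   - \int[lam]_(x in D) (g x * prodf h x)].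

Lemma weak_partial_wk Omega D i u g : D `<=` Omega ->
  lam.-integrable D (EFin \o u) -> lam.-integrable D (EFin \o g) ->
  weak_partial Omega i u g -> wk D i u g.
Proof.
move=> DO iu ig wu; split => // h a b bh abD.
have := wu _ (test_function_prodf bh (subset_trans abD DO)).
have sh : smooth (h i) by have [] := bh i.
under eq_Rintegral => x _ do rewrite (congr1 (@^~ x) (derive_prodf sh)).
by rewrite !(Rintegral_supp DO)// => x nDx;
  rewrite (prodf_supp (bumps_dfam i bh))// + rewrite (prodf_supp bh)//;
  rewrite ?mulr0//; move=> /abD.
Qed.

Lemma wkS D D' i u g : measurable D -> measurable D' -> D' `<=` D ->
  wk D i u g -> wk D' i u g.
Proof.
move=> mD mD' DD [iu ig H]; split.
- exact: integrableS iu.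
- exact: integrableS ig.
- move=> h a b bh abD; have := H h a b bh (subset_trans abD DD).
  by rewrite !(Rintegral_supp DD)// => x nDx;
  rewrite (prodf_supp (bumps_dfam i bh))// + rewrite (prodf_supp bh)//;
  rewrite ?mulr0//; move=> /abD.
Qed.

Lemma wkZ D i c u g : measurable D -> wk D i u g ->
  wk D i (fun x => c * u x) (fun x => c * g x).
Proof.
move=> mD [iu ig H]; split.
- exact: (integrableZl mD c iu).
- exact: (integrableZl mD c ig).
- move=> h a b bh abD.
  under eq_Rintegral do rewrite -mulrA.
  under [in RHS]eq_Rintegral do rewrite -mulrA.
  rewrite !RintegralZl//.
  + by rewrite (H h a b)// mulrN.
  + exact: integrable_mul_bumps bh.
  + exact: integrable_mul_bumps (bumps_dfam i bh).
Qed.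

Lemma wkD D i u u' g g' : measurable D -> wk D i u g -> wk D i u' g' ->
  wk D i (fun x => u x + u' x) (fun x => g x + g' x).
Proof.
move=> mD [iu ig H] [iu' ig' H']; split.
- exact: (integrableD mD iu iu').
- exact: (integrableD mD ig ig').
- move=> h a b bh abD.
  under eq_Rintegral do rewrite mulrDl.
  under [in RHS]eq_Rintegral do rewrite mulrDl.
  rewrite !RintegralD//; try exact: integrable_mul_bumps bh;
    try exact: integrable_mul_bumps (bumps_dfam i bh).
  by rewrite (H h a b)// (H' h a b)// opprD.
Qed.

Lemma wk_sum D i n (u g : 'I_n -> 'rV[R]_k -> R) : measurable D -> 
  lam.-integrable D (EFin \o cst (0 : R)) ->
  (forall l, wk D i (u l) (g l)) ->
  wk D i (fun x => \sum_l u l x) (fun x => \sum_l g l x).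
Proof.
move=> mD i0 H; elim: (index_enum _) => [|l s IHs].
  under eq_fun do rewrite big_nil; under [X in wk _ _ _ X]eq_fun do rewrite big_nil.
  split => // h a b _ _.
  by rewrite !(@eq_Rintegral _ _ _ _ _ (cst 0)) ?Rintegral_cst ?mul0r ?oppr0// => x _;
    rewrite mul0r.
under eq_fun do rewrite big_cons; under [X in wk _ _ _ X]eq_fun do rewrite big_cons.
exact: wkD.
Qed.

Lemma dfamC i j h : dfam i (dfam j h) = dfam j (dfam i h).
Proof.
by apply/funext => l; rewrite /dfam; case: (l == i); case: (l == j).
Qed.

(** Up to sign, both sides are the integral of [u] against the same mixed second derivative of the
    test function. This is the symmetry of second weak derivatives, with no derivative of [g] or
    [g'] involved. *)
Lemma wk_curl D i j u g g' h a b : wk D i u g -> wk D j u g' ->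
  bumps a b h -> cbox a b `<=` D ->
  \int[lam]_(x in D) (g x * prodf (dfam j h) x) =
  \int[lam]_(x in D) (g' x * prodf (dfam i h) x).
Proof.
move=> [_ _ H] [_ _ H'] bh abD; apply: oppr_inj.
rewrite -(H _ a b)//; last exact: bumps_dfam.
rewrite -(H' _ a b)//; last exact: bumps_dfam.
by rewrite dfamC.
Qed.

Let bump_int (a b : R) (h : R -> R) : bump1 a b h ->
  measurable_fun setT h /\ (@lebesgue_measure R).-integrable setT (EFin \o h).
Proof.
move=> [sh zh]; split; first by apply: continuous_measurable_fun; exact: smooth_continuous.
exact: supp_itv_integrable (smooth_continuous sh) zh.
Qed.

Lemma Rintegral_bumps a b h : bumps a b h ->
  \int[lam]_x prodf h x = \prod_i \int[lebesgue_measure]_x h i x.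
Proof.
move=> bh; apply: (integral_prodf _ _).2 => i.
- exact: (bump_int (bh i)).1.
- exact: (bump_int (bh i)).2.
Qed.

Lemma Rintegral_dfam a b h i : bumps a b h -> \int[lam]_x prodf (dfam i h) x = 0.
Proof.
move=> bh; rewrite (Rintegral_bumps (bumps_dfam i bh)) (bigD1 i)//=.
by rewrite {1}/dfam eqxx (Rintegral_bump_derive (bh i)) mul0r.
Qed.

(** The coordinate only modifies the [l]-th factor, so the integral still splits. For [l = i] that
    factor is integrated by parts; otherwise the factor [h i] has been replaced by its derivative,
    whose integral is 0. *)
Lemma Rintegral_coord_dfam a b h i l : bumps a b h ->
  \int[lam]_x (x 0 l * prodf (dfam i h) x) = - (l == i)%:R * \int[lam]_x prodf h x.
Proof.
move=> bh; pose hl j := if j == l then (fun x => x * dfam i h j x) else dfam i h j.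
have -> : (fun x : 'rV[R]_k => x 0 l * prodf (dfam i h) x) = prodf hl.
  apply/funext => x; rewrite /prodf (bigD1 l)//= [RHS](bigD1 l)//= mulrA.
  have -> : hl l (x 0 l) = x 0 l * dfam i h l (x 0 l) by rewrite /hl eqxx.
  by congr (_ * _); apply: eq_bigr => j /negbTE jl; rewrite /hl jl.
have bh' := bumps_dfam i bh.
have chl j : continuous (hl j).
  have cd : continuous (dfam i h j) by apply: smooth_continuous; have [] := bh' j.
  rewrite /hl; case: ifP => // _ x.
  by apply: continuousM; [exact: cvg_id|exact: cd].
have shl j : supp_itv (a j) (b j) (hl j).
  move=> x xab; have [_ /(_ _ xab) z] := bh' j.
  by rewrite /hl; case: ifP => // _; rewrite z mulr0.
rewrite (integral_prodf _ _).2; last 2 first.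
- by move=> j; exact: continuous_measurable_fun.
- by move=> j; exact: supp_itv_integrable (chl j) (shl j).
rewrite (bigD1 l)//= {1}/hl eqxx.
have [eli|li] := eqVneq l i.
  rewrite /hl {hl chl shl} eli.
  rewrite {1}/dfam eqxx (Rintegral_id_bump_derive (bh i)) mulN1r.
  rewrite (Rintegral_bumps bh) [in RHS](bigD1 i)//= mulNr; congr (- (_ * _)).
  by apply: eq_bigr => j /negbTE ji; rewrite ji /dfam ji.
rewrite oppr0 mul0r (bigD1 i) 1?eq_sym//=.
have -> : hl i = derive1 (h i) by rewrite /hl eq_sym (negbTE li) /dfam eqxx.
by rewrite (Rintegral_bump_derive (bh i)) mul0r mulr0.
Qed.

Lemma wk_cst D i c : measurable D -> (lam D < +oo)%E -> wk D i (fun=> c) (fun=> 0).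
Proof.
move=> mD Doo.
have icst (c' : R) : lam.-integrable D (EFin \o fun=> c').
  by apply: measurable_bounded_integrable => //; exact: bounded_cst.
split; [exact: icst|exact: icst|] => h a b bh abD.
rewrite -(Rintegral_supp (@subsetT _ D)); last first.
  by move=> x nDx; rewrite (prodf_supp (bumps_dfam i bh)) ?mulr0// => /abD.
rewrite RintegralZl//; last first.
  have := integral_prodf (fun j => (bump_int (bumps_dfam i bh j)).1) (fun j => (bump_int (bumps_dfam i bh j)).2).
  by case.
rewrite (Rintegral_dfam i bh) mulr0.
by under eq_Rintegral do rewrite mul0r; rewrite Rintegral_cst// mul0r oppr0.
Qed.

Lemma wk_coord D i l : measurable D -> (lam D < +oo)%E ->
  [bounded x 0 l | x in D] -> wk D i (fun x => x 0 l) (fun=> (l == i)%:R).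
Proof.
move=> mD Doo bD; split.
- apply: measurable_bounded_integrable => //.
  exact: measurable_funTS (measurable_rV_coord l).
- by apply: measurable_bounded_integrable => //; exact: bounded_cst.
move=> h a b bh abD.
rewrite -(Rintegral_supp (@subsetT _ D)); last first.
  by move=> x nDx; rewrite (prodf_supp (bumps_dfam i bh)) ?mulr0// => /abD.
rewrite -(Rintegral_supp (@subsetT _ D)); last first.
  by move=> x nDx; rewrite (prodf_supp bh) ?mulr0// => /abD.
rewrite (Rintegral_coord_dfam i l bh) mulNr RintegralZl//.
have := integral_prodf (fun j => (bump_int (bh j)).1) (fun j => (bump_int (bh j)).2).
by case.
Qed.

End weak_partials.

(** * Dyadic cells and Morrey's inequality *)

Section dyadic_cells.
Context {R : realType} {k : nat}.
Implicit Types (x y : 'rV[R]_k) (j : 'rV[int]_k) (m l : nat).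
Notation lam := (lebesgue_rV R k).

(** Cells are introduced as the fibres of a floor map, so that those of a given level form a
    partition by construction; they are the half-open cubes of side [2 ^- m]. *)
Definition cellof m x : 'rV[int]_k := \row_i Num.floor (2 ^+ m * x 0 i).

Definition cell m j := [set x | cellof m x = j].

Definition parent j : 'rV[int]_k := \row_i divz (j 0 i) 2.

Definition vol m : R := (2 ^- m) ^+ k.

Lemma vol_gt0 m : 0 < vol m.
Proof. by rewrite exprn_gt0// invr_gt0 exprn_gt0. Qed.

Let p2 m : 0 < (2 : R) ^+ m. Proof. exact: exprn_gt0. Qed.

Lemma cellP m j x : cell m j x <->
  forall i, (j 0 i)%:~R / 2 ^+ m <= x 0 i < ((j 0 i)%:~R + 1) / 2 ^+ m.
Proof.
have E i : (Num.floor (2 ^+ m * x 0 i) == j 0 i) =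
    ((j 0 i)%:~R / 2 ^+ m <= x 0 i < ((j 0 i)%:~R + 1) / 2 ^+ m).
  by rewrite floor_eq ler_pdivrMr// ltr_pdivlMr// [x 0 i * _]mulrC intrD.
split => [/rowP jx i|jx]; first by rewrite -E; have := jx i; rewrite mxE => ->.
by apply/rowP => i; rewrite mxE; apply/eqP; rewrite E.
Qed.

Lemma divz2_itv (q : int) : (divz q 2)%:~R * 2 <= q%:~R :> R /\
  q%:~R + 1 <= (divz q 2)%:~R * 2 + 2 :> R.
Proof.
have E := divz_eq q 2; have m0 : (0 <= modz q 2)%R by exact: modz_ge0.
have m1 : (modz q 2 < 2)%R by exact: ltz_pmod.
split.
  by rewrite -(intrM _ _ 2) ler_int [leRHS]E lerDl.
by rewrite -(intrM _ _ 2) -!(intrD _ _ 1) -(intrD _ _ 2) ler_int [in leLHS]E -addrA lerD2l lezD1.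
Qed.

Lemma cellof_parent m x : cellof m x = parent (cellof m.+1 x).
Proof.
apply/rowP => i; rewrite !mxE; apply/eqP; rewrite floor_eq.
set t := 2 ^+ m * x 0 i; have -> : 2 ^+ m.+1 * x 0 i = 2 * t by rewrite exprS mulrA.
set j := Num.floor (2 * t).
have /andP[j1 j2] : j%:~R <= 2 * t < (j + 1)%:~R by rewrite -floor_eq.
have [h1 h2] := @divz2_itv j.
set q : R := (j %/ 2)%Z%:~R in h1 h2 *.
apply/andP; split; rewrite ?intrD; lra.
Qed.

Lemma cellof_iter m l x : cellof m x = iter l parent (cellof (m + l) x).
Proof.
elim: l => [|l IHl] in m *; first by rewrite addn0.
by rewrite cellof_parent iterS IHl addSnnS.
Qed.

Lemma cellW m l x y : cellof (m + l) x = cellof (m + l) y -> cellof m x = cellof m y.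
Proof. by move=> xy; rewrite !(cellof_iter m l) xy. Qed.

Lemma cell_sub m l j x : cell m j x -> cell (m + l) (cellof (m + l) x) `<=` cell m j.
Proof. by move=> <- y /cellW. Qed.

Let edge m j i : set R := `[(j 0 i)%:~R / 2 ^+ m, ((j 0 i)%:~R + 1) / 2 ^+ m[%classic.

Let measurable_edge m j i : measurable (edge m j i).
Proof. exact: measurable_itv. Qed.

Let cell_box m j : cell m j = [set v | forall i, edge m j i (v 0 i)].
Proof.
apply/seteqP; split => [x /cellP xj i|x xj].
  by have := xj i; rewrite /edge/= in_itv.
by apply/cellP => i; have := xj i; rewrite /edge/= in_itv.
Qed.

Lemma measurable_box (A : 'I_k -> set R) : (forall i, measurable (A i)) ->
  measurable [set v : 'rV[R]_k | forall i, A i (v 0 i)].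
Proof.
move=> mA; have -> : [set v : 'rV[R]_k | forall i, A i (v 0 i)] =
    \bigcap_(i in [set: 'I_k]) [set v | A i (v 0 i)].
  by apply/seteqP; split=> v Av i => [_|]; exact: Av.
apply: fin_bigcap_measurable => // i _; rewrite -[X in measurable X]setTI.
exact: (measurable_rV_coord i) (mA _).
Qed.

Lemma measurable_cell m j : measurable (cell m j).
Proof. by rewrite cell_box; exact: measurable_box. Qed.

Lemma lebesgue_cell m j : lam (cell m j) = (vol m)%:E.
Proof.
rewrite cell_box (lebesgue_rV_box (measurable_edge m j)).
rewrite (eq_bigr (fun=> (2 ^- m)%:E)) => [|i _].
  by rewrite prodEFin prodr_const card_ord.
rewrite /= lebesgue_measure_itv/= lte_fin ltr_pM2r ?invr_gt0// ltrDl ltr01.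
by rewrite -EFinB -mulrBl addrC addKr mul1r.
Qed.

Lemma lebesgue_cell_fin m j : (lam (cell m j) < +oo)%E.
Proof. by rewrite lebesgue_cell ltry. Qed.

Lemma Rintegral_cell_cst m j (c : R) : \int[lam]_(x in cell m j) c = c * vol m.
Proof.
rewrite Rintegral_cst; last exact: measurable_cell.
by congr (_ * _); exact: (congr1 fine (lebesgue_cell m j)).
Qed.

Lemma cell_dist m j x y i : cell m j x -> cell m j y -> `|x 0 i - y 0 i| <= 2 ^- m.
Proof.
move=> /cellP/(_ i)/andP[x1 x2] /cellP/(_ i)/andP[y1 y2].
move: x2 y2; rewrite !mulrDl !mul1r => x2 y2.
by rewrite ler_norml; apply/andP; split; lra.
Qed.

Lemma ltr_mx_norm x (e : R) : 0 < e -> (forall i, `|x 0 i| < e) -> `|x| < e.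
Proof.
move=> e0 xe; rewrite /Num.Def.normr/= mx_normrE; apply: bigmax_lt => //= -[i l] _ /=.
by rewrite (ord1 i); exact: xe.
Qed.

Lemma expr2N_lt (e : R) : 0 < e -> exists m, 2 ^- m < e.
Proof.
move=> e0; exists (Num.truncn e^-1).+1.
rewrite invf_plt ?posrE// (lt_le_trans (truncnS_gt _))// -natrX ler_nat.
by rewrite ltnW// ltn_expl.
Qed.

Lemma nbhs_cell x (A : set 'rV[R]_k) : nbhs x A ->
  exists m0, forall m, (m0 <= m)%N -> cell m (cellof m x) `<=` A.
Proof.
move=> /nbhs_ballP[e /= e0 xeA]; have [m0 me] := expr2N_lt e0.
exists m0 => m m0m y xy; apply: xeA; rewrite mx_norm_ball /ball_/=.
apply: ltr_mx_norm => // i; rewrite !mxE.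
rewrite (le_lt_trans (@cell_dist m (cellof m x) _ _ _ _ _))//.
rewrite (le_lt_trans _ me)// lef_pV2 ?posrE// -!natrX ler_nat.
by rewrite leq_exp2l.
Qed.

End dyadic_cells.

(** * Means against bumps in nested cells *)

Section bump_step.
Context {R : realType} {k : nat}.
Implicit Types (x y : 'rV[R]_k) (j : 'rV[int]_k) (m l : nat).
Notation lam := (lebesgue_rV R k).
Variables (N : R -> R) (B : R).
Hypotheses (k0 : (0 < k)%N).
Hypotheses (sN : smooth N) (N0 : forall t : R, t <= 4^-1 -> N t = 0)
  (N1 : forall t : R, 3 / 4 <= t -> N t = 1) (N01 : forall t : R, 0 <= N t <= 1)
  (B1 : 1 <= B) (NB : forall t : R, `|derive1 N t| <= B).

Let B0 : 0 <= B. Proof. exact: le_trans B1. Qed.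

Let p2 m : 0 < (2 : R) ^+ m. Proof. exact: exprn_gt0. Qed.

Let eta : R -> R := derive1 N.

(** As the derivative of a smooth step from 0 to 1, this bump has integral 1, and the difference of
    two such bumps is the derivative of a compactly supported function. *)
Definition hcell m (q : int) : R -> R := fun t => 2 ^+ m * derive1 N (2 ^+ m * t - q%:~R).
Definition Ncell m (q : int) : R -> R := fun t => N (2 ^+ m * t - q%:~R).

Let smooth_Ncell m q : smooth (Ncell m q).
Proof. by move=> n; apply: C1_comp; [exact: sN|exact: C1_affine]. Qed.

Let is_derive_Ncell m q t : is_derive t (1 : R) (Ncell m q) (hcell m q t).
Proof.
have da : is_derive t (1 : R) (fun t => 2 ^+ m * t - q%:~R) (2 ^+ m).
  have := is_deriveD (is_deriveZ (2 ^+ m) (is_derive_id t (1 : R))) (is_derive_cst (- q%:~R : R) t (1 : R)).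
  by rewrite /GRing.scale/= mulr1 addr0.
rewrite /hcell mulrC.
exact: (@is_derive1_comp R N (fun t => 2 ^+ m * t - q%:~R)) (smooth_is_derive _ sN) da.
Qed.

Let derive_Ncell m q : derive1 (Ncell m q) = hcell m q.
Proof. by apply/funext => t; rewrite derive1E; have [] := is_derive_Ncell m q t. Qed.

Let smooth_hcell m q : smooth (hcell m q).
Proof. by rewrite -derive_Ncell; exact: smooth_derive. Qed.

Let eta0 t : ~~ (4^-1 <= t <= 3 / 4) -> eta t = 0.
Proof.
rewrite negb_and -!ltNge => /orP[t1|t3]; rewrite /eta derive1E.
- rewrite -(@near_eq_derive _ _ _ (cst 0)) ?derive_cst//.
  by near=> s; rewrite N0//; apply/ltW; near: s; exact: lt_nbhsl.
- rewrite -(@near_eq_derive _ _ _ (cst (1 : R))) ?derive_cst//.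
  by near=> s; rewrite N1//; apply/ltW; near: s; exact: lt_nbhsr.
Unshelve. all: by end_near.
Qed.

Let scale_itv m (q : int) (c d t : R) :
  ((q%:~R + c) / 2 ^+ m <= t <= (q%:~R + d) / 2 ^+ m) =
  (c <= 2 ^+ m * t - q%:~R <= d).
Proof.
by rewrite ler_pdivrMr// ler_pdivlMr// lerBrDl lerBlDl [t * _]mulrC.
Qed.

Lemma supp_hcell m q : supp_itv ((q%:~R + 4^-1) / 2 ^+ m) ((q%:~R + 3 / 4) / 2 ^+ m) (hcell m q).
Proof. by move=> t; rewrite scale_itv => /eta0; rewrite /eta/hcell => ->; rewrite mulr0. Qed.

Let Rintegral_hcell m q : \int[lebesgue_measure]_t hcell m q t = 1.
Proof.
have ab : (q%:~R + 4^-1) / 2 ^+ m < (q%:~R + 3 / 4) / 2 ^+ m :> R.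
  by rewrite ltr_pM2r ?invr_gt0// ltrD2l; lra.
rewrite (supp_itv_FTC ab _ (@supp_hcell m q) (is_derive_Ncell m q)); last first.
  exact: smooth_continuous.
have E c : 2 ^+ m * ((q%:~R + c) / 2 ^+ m) - q%:~R = c :> R.
  by rewrite mulrC divfK ?gt_eqF// addrC addKr.
by rewrite /Ncell !E N1// N0// subr0.
Qed.

Let hcell_bound m q t : `|hcell m q t| <= 2 ^+ m * B.
Proof. by rewrite /hcell normrM ger0_norm ?(ltW (p2 m))// ler_wpM2l// ltW. Qed.

Definition psi m j := prodf (fun i => hcell m (j 0 i)).

(** A bump fills the middle half of its interval. Seen from the parent interval, the middle half of
    a child is [1/8, 3/8] or [5/8, 7/8]; the margin 1/8 thus accommodates the bumps of a cell and of
    all its children. *)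
Let lo m j : 'I_k -> R := fun i => ((j 0 i)%:~R + 8^-1) / 2 ^+ m.
Let hi m j : 'I_k -> R := fun i => ((j 0 i)%:~R + 7 / 8) / 2 ^+ m.

Let cbox_cell m j : cbox (lo m j) (hi m j) `<=` cell m j.
Proof.
move=> x xj; apply/cellP => i; have /andP[x1 x2] := xj i.
apply/andP; split.
  by apply: le_trans x1; rewrite ler_pM2r ?invr_gt0// lerDl; lra.
by apply: le_lt_trans x2 _; rewrite ltr_pM2r ?invr_gt0// ltrD2l; lra.
Qed.

Let bump_hcell m j i : bump1 (lo m j i) (hi m j i) (hcell m (j 0 i)).
Proof.
split; first exact: smooth_hcell.
by apply: supp_itvW (@supp_hcell m (j 0 i)); rewrite ler_pM2r ?invr_gt0// lerD2l; lra.
Qed.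

Lemma psi_bumps m j : bumps (lo m j) (hi m j) (fun i => hcell m (j 0 i)).
Proof. by move=> i; exact: bump_hcell. Qed.

Let child_lohi m j i : lo m (parent j) i <= ((j 0 i)%:~R + 4^-1) / 2 ^+ m.+1 /\
   ((j 0 i)%:~R + 3 / 4) / 2 ^+ m.+1 <= hi m (parent j) i.
Proof.
rewrite /lo /hi mxE.
have [h1 h2] := @divz2_itv R (j 0 i).
rewrite exprS invfM !mulrA !ler_pM2r ?invr_gt0//.
by split; lra.
Qed.

Let bump_child m j i : bump1 (lo m (parent j) i) (hi m (parent j) i) (hcell m.+1 (j 0 i)).
Proof.
split; first exact: smooth_hcell.
have [l h] := child_lohi m j i.
exact: supp_itvW (@supp_hcell m.+1 (j 0 i)).
Qed.

(** The antiderivative of the difference between the child and the parent bump. Both steps are 0 on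
    the left and 1 on the right of the parent's support, hence it has compact support. *)
Let ND m j (i : 'I_k) t := Ncell m.+1 (j 0 i) t - Ncell m (parent j 0 i) t.

Let derive_ND m j i : derive1 (ND m j i) = fun t => hcell m.+1 (j 0 i) t - hcell m (parent j 0 i) t.
Proof.
apply/funext => t; rewrite derive1E; have := is_deriveB (is_derive_Ncell m.+1 (j 0 i) t) (is_derive_Ncell m (parent j 0 i) t).
by case.
Qed.

Let bump_ND m j i : bump1 (lo m (parent j) i) (hi m (parent j) i) (ND m j i).
Proof.
split.
  move=> n; have := C1D (smooth_Ncell m.+1 (j 0 i) n) (C1M (@C1_cst R n (-1)) (smooth_Ncell m (parent j 0 i) n)).
  by under eq_fun do rewrite mulN1r.
move=> t; rewrite negb_and -!ltNge => /orP[tl|th]; rewrite /ND /Ncell.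
- have [l _] := child_lohi m j i.
  rewrite !N0 ?subr0//.
  + move: tl; rewrite /lo ltr_pdivlMr// mulrC => /ltW; lra.
  + have := lt_le_trans tl l; rewrite ltr_pdivlMr// mulrC => /ltW; lra.
- have [_ h] := child_lohi m j i.
  rewrite !N1 ?subrr//.
  + move: th; rewrite /hi ltr_pdivrMr// [t * _]mulrC => /ltW; lra.
  + have := le_lt_trans h th; rewrite ltr_pdivrMr// [t * _]mulrC => /ltW; lra.
Qed.

Let ND_bound m j i t : `|ND m j i t| <= 1.
Proof.
have /andP[a b] := N01 (2 ^+ m.+1 * t - (j 0 i)%:~R).
have /andP[c d] := N01 (2 ^+ m * t - (parent j 0 i)%:~R).
by rewrite /ND /Ncell ler_norml; apply/andP; split; lra.
Qed.

(* The factors of the parent bump are replaced by those of the child one at a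
   time; at stage [s] the difference is the [s]-th partial derivative of
   [prodf (phi m j s)]. *)
Let mix m j (s : nat) (i : 'I_k) := if (i < s)%N then hcell m.+1 (j 0 i) else hcell m (parent j 0 i).

Let phi m j (s : 'I_k) (i : 'I_k) := if i == s then ND m j i else mix m j s i.

Let bumps_phi m j s : bumps (lo m (parent j)) (hi m (parent j)) (phi m j s).
Proof.
move=> i; rewrite /phi /mix; case: eqP => [_|_]; first exact: bump_ND.
by case: ifP => _; [exact: bump_child|exact: bump_hcell].
Qed.

Let bumps_mix m j s : bumps (lo m (parent j)) (hi m (parent j)) (mix m j s).
Proof.
by move=> i; rewrite /mix; case: ifP => _; [exact: bump_child|exact: bump_hcell].
Qed.

Let dfam_phi m j (s : 'I_k) x : prodf (dfam s (phi m j s)) x =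
  prodf (mix m j s.+1) x - prodf (mix m j s) x.
Proof.
rewrite /prodf (bigD1 s)//= [in X in _ = X - _](bigD1 s)//= [in X in _ = _ - X](bigD1 s)//=.
have -> : \prod_(i < k | i != s) mix m j s.+1 i (x 0 i) = \prod_(i < k | i != s) mix m j s i (x 0 i).
  apply: eq_bigr => i si; rewrite /mix ltnS leq_eqVlt.
  by rewrite -val_eqE/= in si; rewrite (negbTE si).
have -> : \prod_(i < k | i != s) dfam s (phi m j s) i (x 0 i) = \prod_(i < k | i != s) mix m j s i (x 0 i).
  by apply: eq_bigr => i /negbTE si; rewrite /dfam /phi si.
by rewrite -mulrBl /dfam /phi eqxx derive_ND /mix ltnS leqnn ltnn.
Qed.

(** One factor is the antiderivative [ND], bounded by 1 instead of by a multiple of [2 ^ m]. The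
    power of [2 ^ m] saved here is the factor [2 ^- m] of Morrey's inequality. *)
Let phi_bound m j s x : `|prodf (phi m j s) x| <= (2 ^+ m.+1 * B) ^+ k.-1.
Proof.
rewrite /prodf (bigD1 s)//= normrM -[leRHS]mul1r.
apply: ler_pM => //; first by rewrite /phi eqxx.
rewrite normr_prod (@le_trans _ _ (\prod_(i < k | i != s) (2 ^+ m.+1 * B)))//.
  apply: ler_prod => i /negbTE si; rewrite normr_ge0 /phi si /mix.
  case: ifP => _; rewrite (le_trans (hcell_bound _ _ _))// ler_wpM2r//.
  by rewrite ler_eXn2l// ?ltr1n.
by rewrite prodr_const cardC1 card_ord.
Qed.

Lemma mix0 m j : prodf (mix m j 0) = psi m (parent j).
Proof. by []. Qed.

Lemma mixk m j : prodf (mix m j k) = psi m.+1 j.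
Proof.
by apply/funext => x; apply: eq_bigr => i _; rewrite /mix ltn_ord.
Qed.

Lemma Rintegral_mul_bound D (g q : 'rV[R]_k -> R) (C : R) :
  measurable D -> lam.-integrable D (EFin \o g) ->
  lam.-integrable D (EFin \o (fun x => g x * q x)) ->
  (forall x, D x -> `|q x| <= C) ->
  `| \int[lam]_(x in D) (g x * q x)| <= C * \int[lam]_(x in D) `|g x|.
Proof.
move=> mD ig igq qC; have iag : lam.-integrable D (EFin \o (fun x => `|g x|)).
  exact: (integrable_abse ig).
rewrite (le_trans (le_normr_Rintegral mD igq))// -RintegralZl//.
apply: le_Rintegral => //.
- exact: (integrable_abse igq).
- exact: (integrableZl mD C iag).
- by move=> x Dx; rewrite normrM mulrC ler_wpM2r// qC.
Qed.

Lemma psi_step m j u g : (forall i, wk (cell m (parent j)) i u (g i)) ->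
  `| \int[lam]_(x in cell m.+1 j) (u x * psi m.+1 j x) -
     \int[lam]_(x in cell m (parent j)) (u x * psi m (parent j) x) | <=
  (2 ^+ m.+1 * B) ^+ k.-1 * \sum_i \int[lam]_(x in cell m (parent j)) `|g i x|.
Proof.
move=> wu; set P := cell m (parent j).
have mP : measurable P by exact: measurable_cell.
have iu : lam.-integrable P (EFin \o u) by have [] := wu (Ordinal k0).
have sub : cell m.+1 j `<=` P by move=> x xj; rewrite /P /cell/= cellof_parent (xj : cellof _ _ = _).
have -> : \int[lam]_(x in cell m.+1 j) (u x * psi m.+1 j x) =
    \int[lam]_(x in P) (u x * prodf (mix m j k) x).
  rewrite mixk (Rintegral_supp sub)// => x nx.
  by rewrite /psi (prodf_supp (psi_bumps m.+1 j)) ?mulr0// => /cbox_cell.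
rewrite -mix0 mulr_sumr.
pose U s := \int[lam]_(x in P) (u x * prodf (mix m j s) x).
rewrite -/(U k) -/(U 0%N) -(telescope_sumr _ (leq0n k)) big_mkord.
rewrite (le_trans (ler_norm_sum _ _ _))//; apply: ler_sum => s _.
have [_ ig ws] := wu s.
rewrite /U -RintegralB//; last 2 first.
- exact: integrable_mul_bumps (bumps_mix m j s.+1).
- exact: integrable_mul_bumps (bumps_mix m j s).
have -> : \int[lam]_(x in P) (u x * prodf (mix m j s.+1) x - u x * prodf (mix m j s) x) =
    \int[lam]_(x in P) (u x * prodf (dfam s (phi m j s)) x).
  by apply: eq_Rintegral => x _; rewrite dfam_phi mulrBr.
rewrite (ws _ _ _ (bumps_phi m j s) (@cbox_cell _ _)) normrN.
apply: Rintegral_mul_bound (fun x _ => phi_bound m j s x) => //.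
exact: integrable_mul_bumps (bumps_phi m j s).
Qed.

(** The bump has integral 1, so [c] may be moved under the integral. The factor [B ^ k] bounds the
    integral of its absolute value, as its sign is not controlled. *)
Lemma psi_cvg m j u (e c : R) : lam.-integrable (cell m j) (EFin \o u) ->
  (forall x, cell m j x -> `|u x - c| <= e) ->
  `| \int[lam]_(x in cell m j) (u x * psi m j x) - c | <= e * B ^+ k.
Proof.
move=> iu ue; have mC := @measurable_cell R k m j.
have ipsi : lam.-integrable setT (EFin \o psi m j).
  apply: (integral_prodf _ _).1 => i.
    by apply: continuous_measurable_fun; exact: smooth_continuous.
  by apply: supp_itv_integrable (@supp_hcell m (j 0 i)); exact: smooth_continuous.
have I1 : \int[lam]_(x in cell m j) psi m j x = 1.
  rewrite -(Rintegral_supp (@subsetT _ _)).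
    by rewrite (Rintegral_bumps (psi_bumps m j)) big1.
  by move=> x nx; rewrite /psi (prodf_supp (psi_bumps m j))// => /cbox_cell.
have ipsi' : lam.-integrable (cell m j) (EFin \o psi m j).
  exact: integrableS ipsi.
have icpsi : lam.-integrable (cell m j) (EFin \o (fun x => c * psi m j x)).
  exact: (integrableZl mC c ipsi').
have iupsi : lam.-integrable (cell m j) (EFin \o (fun x => u x * psi m j x)).
  exact: integrable_mul_bumps (psi_bumps m j).
rewrite -[X in _ - X]mulr1 -I1 -RintegralZl// -RintegralB//.
have -> : \int[lam]_(x in cell m j) (u x * psi m j x - c * psi m j x) =
   \int[lam]_(x in cell m j) ((u x - c) * psi m j x).
  by apply: eq_Rintegral => x _; rewrite mulrBl.
have iuc : lam.-integrable (cell m j) (EFin \o (fun x => u x - c)).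
  have icst : lam.-integrable (cell m j) (EFin \o cst (- c)).
    apply: measurable_bounded_integrable => //; last exact: bounded_cst.
    exact: lebesgue_cell_fin.
  exact: (integrableD mC iu icst).
rewrite (le_trans (@Rintegral_mul_bound _ _ _ ((2 ^+ m * B) ^+ k) mC iuc _ _))//.
- exact: integrable_mul_bumps (psi_bumps m j).
- move=> x _; rewrite /psi /prodf normr_prod.
  rewrite (le_trans (@ler_prod _ _ _ _ _ (fun=> 2 ^+ m * B) _))//.
    by move=> i _; rewrite normr_ge0 hcell_bound.
  by rewrite prodr_const card_ord.
have ie : lam.-integrable (cell m j) (EFin \o cst e).
  apply: measurable_bounded_integrable => //; last exact: bounded_cst.
  exact: lebesgue_cell_fin.
rewrite (@le_trans _ _ ((2 ^+ m * B) ^+ k * \int[lam]_(x in cell m j) e))//.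
  rewrite ler_wpM2l ?exprn_ge0 ?mulr_ge0 ?(ltW (p2 m))//.
  apply: le_Rintegral => //; exact: (integrable_abse iuc).
rewrite Rintegral_cell_cst /vol mulrCA -exprMn mulrAC divff ?mul1r// gt_eqF.
Qed.

(** The factor [2 ^ m / vol m] is the natural scaling of a derivative of a bump of mass 1. When the
    symmetry of second derivatives is tested, it cancels the side and the volume of the cell. *)
Lemma cell_bump (B2 : R) m j : (forall t : R, `|derive1 (derive1 N) t| <= B2) ->
  exists h a b, [/\ bumps a b h, cbox a b `<=` cell m j,
    \int[lam]_(x in cell m j) prodf h x = 1 &
    forall i x, `|prodf (dfam i h) x| <= B2 * B ^+ k.-1 * 2 ^+ m / vol (R := R) (k := k) m].
Proof.
move=> NB2; exists (fun i => hcell m (j 0 i)), (lo m j), (hi m j).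
have bp := psi_bumps m j; split => //.
  rewrite -(Rintegral_supp (@subsetT _ _)).
    by rewrite (Rintegral_bumps bp) big1.
  by move=> x nx; rewrite (prodf_supp bp)// => /cbox_cell.
move=> i x; rewrite /prodf (bigD1 i)//= normrM /dfam eqxx.
have db t : `|derive1 (hcell m (j 0 i)) t| <= 2 ^+ m * (2 ^+ m * B2).
  have da : is_derive t (1 : R) (fun t => 2 ^+ m * t - (j 0 i)%:~R) (2 ^+ m).
    have := is_deriveD (is_deriveZ (2 ^+ m) (is_derive_id t (1 : R)))
       (is_derive_cst (- (j 0 i)%:~R : R) t (1 : R)).
    by rewrite /GRing.scale/= mulr1 addr0.
  have := @is_derive1_comp R (derive1 N) (fun t => 2 ^+ m * t - (j 0 i)%:~R) _ _ _
    (smooth_is_derive _ (smooth_derive sN)) da.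
  move=> /(is_deriveZ (2 ^+ m))[_ dE]; rewrite derive1E dE /GRing.scale/= normrM ger0_norm ?(ltW (p2 m))//.
  by rewrite ler_wpM2l ?(ltW (p2 m))// normrM mulrC ger0_norm ?(ltW (p2 m))// ler_wpM2l ?(ltW (p2 m)).
rewrite (le_trans (ler_pM _ _ (db _) (_ : _ <= (2 ^+ m * B) ^+ k.-1)))//.
  rewrite normr_prod (@le_trans _ _ (\prod_(l < k | l != i) (2 ^+ m * B)))//.
    by apply: ler_prod => l /negbTE ->; rewrite normr_ge0/=.
  by rewrite prodr_const cardC1 card_ord.
have -> : (vol (R := R) (k := k) m)^-1 = 2 ^+ m * (2 ^+ m) ^+ k.-1.
  by rewrite /vol -exprVn invrK -[in LHS](prednK k0) exprS.
by rewrite exprMn le_eqVlt; apply/orP; left; apply/eqP; ring.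
Qed.

End bump_step.

Lemma smooth_step_bounded (R : realType) : exists (N : R -> R) (B B2 : R),
  [/\ smooth N, forall t : R, t <= 4^-1 -> N t = 0, forall t : R, 3 / 4 <= t -> N t = 1,
    forall t : R, 0 <= N t <= 1 &
    [/\ 1 <= B, forall t : R, `|derive1 N t| <= B &
        forall t : R, `|derive1 (derive1 N) t| <= B2]].
Proof.
have [N [sN N0 N1 N01]] := @smooth_step_exists R.
have bN : bump1 0 1 (derive1 N).
  split; first exact: smooth_derive.
  move=> t; rewrite negb_and -!ltNge => /orP[t1|t3]; rewrite derive1E.
  - rewrite -(@near_eq_derive _ _ _ (cst 0)) ?derive_cst//.
    near=> s; rewrite N0// (@le_trans _ _ 0)//; apply/ltW; near: s; exact: lt_nbhsl.
  - rewrite -(@near_eq_derive _ _ _ (cst (1 : R))) ?derive_cst//.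
    near=> s; rewrite N1// (@le_trans _ _ 1)//; first by lra.
    by apply/ltW; near: s; exact: lt_nbhsr.
have [B B0 NB] := supp_itv_bounded (smooth_continuous bN.1) bN.2.
have [B2 _ NB2] := supp_itv_bounded (smooth_continuous (bump_derive bN).1) (bump_derive bN).2.
exists N, (B + 1), B2; split => //; split => //; first by rewrite lerDr.
by move=> t; rewrite (le_trans (NB t))// lerDl.
Unshelve. all: by end_near.
Qed.

Section morrey.
Context {R : realType} {k : nat}.
Notation lam := (lebesgue_rV R k).
Implicit Types (x y : 'rV[R]_k) (j : 'rV[int]_k) (m l : nat).
Implicit Types (u : 'rV[R]_k -> R) (g : 'I_k -> 'rV[R]_k -> R).

(* The averages of [|g|] may grow by a factor [rho] at each dyadic subdivision;
   [rho < 2] makes the oscillations in [morrey] summable. *)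
Definition avgle (rho : R) m j (g : 'rV[R]_k -> R) (K : R) :=
  forall l j', (cell (m + l) j' : set 'rV[R]_k) `<=` cell m j ->
    \int[lam]_(x in cell (m + l) j') `|g x| <= K * rho ^+ l * vol (R := R) (k := k) (m + l).

(* The means of [u] against bumps in the nested cells around [x] tend to [u x],
   and consecutive ones differ by a multiple of [K (rho / 2) ^ l 2 ^ - m]. *)
Lemma morrey (rho : R) : (0 < k)%N -> 0 <= rho < 2 ->
  exists2 C : R, 0 <= C & forall m j u g K, 0 <= K ->
    (forall x, cell m j x -> {for x, continuous u}) ->
    (forall i, wk (cell m j) i u (g i)) ->
    (forall i, avgle rho m j (g i) K) ->
    forall x y, cell m j x -> cell m j y -> `|u x - u y| <= C * K * 2 ^- m.
Proof.
move=> k0 /andP[rho0 rho2].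
have [N [B [B2 [sN N0 N1 N01 [B1 NB _]]]]] := @smooth_step_bounded R.
have B0 : 0 <= B by exact: le_trans B1.
pose th := rho / 2; have th0 : 0 <= th by rewrite divr_ge0.
have th1 : 0 < 1 - th by rewrite subr_gt0 /th ltr_pdivrMr// mul1r.
pose C1 := k%:R * (2 * B) ^+ k.-1.
have C10 : 0 <= C1 by rewrite mulr_ge0// exprn_ge0// mulr_ge0.
exists (2 * (C1 / (1 - th))).
  by rewrite mulr_ge0// divr_ge0// ltW.
move=> m j u g K K0 cu wu gK.
have iu : lam.-integrable (cell m j) (EFin \o u) by have [] := wu (Ordinal k0).
pose U x l := \int[lam]_(y in cell (m + l) (cellof (m + l) x))
  (u y * psi N (m + l) (cellof (m + l) x) y).
have p2 n : 0 < (2 : R) ^+ n by exact: exprn_gt0.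
have step x l : cell m j x -> `|U x l.+1 - U x l| <= C1 * K * 2 ^- m * th ^+ l.
  move=> xj; have sub := cell_sub (l := l) xj.
  have mP n q := @measurable_cell R k n q.
  have pE : parent (cellof (m + l).+1 x) = cellof (m + l) x by rewrite [RHS]cellof_parent.
  have := @psi_step R k N B k0 sN N0 N1 N01 B1 NB (m + l) (cellof (m + l).+1 x) u g.
  rewrite pE -addnS => H; rewrite (le_trans (H _))//.
    by move=> i; exact: wkS (wu i).
  (* Of the [k] powers of [2 ^- (m + l)] in the volume, [k - 1] cancel against the bumps; the
     remaining one, with the growth [rho ^ l], gives the ratio [th = rho / 2] of a convergent
     geometric series. *)
  have -> : C1 * K * 2 ^- m * th ^+ l = (2 ^+ (m + l).+1 * B) ^+ k.-1 *
      \sum_(i < k) (K * rho ^+ l * vol (R := R) (k := k) (m + l)).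
    have -> : C1 * K * 2 ^- m * th ^+ l = k%:R * (2 * B) ^+ k.-1 * K * (rho ^+ l * 2 ^- (m + l)).
      have -> : th ^+ l = rho ^+ l * 2 ^- l by rewrite /th exprMn exprVn.
      by rewrite /C1 exprD invfM; ring.
    have P0 : (2 : R) ^+ (m + l) != 0 by rewrite gt_eqF.
    have -> : 2 ^+ (m + l).+1 * B = 2 ^+ (m + l) * (2 * B) by rewrite exprS; ring.
    have -> : vol (R := R) (k := k) (m + l) = (2 ^- (m + l)) ^+ k.-1 * 2 ^- (m + l).
      by rewrite /vol -[in LHS](prednK k0) exprSr.
    rewrite sumr_const card_ord -[_ *+ k]mulr_natl [(2 ^+ _ * _) ^+ _]exprMn.
    have : (2 ^+ (m + l)) ^+ k.-1 * (2 ^- (m + l)) ^+ k.-1 = 1 :> R.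
      by rewrite -exprMn divff// expr1n.
    move: ((2 * B) ^+ k.-1) ((2 ^+ (m + l)) ^+ k.-1) ((2 ^- (m + l)) ^+ k.-1) => a b c bc.
    rewrite [RHS](_ : _ = (b * c) * (k%:R * a * K * (rho ^+ l * 2 ^- (m + l)))); last by ring.
    by rewrite bc mul1r mulr1.
  rewrite addnS ler_wpM2l ?exprn_ge0 ?mulr_ge0 ?(ltW (p2 _))//.
  by apply: ler_sum => i _; exact: gK.
have bound x L : cell m j x -> `|U x L - U x 0%N| <= C1 * K * 2 ^- m / (1 - th).
  move=> xj; rewrite (@le_trans _ _ (C1 * K * 2 ^- m * ((1 - th ^+ L) / (1 - th))))//.
    elim: L => [|L IHL]; first by rewrite subrr normr0 expr0 subrr mul0r mulr0.
    rewrite (le_trans (ler_distD (U x L) _ _))//.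
    rewrite (le_trans (lerD (step x L xj) IHL))// -mulrDr.
    rewrite [X in _ * X](_ : _ = (1 - th ^+ L.+1) / (1 - th))//.
    by rewrite exprS; field; rewrite gt_eqF.
  apply: ler_wpM2l; first by rewrite mulr_ge0 ?invr_ge0 ?(ltW (p2 m))// mulr_ge0.
  by rewrite ler_pdivrMr// mulVf ?gt_eqF// gerBl exprn_ge0.
have limit x : cell m j x -> `|u x - U x 0%N| <= C1 * K * 2 ^- m / (1 - th).
  move=> xj; apply/ler_addgt0Pr => e e0.
  have Bk : 0 < B ^+ k by rewrite exprn_gt0// (lt_le_trans _ B1).
  have /(cu _ xj)/nbhs_cell[L HL] : nbhs (u x) [set r | `|r - u x| <= e / B ^+ k].
    apply/nbhs_ballP; exists (e / B ^+ k) => /=; first by rewrite divr_gt0.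
    by move=> r; rewrite /ball/= distrC => /ltW.
  rewrite (le_trans (ler_distD (U x L) _ _))// addrC lerD ?bound//.
  rewrite distrC (le_trans (@psi_cvg R k N B sN N0 N1 B1 NB (m + L) (cellof (m + L) x) u (e / B ^+ k) (u x) _ _))//.
  - by apply: integrableS iu => //; try exact: measurable_cell; exact: cell_sub.
  - by move=> y; exact: (HL _ (leq_addl _ _)).
  - by rewrite divfK// gt_eqF.
move=> x y xj yj.
have Uxy : U x 0%N = U y 0%N.
  by rewrite /U addn0 (xj : cellof _ _ = _) (yj : cellof _ _ = _).
have hx := limit x xj; have hy := limit y yj; rewrite -Uxy distrC in hy.
move: (U x 0%N) hx hy => w hx hy.
apply: (le_trans (ler_distD w _ _)); apply: (le_trans (lerD hx hy)).
by rewrite le_eqVlt; apply/orP; left; apply/eqP; ring.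
Qed.

Lemma cell_bump_exists : (0 < k)%N -> exists2 C : R, 0 <= C & forall m j, exists h a b,
  [/\ bumps a b h, cbox a b `<=` cell m j, \int[lam]_(x in cell m j) prodf h x = 1 &
    forall i x, `|prodf (dfam i h) x| <= C * 2 ^+ m / vol (R := R) (k := k) m].
Proof.
move=> k0; have [N [B [B2 [sN N0 N1 N01 [B1 NB NB2]]]]] := @smooth_step_bounded R.
exists (B2 * B ^+ k.-1) => [|m j]; last exact: (cell_bump k0 sN).
by rewrite mulr_ge0 ?exprn_ge0 ?(le_trans _ B1)// (le_trans _ (NB2 0)).
Qed.

End morrey.

(** * The contact equation on a dyadic cell *)

Section symplectic.
Context {R : realType} {n : nat}.
Implicit Types (p v w : heis R n).

Definition omega p w : R :=
  \sum_(i < n) (p 0 (ix i) * w 0 (iy i) - p 0 (iy i) * w 0 (ix i)).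

(* The last coordinate of [p^-1 * w] in the Heisenberg group. *)
Definition gap p w : R := w 0 (it n) - p 0 (it n) + 2 * omega p w.

Lemma contact_formE p w : contact_form p w = w 0 (it n) + 2 * omega p w.
Proof. by []. Qed.

Lemma omegaDl p p' w : omega (p + p') w = omega p w + omega p' w.
Proof. by rewrite -big_split; apply: eq_bigr => i _; rewrite !mxE/=; ring. Qed.

Lemma omegaZl c p w : omega (c *: p) w = c * omega p w.
Proof. by rewrite mulr_sumr; apply: eq_bigr => i _; rewrite !mxE/=; ring. Qed.

Lemma omegaDr p w w' : omega p (w + w') = omega p w + omega p w'.
Proof. by rewrite -big_split; apply: eq_bigr => i _; rewrite !mxE/=; ring. Qed.

Lemma omegaZr c p w : omega p (c *: w) = c * omega p w.
Proof. by rewrite mulr_sumr; apply: eq_bigr => i _; rewrite !mxE/=; ring. Qed.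

Lemma omegaBl p p' w : omega (p - p') w = omega p w - omega p' w.
Proof. by rewrite -scaleN1r omegaDl omegaZl mulN1r. Qed.

Lemma omegaC p w : omega p w = - omega w p.
Proof. by rewrite -sumrN; apply: eq_bigr => i _; ring. Qed.

Lemma omega_suml (I : finType) (F : I -> heis R n) w :
  omega (\sum_i F i) w = \sum_i omega (F i) w.
Proof.
elim: (index_enum I) => [|i s IHs].
  by rewrite !big_nil /omega big1// => i _; rewrite !mxE; ring.
by rewrite !big_cons omegaDl IHs.
Qed.

Lemma omega_sumr (I : finType) (F : I -> heis R n) w :
  omega w (\sum_i F i) = \sum_i omega w (F i).
Proof. by rewrite omegaC omega_suml -sumrN; apply: eq_bigr => i _; rewrite -omegaC. Qed.

Lemma omega_self p : omega p p = 0.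
Proof. by rewrite /omega big1// => i _; ring. Qed.

Lemma omega_bound p w (P : R) : (forall l, `|p 0 l| <= P) ->
  `|omega p w| <= n.*2%:R * P * \sum_l `|w 0 l|.
Proof.
move=> pP; rewrite (le_trans (ler_norm_sum _ _ _))//.
have S l : `|w 0 l| <= \sum_l `|w 0 l|.
  by rewrite (bigD1 l)//= lerDl sumr_ge0.
set W := \sum_l _ in S *.
rewrite (@le_trans _ _ (\sum_(i < n) (2 * P * W)))//; last first.
  rewrite sumr_const card_ord -[_ *+ n]mulr_natl -muln2 natrM.
  by rewrite le_eqVlt; apply/orP; left; apply/eqP; ring.
apply: ler_sum => i _; rewrite (le_trans (ler_normB _ _))// !normrM.
have -> : 2 * P * W = P * W + P * W by ring.
by apply: lerD; apply: ler_pM.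
Qed.

End symplectic.

(** A form of Young's inequality with threshold [s]: below it the first term is enough, above it
    [t / s <= (t / s) ^ q]. It serves in place of Hölder's inequality. *)
Lemma le_powR_scale (R : realType) (t s q : R) : 0 <= t -> 0 < s -> 1 <= q -> t <= s + s / s `^ q * t `^ q.
Proof.
move=> t0 s0 q1; have [ts|st] := leP t s.
  by rewrite (le_trans ts)// lerDl mulr_ge0 ?powR_ge0// divr_ge0 ?powR_ge0// ltW.
have ts1 : 1 <= t / s by rewrite ler_pdivlMr// mul1r ltW.
have s_neq0 : s != 0 by rewrite gt_eqF.
have -> : t `^ q = (t / s) `^ q * s `^ q.
  by rewrite -powRM ?divfK// ?divr_ge0 // ltW.
rewrite mulrACA mulrA divfK ?gt_eqF ?powR_gt0//.
rewrite (@le_trans _ _ (s * (t / s)))//; first by rewrite mulrC divfK.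
rewrite (@le_trans _ _ (s * (t / s) `^ q))//.
  rewrite ler_wpM2l ?(ltW s0)// -[leLHS]powRr1 ?(le_trans _ ts1)//.
  exact: ler_powR.
by rewrite lerDr ltW.
Qed.

(** * Growth of averages under subdivision *)

Section average_bounds.
Context {R : realType} {k : nat}.
Notation lam := (lebesgue_rV R k).
Implicit Types (x y : 'rV[R]_k) (j : 'rV[int]_k) (m l : nat).
Implicit Types (D : set 'rV[R]_k) (g : 'rV[R]_k -> R).

Lemma ae_le_Rintegral D g h : measurable D ->
  lam.-integrable D (EFin \o g) -> lam.-integrable D (EFin \o h) ->
  (forall x, 0 <= g x) -> (forall x, 0 <= h x) ->
  {ae lam, forall x, D x -> g x <= h x} ->
  \int[lam]_(x in D) g x <= \int[lam]_(x in D) h x.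
Proof.
move=> mD ig ih g0 h0 gh; apply: fine_le; [exact: (integrable_fin_num mD ig)|exact: (integrable_fin_num mD ih)|].
apply: ae_ge0_le_integral => //.
- by move=> x _; rewrite lee_fin.
- by case/integrableP : ig.
- by move=> x _; rewrite lee_fin.
- by case/integrableP : ih.
Qed.

Lemma Rintegral_sum D (I : finType) (g : I -> 'rV[R]_k -> R) : measurable D ->
  (forall i, lam.-integrable D (EFin \o g i)) ->
  lam.-integrable D (EFin \o (fun x => \sum_i g i x)) /\
  \int[lam]_(x in D) (\sum_i g i x) = \sum_i \int[lam]_(x in D) g i x.
Proof.
move=> mD ig; elim: (index_enum I) => [|i s [IHs1 IHs2]].
  have -> : (fun x => \sum_(i <- [::]) g i x) = cst 0 by apply/funext => x; rewrite big_nil.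
  rewrite big_nil Rintegral_cst// mul0r; split => //.
  exact: (integrable0 lam D).
have -> : (fun x => \sum_(i <- i :: s) g i x) = (fun x => g i x + \sum_(i <- s) g i x).
  by apply/funext => x; rewrite big_cons.
split; first exact: (integrableD mD (ig i) IHs1).
by rewrite big_cons RintegralD// IHs2.
Qed.

Lemma integrable_cell_cst m j (c : R) : lam.-integrable (cell m j) (EFin \o cst c).
Proof.
apply: measurable_bounded_integrable; [exact: measurable_cell|exact: lebesgue_cell_fin|by []|exact: bounded_cst].
Qed.

(** Stability of [avgle] under almost everywhere domination; the constant [c1] is admissible because
    [1 <= rho]. It feeds Morrey's inequality with gradients that are only estimated in terms of
    [Df - A]. *)
Lemma avgle_ae (rho : R) m j (I : finType) (E : I -> 'rV[R]_k -> R) g (K c1 c2 : R) :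
  1 <= rho -> 0 <= c1 -> 0 <= c2 ->
  lam.-integrable (cell m j) (EFin \o g) ->
  (forall i, lam.-integrable (cell m j) (EFin \o E i)) ->
  (forall i, avgle rho m j (E i) K) ->
  {ae lam, forall x, cell m j x -> `|g x| <= c1 + c2 * \sum_i `|E i x|} ->
  avgle rho m j g (c1 + c2 * (#|I|%:R * K)).
Proof.
move=> rho1 c10 c20 ig iE EK gE l j' sub.
have mC' := @measurable_cell R k (m + l) j'; have mC := @measurable_cell R k m j.
have iE' i : lam.-integrable (cell (m + l) j') (EFin \o (fun x => `|E i x|)).
  exact: (integrable_abse (integrableS mC mC' sub (iE i))).
have [isum Isum] := Rintegral_sum mC' iE'.
have icsum : lam.-integrable (cell (m + l) j') (EFin \o (fun x => c2 * \sum_i `|E i x|)).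
  exact: (integrableZl mC' c2 isum).
have icst := integrable_cell_cst (m + l) j' c1.
have S0 x : 0 <= \sum_i `|E i x| by apply: sumr_ge0.
apply: (@le_trans _ _ (\int[lam]_(x in cell (m + l) j') (c1 + c2 * \sum_i `|E i x|))).
  apply: ae_le_Rintegral => //.
  - exact: (integrable_abse (integrableS mC mC' sub ig)).
  - exact: (integrableD mC' icst icsum).
  - by move=> x; rewrite addr_ge0// mulr_ge0.
  - by apply: filterS gE => x H /sub.
rewrite RintegralD// RintegralZl// Isum Rintegral_cell_cst -!mulrA mulrDl.
apply: lerD.
  rewrite ler_wpM2l// ler_peMl// ?exprn_ege1//.
  exact/ltW/vol_gt0.
rewrite -!mulrA ler_wpM2l// (@le_trans _ _ (\sum_(i in I) (K * (rho ^+ l * vol (R := R) (k := k) (m + l)))))//.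
  by apply: ler_sum => i _; rewrite mulrA; exact: EK.
by rewrite sumr_const -[leLHS]mulr_natl.
Qed.

(** The threshold [s = M rho ^ l] balances both terms of [le_powR_scale]: as [rho ^ q = 2 ^ k], the
    factor [s ^ q] grows exactly as fast as the volume of the subcells shrinks, that is,
    [M ^ q vol m = s ^ q vol (m + l)]. *)
Lemma avgle_young (rho q : R) m j g (M : R) : 0 < rho -> rho `^ q = 2 ^+ k -> 1 <= q ->
  0 < M -> lam.-integrable (cell m j) (EFin \o g) ->
  lam.-integrable (cell m j) (EFin \o (fun x => `|g x| `^ q)) ->
  \int[lam]_(x in cell m j) (`|g x| `^ q) <= M `^ q * vol (R := R) (k := k) m ->
  avgle rho m j g (2 * M).
Proof.
move=> rho0 rhoq q1 M0 ig igq gM l j' sub.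
have mC' := @measurable_cell R k (m + l) j'; have mC := @measurable_cell R k m j.
set s := M * rho ^+ l; have s0 : 0 < s by rewrite mulr_gt0// exprn_gt0.
set c := s / s `^ q; have c0 : 0 <= c by rewrite divr_ge0 ?powR_ge0// ltW.
have iagq := integrableS mC mC' sub igq.
have icgq := integrableZl mC' c iagq.
have icst := integrable_cell_cst (m + l) j' s.
apply: (@le_trans _ _ (\int[lam]_(x in cell (m + l) j') (s + c * `|g x| `^ q))).
  apply: le_Rintegral => //.
  - exact: (integrable_abse (integrableS mC mC' sub ig)).
  - exact: (integrableD mC' icst icgq).
  - by move=> x _; exact: le_powR_scale.
rewrite RintegralD// RintegralZl// Rintegral_cell_cst.
have h : \int[lam]_(x in cell (m + l) j') (`|g x| `^ q) <= M `^ q * vol (R := R) (k := k) m.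
  apply: le_trans gM; apply: fine_le.
  - exact: (integrable_fin_num mC' iagq).
  - exact: (integrable_fin_num mC igq).
  - apply: ge0_subset_integral => //.
    by case/integrableP : igq.
have volE : M `^ q * vol (R := R) (k := k) m = s `^ q * vol (R := R) (k := k) (m + l).
  rewrite /s powRM ?(ltW M0) ?exprn_ge0 ?(ltW rho0)// -mulrA; congr (_ * _).
  rewrite -powR_mulrn ?(ltW rho0)// -powRrM [l%:R * q]mulrC powRrM rhoq powR_mulrn ?exprn_ge0//.
  rewrite /vol exprD invfM exprMn [2 ^+ k ^+ l]exprAC mulrCA -exprMn.
  by rewrite divff ?expr1n ?mulr1// gt_eqF// exprn_gt0.
have -> : 2 * M * rho ^+ l * vol (R := R) (k := k) (m + l) =
   s * vol (R := R) (k := k) (m + l) + c * (s `^ q * vol (R := R) (k := k) (m + l)).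
  have sq0 : s `^ q != 0 by rewrite gt_eqF// powR_gt0.
  by rewrite /c mulrA divfK// /s; ring.
by rewrite lerD2l ler_wpM2l// -volE.
Qed.

End average_bounds.

Section affine_functions.
Context {R : realType} {k : nat}.
Notation lam := (lebesgue_rV R k).
Implicit Types (x y : 'rV[R]_k) (j : 'rV[int]_k) (m : nat).

Lemma bounded_coord_cell m j l : [bounded x 0 l : R | x in (cell m j : set 'rV[R]_k)].
Proof.
exists (`|(j 0 l)%:~R / 2 ^+ m| + `|((j 0 l)%:~R + 1) / 2 ^+ m|); split; first exact: num_real.
move=> M CM x /cellP/(_ l)/andP[x1 x2] /=; apply: le_trans (ltW CM).
set a := _ / _ in x1 x2 *; set b := _ / _ in x2 *.
have ha := ler_norm (- a); have hb := ler_norm b; rewrite normrN in ha.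
have a0 := normr_ge0 a; have b0 := normr_ge0 b.
by rewrite ler_norml; apply/andP; split; lra.
Qed.

Lemma wk_affine m j i (c : 'I_k -> R) (c0 : R) :
  wk (cell m j) i (fun y => \sum_l y 0 l * c l + c0) (fun=> c i).
Proof.
have mC := @measurable_cell R k m j; have Cfin := @lebesgue_cell_fin R k m j.
have icst (c' : R) := integrable_cell_cst m j c'.
have := wkD mC (wk_sum mC (icst 0) (fun l => wkZ (c l) mC
  (wk_coord i mC Cfin (@bounded_coord_cell m j l)))) (wk_cst i c0 mC Cfin).
congr wk; apply/funext => y.
  by congr (_ + _); apply: eq_bigr => l _; rewrite mulrC.
rewrite addr0 (bigD1 i)//= eqxx mulr1 big1 ?addr0// => l /negbTE ->.
by rewrite mulr0.
Qed.

End affine_functions.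

Lemma continuous_at_sum {R : realType} {T : topologicalType} (I : Type) (s : seq I)
    (F : I -> T -> R) (z : T) : (forall i, {for z, continuous (F i)}) ->
  {for z, continuous (fun y => \sum_(i <- s) F i y)}.
Proof.
move=> cF; elim: s => [|i s IHs].
  have -> : (fun y => \sum_(i <- [::]) F i y) = cst 0 by apply/funext => y; rewrite big_nil.
  exact: cst_continuous.
have -> : (fun y => \sum_(i <- i :: s) F i y) = (fun y => F i y + \sum_(i <- s) F i y).
  by apply/funext => y; rewrite big_cons.
exact: (@continuousD _ _ _ (F i) _ z (cF i) IHs).
Qed.

Lemma continuous_linear_coord {R : realType} {k : nat} (c : 'I_k -> R) :
  continuous (fun x : 'rV[R]_k => \sum_i x 0 i * c i).
Proof.
move=> x; apply: continuous_at_sum => i.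
by apply: continuousM; [exact: coord_continuous|exact: cst_continuous].
Qed.

Local Ltac nonneg := do ?[by [] | apply: addr_ge0 | apply: mulr_ge0].

(** * The estimates on one cell *)

Section cell_estimate.
Context {R : realType} {n k : nat}.
Notation lam := (lebesgue_rV R k).
Implicit Types (x y : 'rV[R]_k) (j : 'rV[int]_k) (m : nat).
Implicit Types (f : 'rV[R]_k -> heis R n) (Df : 'rV[R]_k -> 'M[R]_(k, n.*2.+1)).

Lemma row_mulE (v : 'rV[R]_k) (A : 'M[R]_(k, n.*2.+1)) :
  v *m A = \sum_i v 0 i *: row i A.
Proof. by rewrite mulmx_sum_row. Qed.

Lemma cell_nonempty m j : exists x, cell m j x.
Proof.
exists (\row_i ((j 0 i)%:~R / 2 ^+ m)); apply/cellP => i; rewrite mxE lexx/=.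
by rewrite ltr_pM2r ?invr_gt0 ?exprn_gt0// ltrDl.
Qed.

Lemma continuous_gap p f z :
  (forall l, {for z, continuous (fun y : 'rV[R]_k => f y 0 l)}) ->
  {for z, continuous (fun y => gap p (f y))}.
Proof.
move=> cf; pose F i y := p 0 (ix i) * f y 0 (iy i) - p 0 (iy i) * f y 0 (ix i).
have cF i : {for z, continuous (F i)}.
  by apply: continuousB; apply: continuousM; (exact: cst_continuous || exact: cf).
have csum : {for z, continuous (fun y => omega p (f y))}.
  exact: continuous_at_sum.
apply: (@continuousD _ _ _ (fun y => f y 0 (it n) - p 0 (it n)) (fun y => 2 * omega p (f y))).
  by apply: continuousB; [exact: cf|exact: cst_continuous].
by apply: continuousM; [exact: cst_continuous|exact: csum].
Qed.

(* The bound on [omega] comes from testing the symmetry of the second weak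
   derivatives of [y |-> gap (f x) (f y)] against one bump. *)
Lemma cell_estimate (q : R) : (0 < k)%N -> k%:R < q ->
  exists2 C : R, 0 <= C &
  forall f Df m j (A : 'M[R]_(k, n.*2.+1)) (a M : R),
    (forall l x, cell m j x -> {for x, continuous (fun y : 'rV[R]_k => f y 0 l)}) ->
    (forall i l, wk (cell m j) i (fun x => f x 0 l) (fun x => Df x i l)) ->
    {ae lam, forall x, cell m j x -> forall i, contact_form (f x) (row i (Df x)) = 0} ->
    (forall i l, `|A i l| <= a) -> 0 < M ->
    (forall i l, lam.-integrable (cell m j) (EFin \o (fun x => `|Df x i l - A i l| `^ q)) /\
      \int[lam]_(x in cell m j) (`|Df x i l - A i l| `^ q) <= M `^ q * vol (R := R) (k := k) m) ->
  (forall b c, `|omega (row b A) (row c A)| <= C * (M * (a + M))) /\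
  forall x y, cell m j x -> cell m j y ->
    (forall l, `|(f y - f x - (y - x) *m A) 0 l| <= C * M * 2 ^- m) /\
    `|gap (f x) (f y)| <= C * (M * (a + M)) * (2 ^- m) ^+ 2.
Proof.
move=> k0 kq; have q0 : 0 < q by exact: le_lt_trans kq.
have q1 : 1 <= q by apply/ltW/le_lt_trans/kq; rewrite ler1n.
pose rho := 2 `^ (k%:R / q) : R.
have rho0 : 0 < rho by rewrite powR_gt0.
(* This is the growth rate required by [avgle_young]; the exponent [k / q] lies between 0 and 1,
   whence [1 <= rho < 2]. *)
have rhoq : rho `^ q = 2 ^+ k by rewrite -powRrM divfK ?gt_eqF// powR_mulrn.
have rho2 : rho < 2.
  rewrite -[ltRHS]lnK ?posrE// /rho /powR pnatr_eq0/= ltr_expR.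
  by rewrite gtr_pMl ?ln_gt0 ?ltr1n// ltr_pdivrMr// mul1r.
have rho1 : 1 <= rho.
  by rewrite -[leLHS](powRr0 2) /rho; apply: ler_powR; rewrite ?ler1n// divr_ge0// ltW.
have rho02 : 0 <= rho < 2 by rewrite ltW.
have [CM CM0 HM] := morrey k0 rho02.
have [CB CB0 HB] := @cell_bump_exists R k k0.
pose L : R := n.*2.+1%:R; pose n2 : R := n.*2%:R.
have L0 : 0 <= L by []; have n20 : 0 <= n2 by [].
(* The summands of [C1] are the coefficients in the expansion of [K1] below. Testing with a bump
   multiplies them by [CB], and a last use of Morrey's inequality by [CM]. *)
pose C1 := 4 * n2 * L * CM + 4 * n2 * L * k%:R + 8 * n2 * L * CM.
have C10 : 0 <= C1 by rewrite !addr_ge0 ?mulr_ge0.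
pose C2 := CB * C1; have C20 : 0 <= C2 by rewrite mulr_ge0.
pose C3 := CM * (2 * k%:R * C2 + C1).
have C30 : 0 <= C3 by rewrite mulr_ge0 ?addr_ge0 ?mulr_ge0.
exists (2 * CM + C2 + C3); first by rewrite addr_ge0// addr_ge0// mulr_ge0.
move=> f Df m j A a M cf wf contact Aa M0 DfA.
have mC := @measurable_cell R k m j.
set r : R := 2 ^- m; have r0 : 0 < r by rewrite invr_gt0 exprn_gt0.
have a0 : 0 <= a by apply: le_trans (Aa (Ordinal k0) ord0).
pose E (il : 'I_k * 'I_(n.*2.+1)) x := Df x il.1 il.2 - A il.1 il.2.
have icst (c : R) := integrable_cell_cst m j c.
have wE i l : wk (cell m j) i (fun x => f x 0 l - (x *m A) 0 l) (fun x => E (i, l) x).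
  have := wkD mC (wf i l) (wkZ (-1) mC (wk_affine m j i (fun i => A i l) 0)).
  congr wk; apply/funext => y; last by rewrite mulN1r.
  by rewrite mulN1r addr0 mxE.
have iE il : lam.-integrable (cell m j) (EFin \o E il) by case: il => i l; have [] := wE i l.
have aE il : avgle rho m j (E il) (2 * M).
  case: il => i l; have [iq Iq] := DfA i l.
  exact: (@avgle_young _ _ _ q).
have M20 : 0 <= 2 * M by rewrite mulr_ge0// ltW.
have Hf x y l : cell m j x -> cell m j y ->
    `|(f y - f x - (y - x) *m A) 0 l| <= CM * (2 * M) * r.
  move=> xj yj; have := HM m j _ _ _ M20 _ (fun i => wE i l) (fun i => aE (i, l)) y x yj xj.
  rewrite (_ : (_ - _ - _ : heis R n) 0 l = (f y 0 l - (y *m A) 0 l) - (f x 0 l - (x *m A) 0 l)).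
    apply=> z zj; apply: continuousB; first exact: cf.
    have := @continuous_linear_coord R k (fun i => A i l) z.
    rewrite (_ : (fun y : 'rV[R]_k => _) = (fun y : 'rV[R]_k => (y *m A) 0 l))//.
    by apply/funext => w; rewrite mxE.
  by rewrite mulmxBl !mxE; ring.
set H := CM * (2 * M) * r in Hf.
have r0' : 0 <= r by exact: ltW.
have M0' : 0 <= M by exact: ltW.
have H0 : 0 <= H by rewrite mulr_ge0// mulr_ge0.
have lin x y l : cell m j x -> cell m j y -> `|((y - x) *m A) 0 l| <= k%:R * r * a.
  move=> xj yj; rewrite mxE (le_trans (ler_norm_sum _ _ _))//.
  rewrite (@le_trans _ _ (\sum_(i < k) r * a))//; last first.
    by rewrite sumr_const card_ord -[leLHS]mulr_natl mulrA.
  by apply: ler_sum => i _; rewrite normrM ler_pM// !mxE; exact: cell_dist yj xj.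
have rowA b : \sum_l `|row b A 0 l| <= L * a.
  rewrite (@le_trans _ _ (\sum_(l < n.*2.+1) a))//.
    by apply: ler_sum => l _; rewrite mxE.
  by rewrite sumr_const card_ord -[leLHS]mulr_natl.
pose g x b (y : 'rV[R]_k) := Df y b (it n) + 2 * omega (f x) (row b (Df y)).
have wu x b : wk (cell m j) b (fun y => gap (f x) (f y)) (g x b).
  have := wkD mC (wkD mC (wf b (it n)) (wk_cst b (- f x 0 (it n)) mC (lebesgue_cell_fin m j)))
    (wkZ 2 mC (wk_sum mC (icst 0) (fun i : 'I_n =>
      wkD mC (wkZ (f x 0 (ix i)) mC (wf b (iy i))) (wkZ (- f x 0 (iy i)) mC (wf b (ix i)))))).
  congr wk; apply/funext => y; rewrite /gap /g /omega ?addr0; congr (_ + 2 * _).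
    by apply: eq_bigr => i _; rewrite mulNr.
  by apply: eq_bigr => i _; rewrite mulNr !mxE.
(* Replacing [f y - f x] by its linear part and [Df] by [A] in the gradient of the gap gives
   [- ell]. It is affine in [y], and its own derivatives are the numbers [omega (A_c, A_b)] to be
   bounded; the rest [err] carries a factor [M]. *)
pose ell x b (y : 'rV[R]_k) := 2 * omega ((y - x) *m A) (row b A).
have well x b c : wk (cell m j) c (ell x b) (fun=> 2 * omega (row c A) (row b A)).
  have := wk_affine m j c (fun l => 2 * omega (row l A) (row b A)) (- 2 * omega (x *m A) (row b A)).
  congr wk; apply/funext => y; rewrite /ell mulmxBl omegaBl mulrBr mulNr.
  congr (_ - _); rewrite (row_mulE y) omega_suml mulr_sumr; apply: eq_bigr => l _.
  by rewrite omegaZl; ring.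
pose err x b y := g x b y + ell x b y.
have ierr x b : lam.-integrable (cell m j) (EFin \o err x b).
  have [_ ig _] := wu x b; have [il _ _] := well x b b.
  exact: (integrableD mC ig il).
pose c1 := 2 * (n2 * H * (L * a)); pose c2 := 2 * n2 * (k%:R * r * a + H).
have c10 : 0 <= c1 by rewrite !mulr_ge0.
have c20 : 0 <= c2 by rewrite !mulr_ge0 ?addr_ge0 ?mulr_ge0 ?r0'.
pose K1 := c1 + c2 * (#|'I_(n.*2.+1)|%:R * (2 * M)).
have aerr x b : cell m j x -> avgle rho m j (err x b) K1.
  move=> xj; apply: (avgle_ae (E := fun l => E (b, l))) => //.
  apply: filterS contact => y Hy yj.
  have hE : f y - f x = (y - x) *m A + (f y - f x - (y - x) *m A) by rewrite [RHS]addrC subrK.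
  have dE : row b (Df y) = row b A + row b (Df y - A) by rewrite -linearD/= [A + _]addrC subrK.
  (* By the contact equation [g x b y] is [- 2 omega (f y - f x, Df_b)]. Splitting [Df_b] into [A_b]
     and the deviation, and then [f y - f x] in the [A_b] term, lets [ell] cancel the main part. *)
  have -> : err x b y = - (2 * omega (f y - f x - (y - x) *m A) (row b A)) +
     - (2 * omega (f y - f x) (row b (Df y - A))).
    have := Hy yj b; rewrite contact_formE mxE => /eqP; rewrite addr_eq0 => /eqP ct.
    rewrite /err /g /ell ct (omegaBl (f y - f x) ((y - x) *m A)).
    have -> : - (2 * omega (f y) (row b (Df y))) + 2 * omega (f x) (row b (Df y)) =
       - (2 * omega (f y - f x) (row b (Df y))) by rewrite omegaBl; ring.
    rewrite [in LHS]dE omegaDr; ring.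
  rewrite (le_trans (ler_normD _ _))// !normrN !normrM !(ger0_norm (_ : 0 <= 2))//.
  apply: lerD.
    rewrite /c1 ler_wpM2l// (le_trans (omega_bound _ (fun l => Hf x y l xj yj)))//.
    by rewrite ler_wpM2l// mulr_ge0.
  have -> : c2 * \sum_l `|E (b, l) y| = 2 * (n2 * (k%:R * r * a + H) * \sum_l `|E (b, l) y|).
    by rewrite /c2 !mulrA.
  rewrite ler_wpM2l//.
  have P l : `|(f y - f x) 0 l| <= k%:R * r * a + H.
    rewrite hE mxE (le_trans (ler_normD _ _))// lerD//; first exact: lin.
    exact: Hf.
  rewrite (le_trans (omega_bound _ P))// ler_wpM2l//.
    by rewrite mulr_ge0// addr_ge0// !mulr_ge0.
  by apply: ler_sum => l _; rewrite !mxE.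
have K1le : K1 <= C1 * (M * (a + M)) * r.
  have -> : C1 * (M * (a + M)) * r = K1 +
     r * M * ((8 * n2 * L * CM) * a + (4 * n2 * L * CM + 4 * n2 * L * k%:R) * M).
    by rewrite /K1 /c1 /c2 /H /C1 card_ord -/L; ring.
  by rewrite lerDl; nonneg.
have K10 : 0 <= K1 by nonneg.
have MaM : 0 <= M * (a + M) by nonneg.
have curl b c : `|omega (row b A) (row c A)| <= C2 * (M * (a + M)).
  have [x xj] := cell_nonempty m j.
  have [h [aa [bb [bh hsub h1 hB]]]] := HB m j.
  have bdf i := bumps_dfam i bh.
  have split_int b' c' : \int[lam]_(y in cell m j) (g x b' y * prodf (dfam c' h) y) =
      \int[lam]_(y in cell m j) (err x b' y * prodf (dfam c' h) y) + 2 * omega (row c' A) (row b' A).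
    have [il icl Hl] := well x b' c'.
    have := Hl _ _ _ bh hsub; rewrite RintegralZl//; last first.
      have := integrable_mul_bumps mC (icst 1) bh.
      rewrite (_ : (fun y : 'rV[R]_k => _) = prodf h)//.
      by apply/funext => y; rewrite mul1r.
    rewrite h1 mulr1 => E1; rewrite -[X in _ + X]opprK -E1 -RintegralB//.
    - by apply: eq_Rintegral => y _; rewrite /err; ring.
    - exact: integrable_mul_bumps (bdf c').
    - exact: integrable_mul_bumps (bdf c').
  have small b' c' : `|\int[lam]_(y in cell m j) (err x b' y * prodf (dfam c' h) y)| <= C1 * CB * (M * (a + M)).
    rewrite (le_trans (Rintegral_mul_bound mC (ierr x b') (integrable_mul_bumps mC (ierr x b') (bdf c')) (fun y _ => hB c' y)))//.
    have := @aerr x b' xj 0%N j; rewrite addn0 => /(_ (fun z zj => zj)); rewrite expr0 mulr1 => I1.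
    have v0 := @vol_gt0 R k m.
    have B0 : 0 <= CB * 2 ^+ m / vol (R := R) (k := k) m.
      by rewrite divr_ge0 ?mulr_ge0 ?exprn_ge0//.
    rewrite (le_trans (ler_wpM2l B0 (le_trans I1 (ler_wpM2r (ltW v0) K1le))))//.
    rewrite /r le_eqVlt; apply/orP; left; apply/eqP; field.
    by rewrite !gt_eqF// exprn_gt0.
  (* The two affine parts stand on opposite sides of the symmetry relation. As [omega] is
     antisymmetric, they add up to [4 omega] instead of cancelling. *)
  have := wk_curl (wu x b) (wu x c) bh hsub; rewrite !split_int [omega (row c A) _]omegaC => E1.
  have s1 := small b c; have s2 := small c b.
  have E2 : 4 * omega (row b A) (row c A) =
      \int[lam]_(y in cell m j) (err x b y * prodf (dfam c h) y) -
      \int[lam]_(y in cell m j) (err x c y * prodf (dfam b h) y).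
    by apply/eqP; rewrite eq_sym subr_eq; apply/eqP; move: E1; lra.
  have : 4 * `|omega (row b A) (row c A)| <= C1 * CB * (M * (a + M)) + C1 * CB * (M * (a + M)).
    rewrite -[X in X * _ <= _](ger0_norm (_ : 0 <= 4))// -normrM E2.
    by rewrite (le_trans (ler_normB _ _))// lerD.
  have w0 := normr_ge0 (omega (row b A) (row c A)).
  rewrite /C2 [CB * _]mulrC; lra.
split.
  by move=> b c; rewrite (le_trans (curl b c))// ler_wpM2r// addrAC lerDr; nonneg.
move=> x y xj yj; split.
  move=> l; rewrite (le_trans (Hf x y l xj yj))// /H mulrA ler_wpM2r ?r0'//.
  by rewrite ler_wpM2r ?M0'// [CM * 2]mulrC -addrA lerDl; nonneg.
(* With [omega] now small on the rows of [A], [ell] is small as well. Thus the full gradient of the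
   gap, not only [err], has small averages, and Morrey's inequality applies to the gap itself. *)
pose c3 := 2 * k%:R * r * (C2 * (M * (a + M))).
have c30 : 0 <= c3 by nonneg.
have ag b : avgle rho m j (g x b) (c3 + 1 * (#|{: unit}|%:R * K1)).
  have [_ ig _] := wu x b.
  apply: (avgle_ae (E := fun _ : unit => err x b)) => //; first by move=> _; exact: aerr.
  apply: aeW => z zj; rewrite mul1r (bigD1 tt)//= big1 ?addr0; last by case.
  have -> : g x b z = err x b z - ell x b z by rewrite /err addrK.
  rewrite (le_trans (ler_normB _ _))// addrC lerD2r.
  rewrite /ell row_mulE omega_suml normrM ger0_norm// /c3 -!mulrA ler_wpM2l//.
  rewrite (le_trans (ler_norm_sum _ _ _))// (@le_trans _ _ (\sum_(i < k) r * (C2 * (M * (a + M)))))//.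
    apply: ler_sum => i _; rewrite omegaZl normrM ler_pM//.
    by rewrite !mxE; exact: cell_dist zj xj.
  by rewrite sumr_const card_ord -[leLHS]mulr_natl /C2 !mulrA.
have K30 : 0 <= c3 + 1 * (#|{: unit}|%:R * K1) by nonneg.
have := HM m j _ _ _ K30 _ (fun b => wu x b) ag y x yj xj.
rewrite [gap (f x) (f x)]/gap subrr omega_self mulr0 addr0 subr0 => H'.
rewrite (le_trans (H' _))//.
  by move=> z zj; apply: continuous_gap => l; exact: cf.
rewrite card_unit !mul1r -/r [r ^+ 2]expr2 mulrA ler_wpM2r ?r0'//.
rewrite (@le_trans _ _ (C3 * (M * (a + M)) * r))//; last first.
  by rewrite ler_wpM2r ?r0'// ler_wpM2r// lerDr; nonneg.
rewrite (le_trans (ler_wpM2l CM0 (lerD (lexx c3) K1le)))//.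
by rewrite le_eqVlt; apply/orP; left; apply/eqP; rewrite /c3 /C3; ring.
Qed.

End cell_estimate.

(** * Density of dyadic step functions in [L^q] *)

Lemma powR_normD (R : realType) (q a b : R) : 0 <= q ->
  `|a + b| `^ q <= 2 `^ q * (`|a| `^ q + `|b| `^ q).
Proof.
move=> q0; have [ab|ab] := leP `|a| `|b|.
- rewrite (@le_trans _ _ ((2 * `|b|) `^ q))//.
    rewrite ge0_ler_powR ?nnegrE ?mulr_ge0// (le_trans (ler_normD _ _))//.
    by rewrite mulr_natl mulr2n lerD2r.
  by rewrite powRM// ler_wpM2l ?powR_ge0// lerDr powR_ge0.
- rewrite (@le_trans _ _ ((2 * `|a|) `^ q))//.
    rewrite ge0_ler_powR ?nnegrE ?mulr_ge0// (le_trans (ler_normD _ _))//.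
    by rewrite mulr_natl mulr2n lerD2l ltW.
  by rewrite powRM// ler_wpM2l ?powR_ge0// lerDl powR_ge0.
Qed.

Section dyadic_density.
Context {R : realType} {k : nat}.
Notation lam := (lebesgue_rV R k).
Implicit Types (x y : 'rV[R]_k) (j : 'rV[int]_k) (m : nat) (f g h : 'rV[R]_k -> R).
Variables (D : set 'rV[R]_k) (q : R).
Hypotheses (mD : measurable D) (Dfin : (lam D < +oo)%E) (q1 : 1 <= q).

Let q0 : 0 < q. Proof. exact: lt_le_trans q1. Qed.
Let q0' : 0 <= q. Proof. exact: ltW. Qed.

Lemma measurable_dyadic m (tau : 'rV[int]_k -> R) :
  measurable_fun setT (fun x : 'rV[R]_k => tau (cellof m x)).
Proof.
move=> _ Y mY; rewrite setTI.
have -> : (fun x : 'rV[R]_k => tau (cellof m x)) @^-1` Y =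
    \bigcup_(j in tau @^-1` Y) cell m j.
  apply/seteqP; split => [x Yx|x [j Yj jx]]; first by exists (cellof m x).
  by rewrite /preimage/= (jx : cellof m x = j).
rewrite bigcup_mkcond; apply: countable_bigcupT_measurable => // j.
by case: ifP => // _; exact: measurable_cell.
Qed.

Definition Lq g : \bar R := (\int[lam]_(x in D) (`|g x| `^ q)%:E)%E.

Lemma measurable_Lq g : measurable_fun D g -> measurable_fun D (fun x => (`|g x| `^ q)%:E).
Proof.
move=> mg; apply/measurable_EFinP.
apply: (@measurableT_comp _ _ _ _ _ _ (@powR R ^~ q)); first exact: measurable_powR.
exact: measurableT_comp.
Qed.

Lemma Lq_le f g : measurable_fun D f -> measurable_fun D g ->
  (forall x, D x -> `|f x| <= `|g x|) -> (Lq f <= Lq g)%E.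
Proof.
move=> mf mg fg; have mf' := measurable_Lq mf; have mg' := measurable_Lq mg.
apply: (ge0_le_integral lam mD _ mf' mg'); first by move=> x _; rewrite lee_fin powR_ge0.
by move=> x Dx; rewrite lee_fin ge0_ler_powR ?nnegrE ?fg.
Qed.

Lemma Lq_triangle f g h : measurable_fun D f -> measurable_fun D g -> measurable_fun D h ->
  (forall x, D x -> `|f x| <= `|g x| + `|h x|) ->
  (Lq f <= (2 `^ q)%:E * (Lq g + Lq h))%E.
Proof.
move=> mf mg mh fgh.
have p0 (a : R) : (0 <= (a `^ q)%:E)%E by rewrite lee_fin powR_ge0.
have ms : measurable_fun D (fun x => (`|g x| `^ q)%:E + (`|h x| `^ q)%:E)%E.
  by apply: emeasurable_funD; exact: measurable_Lq.
rewrite /Lq -(ge0_integralD lam mD (fun x _ => p0 `|g x|) (measurable_Lq mg) (fun x _ => p0 `|h x|) (measurable_Lq mh)).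
rewrite -(ge0_integralZl lam mD ms (fun x _ => adde_ge0 (p0 _) (p0 _)) (p0 2)).
have mf' := measurable_Lq mf; have ms' := measurable_funeM (2 `^ q)%:E ms.
apply: (ge0_le_integral lam mD _ mf' ms') => //.
move=> x Dx; rewrite -EFinD -EFinM lee_fin.
rewrite (le_trans _ (le_trans (powR_normD `|g x| `|h x| q0') _)) ?normr_id//.
by rewrite ge0_ler_powR ?nnegrE// (le_trans (fgh x Dx))// ler_norm.
Qed.

Lemma Lq_triangle_le (e : R) f g h : 0 < e ->
  measurable_fun D f -> measurable_fun D g -> measurable_fun D h ->
  (forall x, D x -> `|f x| <= `|g x| + `|h x|) ->
  (Lq g <= (e / (2 `^ q) / 2)%:E)%E -> (Lq h <= (e / (2 `^ q) / 2)%:E)%E ->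
  (Lq f <= e%:E)%E.
Proof.
move=> e0 mf mg mh fgh ge he; apply: (le_trans (Lq_triangle mf mg mh fgh)).
have c0 : 0 < (2 : R) `^ q by rewrite powR_gt0.
have -> : e%:E = ((2 `^ q)%:E * ((e / (2 `^ q) / 2)%:E + (e / (2 `^ q) / 2)%:E))%E.
  by rewrite -EFinD -EFinM -splitr mulrC divfK// gt_eqF.
by apply: lee_wpmul2l (leeD ge he); rewrite lee_fin ltW.
Qed.

Definition cell_approx g := measurable_fun D g /\
  forall e : R, 0 < e -> exists m (tau : 'rV[int]_k -> R), (Lq (fun x => (g x - tau (cellof m x))%R) <= e%:E)%E.

Let common m1 tau1 m2 tau2 : exists m tau1' tau2', forall x : 'rV[R]_k,
  tau1 (cellof m1 x) = tau1' (cellof m x) :> R /\ tau2 (cellof m2 x) = tau2' (cellof m x) :> R.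
Proof.
exists (m1 + m2)%N, (fun j => tau1 (iter m2 parent j)), (fun j => tau2 (iter m1 parent j)) => x.
by rewrite -(cellof_iter m1 m2) addnC -(cellof_iter m2 m1).
Qed.

Let measurable_dy m tau : measurable_fun D (fun x : 'rV[R]_k => tau (cellof m x) : R).
Proof. exact: measurable_funTS (measurable_dyadic m tau). Qed.

Let e'0 (e : R) : 0 < e -> 0 < e / (2 `^ q) / 2.
Proof. by move=> e0; rewrite !divr_gt0 ?powR_gt0. Qed.

(** This Lipschitz condition treats sums, differences and maxima at once: [F] of two step functions
    on a common refinement is again a step function. *)
Let approx2 (F : R -> R -> R) g h :
  measurable_fun D (fun x => F (g x) (h x)) ->
  (forall a b c d, `|F a b - F c d| <= `|a - c| + `|b - d|) ->
  cell_approx g -> cell_approx h -> cell_approx (fun x => F (g x) (h x)).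
Proof.
move=> mF HF [mg ag] [mh ah]; split; [exact: mF|move=> e e0].
have [m1 [t1 h1]] := ag _ (e'0 e0); have [m2 [t2 h2]] := ah _ (e'0 e0).
have [m [t1' [t2' E]]] := common m1 t1 m2 t2.
exists m, (fun j => F (t1' j) (t2' j)).
apply: (Lq_triangle_le e0 _ _ _ _ h1 h2).
- exact: measurable_funB mF (measurable_dy m (fun j => F (t1' j) (t2' j))).
- exact: measurable_funB mg (measurable_dy m1 t1).
- exact: measurable_funB mh (measurable_dy m2 t2).
- by move=> x _; have [-> ->] := E x; exact: HF.
Qed.

Lemma cell_approx_step m (tau : 'rV[int]_k -> R) : cell_approx (fun x => tau (cellof m x)).
Proof.
split => // e e0; exists m, tau; rewrite /Lq integral0_eq ?lee_fin ?(ltW e0)// => x _.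
by rewrite subrr normr0 powR0// gt_eqF.
Qed.

Lemma cell_approxD g h : cell_approx g -> cell_approx h ->
  cell_approx (fun x => g x + h x).
Proof.
move=> ag ah; apply: (approx2 (F := fun a b => a + b)) => //.
- by apply: measurable_funD; [exact: ag.1|exact: ah.1].
- by move=> a b c d; rewrite opprD addrACA ler_normD.
Qed.

Lemma cell_approx_max g h : cell_approx g -> cell_approx h ->
  cell_approx (fun x => Num.max (g x) (h x)).
Proof.
move=> ag ah; apply: (approx2 (F := Num.max)) => //.
- by apply: measurable_maxr; [exact: ag.1|exact: ah.1].
- move=> a b c d.
  have h1 := ler_norm (a - c); have h2 := ler_norm (b - d).
  have h3 := ler_norm (- (a - c)); have h4 := ler_norm (- (b - d)).
  have h5 := normr_ge0 (a - c); have h6 := normr_ge0 (b - d).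
  rewrite !normrN in h3 h4.
  by rewrite ler_norml; case: (leP a b); case: (leP c d) => *; apply/andP; split; lra.
Qed.

Lemma cell_approx_close g : measurable_fun D g ->
  (forall e : R, 0 < e -> exists2 h, cell_approx h & (Lq (fun x => (g x - h x)%R) <= e%:E)%E) ->
  cell_approx g.
Proof.
move=> mg H; split; [exact: mg|move=> e e0].
have [h [mh ah] gh] := H _ (e'0 e0); have [m [tau ht]] := ah _ (e'0 e0).
exists m, tau; apply: (Lq_triangle_le e0 _ _ _ _ gh ht).
- exact: measurable_funB mg (measurable_dy m tau).
- exact: measurable_funB mg mh.
- exact: measurable_funB mh (measurable_dy m tau).
- by move=> x _; rewrite -[X in `|X| <= _](subrKA (h x)) ler_normD.
Qed.

Lemma cell_approx_lim g (g_ : nat -> 'rV[R]_k -> R) (G : 'rV[R]_k -> R) :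
  measurable_fun D g -> (forall n, cell_approx (g_ n)) ->
  (forall x, D x -> g_ n x @[n --> \oo] --> g x) ->
  lam.-integrable D (EFin \o G) ->
  (forall n x, D x -> `|g x - g_ n x| `^ q <= G x) ->
  cell_approx g.
Proof.
move=> mg ag gg iG HG; apply: cell_approx_close => // e e0.
have mf n : measurable_fun D (fun x => (`|g x - g_ n x| `^ q)%:E).
  by apply: measurable_Lq; apply: measurable_funB => //; exact: (ag n).1.
have := @dominated_cvg _ _ _ lam D mD (fun n x => (`|g x - g_ n x| `^ q)%:E) (cst 0%E) (EFin \o G) mf.
rewrite integral0 => H.
have : Lq (fun x => g x - g_ n x) @[n --> \oo] --> 0%E.
  apply: H => //.
  - move=> x Dx; apply/fine_cvgP; split; first exact: nearW.
    apply/cvgrPdist_le => d d0; have := gg x Dx.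
    have d1 : 0 < Num.min d 1 by rewrite lt_min d0 ltr01.
    move=> /cvgrPdist_le/(_ _ d1); apply: filterS => n hn.
    rewrite /= sub0r normrN ger0_norm ?powR_ge0//.
    move: hn; rewrite le_min => /andP[hd h1].
    apply: le_trans hd; have [->|t0] := eqVneq `|g x - g_ n x| 0.
      by rewrite powR0// gt_eqF.
    by apply: ge1r_powR => //; rewrite h1 andbT lt_neqAle eq_sym t0/=.
  - by move=> n x Dx; rewrite gee0_abs ?lee_fin ?powR_ge0// HG.
move=> /fine_cvgP[fin /cvgrPdist_le/(_ _ e0) Hn].
have [n [fn hn]] : exists n, Lq (fun x => g x - g_ n x) \is a fin_num /\ `|0 - fine (Lq (fun x => g x - g_ n x))| <= e.
  have [N1 _ h1] := fin; have [N2 _ h2] := Hn.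
  exists (maxn N1 N2); split; first exact: (h1 _ (leq_maxl _ _)).
  exact: (h2 _ (leq_maxr _ _)).
exists (g_ n) => //; rewrite -(fineK fn) lee_fin.
by move: hn; rewrite sub0r normrN; apply: le_trans; exact: ler_norm.
Qed.

(** The sets with approximable indicator form a sigma-algebra. It contains the half-spaces bounded
    by a coordinate hyperplane, and these generate. *)
Lemma cell_approx_indic (r : R) (E : set 'rV[R]_k) : 0 <= r -> measurable E ->
  cell_approx (fun x => r * \1_E x).
Proof.
move=> r0 mE.
pose A := [set E : set 'rV[R]_k | measurable E /\ cell_approx (fun x => r * \1_E x)].
have sA : sigma_algebra setT A.
  split.
  - split => //; have := cell_approx_step 0 (fun=> 0).
    by under [in X in _ -> X]eq_fun do rewrite indic0 mulr0.
  - move=> B [mB aB]; split; first exact: measurableD.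
    have -> : (fun x => r * \1_(setT `\` B) x) = (fun x : 'rV[R]_k => r - r * \1_B x).
      by apply/funext => x; rewrite setTD indicC indicE; case: (x \in B); rewrite /= ?mulr1 ?mulr0 ?subrr ?subr0.
    apply: (approx2 (F := fun a b => a - b)) (cell_approx_step 0 (fun=> r)) aB.
    + apply: measurable_funB => //; apply: measurable_funM => //.
    + by move=> a b c d; rewrite [X in `|X| <= _](_ : _ = (a - c) - (b - d)) ?ler_normB//; ring.
  - move=> F AF; have mF n : measurable (F n) by have [] := AF n.
    split; first exact: bigcupT_measurable.
    have mB n : measurable (\big[setU/set0]_(i < n) F i) by apply: bigsetU_measurable => i _.
    (* Finite unions are obtained with maxima, the countable union by dominated convergence; a
       constant is an integrable majorant because [D] has finite measure. *)
    apply: (@cell_approx_lim _ (fun n x => r * \1_(\big[setU/set0]_(i < n) F i) x) (cst (r `^ q))).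
    + apply: measurable_funM => //; apply: measurable_funTS; apply: measurable_indic; exact: bigcupT_measurable.
    + elim=> [|n IHn].
        have := cell_approx_step 0 (fun=> 0).
        by under [in X in _ -> X]eq_fun do rewrite big_ord0 indic0 mulr0.
      have := cell_approx_max IHn (AF n).2; congr cell_approx; apply/funext => x.
      rewrite big_ord_recr/= !indicE in_setU; case: (x \in F n); case: (x \in \big[setU/set0]_(i < n) F i);
        rewrite ?mulr1 ?mulr0 ?maxxx//; [exact/max_idPr|exact/max_idPl].
    + move=> x Dx; apply/cvgrPdist_le => e e0.
      have [[N _ FNx]|nF] := pselect ((\bigcup_n F n) x).
        exists N.+1 => // n /= Nn; rewrite !indicE !mem_set ?subrr ?normr0 ?ltW//.
          by rewrite -bigcup_mkord; exists N.
        by exists N.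
      apply: nearW => n; rewrite !indicE !memNset ?subrr ?normr0 ?ltW//.
      by rewrite -bigcup_mkord => -[i _ Fix]; apply: nF; exists i.
    + apply: measurable_bounded_integrable => //; exact: bounded_cst.
    + move=> n x _; rewrite ge0_ler_powR ?nnegrE// -mulrBr normrM ger0_norm// ler_piMr// ler_norml.
      by rewrite !indicE; case: (_ \in _); case: (_ \in _) => /=; apply/andP; split; lra.
suff : measurable `<=` A by move=> /(_ _ mE)[].
apply: smallest_sub => //; rewrite -bigcup_seq => _ [i _ [B mB <-]].
pose A1 := [set B : set R | A (setT `&` (fun v : 'rV[R]_k => v 0 i) @^-1` B)].
have : (@ocitv R).-sigma.-measurable B := mB.
rewrite RGenInftyO.measurableE; suff H : <<s @RGenInftyO.G R >> `<=` A1 by exact: H.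
apply: smallest_sub.
  split.
  - by rewrite /A1/= preimage_set0 setI0; have [] := sA.
  - by move=> C; rewrite /A1/= !setTI setTD preimage_setC -setTD; have [_ H _] := sA; exact: H.
  - move=> F HF; rewrite /A1/= setTI preimage_bigcup; have [_ _ H] := sA; apply: H => n.
    by rewrite -[X in A X]setTI; exact: HF.
move=> _ [x ->]; rewrite /A1/= setTI.
(* The half-space is exhausted by half-spaces with dyadic bounds from below; the one of level [m] is
   exactly a union of cells of level [m]. *)
pose ray m : set 'rV[R]_k := [set v | v 0 i < (Num.floor (2 ^+ m * x))%:~R / 2 ^+ m].
have -> : (fun v : 'rV[R]_k => v 0 i) @^-1` `]-oo, x[ = \bigcup_m ray m.
  have p2 m : 0 < (2 : R) ^+ m by exact: exprn_gt0.
  apply/seteqP; split => [v /=|v [m _]].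
    rewrite in_itv/= -subr_gt0 => /expr2N_lt[m hm]; exists m => //.
    rewrite /ray/= ltr_pdivlMr//.
    have : 2 ^+ m * x < (Num.floor (2 ^+ m * x) + 1)%:~R.
      by have /andP[] : (Num.floor (2 ^+ m * x))%:~R <= 2 ^+ m * x < (Num.floor (2 ^+ m * x) + 1)%:~R by rewrite -floor_eq.
    move: hm; rewrite ltrBrDr -(ltr_pM2l (p2 m)) mulrDr divff ?gt_eqF// intrD.
    rewrite [v 0 i * _]mulrC; lra.
  rewrite /ray/= in_itv/= => h; apply: (lt_le_trans h).
  by rewrite ler_pdivrMr// mulrC floor_le.
have [_ _ H] := sA; apply: H => m; split.
  rewrite /ray -[X in measurable X]setTI.
  have := measurable_rV_coord i measurableT (measurable_itv `]-oo, ((Num.floor (2 ^+ m * x))%:~R / 2 ^+ m : R)[).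
  by congr measurable; congr (_ `&` _); apply/seteqP; split => v; rewrite /preimage/= in_itv.
have := cell_approx_step m (fun j : 'rV[int]_k => r * (j 0 i < Num.floor (2 ^+ m * x))%R%:R).
congr cell_approx; apply/funext => v; congr (_ * _); rewrite indicE mxE; congr (nat_of_bool _)%:R.
apply/idP/idP => [h|].
  by rewrite inE /ray/= ltr_pdivlMr// mulrC -floor_lt_int.
by rewrite inE /ray/= ltr_pdivlMr// mulrC -floor_lt_int.
Qed.

Import HBSimple HBNNSimple.

Lemma cell_approx_nnsfun (h : {nnsfun 'rV[R]_k >-> R}) : cell_approx h.
Proof.
have -> : (h : 'rV[R]_k -> R) = (fun x => \sum_(y <- finmap.enum_fset (fset_set (range h))) y * \1_(h @^-1` [set y]) x).
  by apply/funext => x; rewrite fimfunE fsbig_finite.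
elim: (finmap.enum_fset (fset_set (range h))) => [|y s IHs].
  have := cell_approx_step 0 (fun=> 0); congr cell_approx.
  by apply/funext => x; rewrite big_nil.
have -> : (fun x => \sum_(y0 <- y :: s) y0 * \1_(h @^-1` [set y0]) x) =
    (fun x => y * \1_(h @^-1` [set y]) x + \sum_(y0 <- s) y0 * \1_(h @^-1` [set y0]) x).
  by apply/funext => x; rewrite big_cons.
apply: cell_approxD; last exact: IHs.
have [y0|y0] := leP 0 y; first exact: cell_approx_indic.
have := cell_approx_step 0 (fun=> 0); congr cell_approx.
apply/funext => x; rewrite indicE memNset ?mulr0//= => hy.
by have : 0 <= h x by []; rewrite hy leNgt y0.
Qed.

Let cell_approx_ge0 g : measurable_fun D g -> (forall x, 0 <= g x) ->
  lam.-integrable D (EFin \o (fun x => `|g x| `^ q)) -> cell_approx g.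
Proof.
move=> mg g0 ig; have mg' : measurable_fun D (EFin \o g) by exact/measurable_EFinP.
have cv := cvg_nnsfun_approx mD mg' (fun x _ => g0 x : (0 <= (EFin \o g) x)%E).
apply: (@cell_approx_lim g (fun n => nnsfun_approx mD mg' n) (fun x => `|g x| `^ q)) => //.
- by move=> n; exact: cell_approx_nnsfun.
- by move=> x Dx; have /fine_cvgP[_] := cv x Dx.
- move=> n x Dx; rewrite ge0_ler_powR ?nnegrE//.
  have h0 : 0 <= nnsfun_approx mD mg' n x by exact: fun_ge0.
  have hg : nnsfun_approx mD mg' n x <= g x.
    have /fine_cvgP[_ c] := cv x Dx.
    have nd : nondecreasing_seq (fun n => nnsfun_approx mD mg' n x).
      by move=> a b ab; have /lefP/(_ x) := nd_nnsfun_approx mD mg' ab.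
    have := nondecreasing_cvgn_le nd (cvgP _ c) n.
    by rewrite (cvg_lim _ c).
  by rewrite !ger0_norm ?subr_ge0// gerBl.
Qed.

Lemma Lq_integrable g : measurable_fun D g -> (Lq g < +oo)%E ->
  lam.-integrable D (EFin \o (fun x => `|g x| `^ q)).
Proof.
move=> mg Lg; apply/integrableP; split; first exact: measurable_Lq.
rewrite (le_lt_trans _ Lg)// /Lq le_eqVlt; apply/orP; left; apply/eqP.
by apply: eq_integral => x _; rewrite gee0_abs// lee_fin powR_ge0.
Qed.

Lemma cell_approx_Lq g : measurable_fun D g -> (Lq g < +oo)%E -> cell_approx g.
Proof.
move=> mg ig.
have mp : measurable_fun D (fun x => Num.max (g x) 0) by exact: measurable_maxr.
have mn : measurable_fun D (fun x => Num.max (- g x) 0).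
  apply: measurable_maxr => //.
  exact: measurable_funN.
have lep x : `|Num.max (g x) 0| <= `|g x|.
  by case: (leP (g x) 0) => gx; rewrite ?normr0.
have len x : `|Num.max (- g x) 0| <= `|g x|.
  by case: (leP (- g x) 0) => gx; rewrite ?normr0// normrN.
have -> : g = (fun x => Num.max (g x) 0 - Num.max (- g x) 0).
  apply/funext => x; case: (leP (g x) 0); case: (leP (- g x) 0) => *; lra.
apply: (approx2 (F := fun a b => a - b)).
- exact: measurable_funB.
- by move=> a b c d; rewrite [X in `|X| <= _](_ : _ = (a - c) - (b - d)) ?ler_normB//; ring.
- apply: cell_approx_ge0 => //; first by move=> x; rewrite le_max lexx orbT.
  apply: (Lq_integrable _ (le_lt_trans (Lq_le _ mg _) ig)) => //.
- apply: cell_approx_ge0 => //; first by move=> x; rewrite le_max lexx orbT.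
  apply: (Lq_integrable _ (le_lt_trans (Lq_le _ mg _) ig)) => //.
Qed.

End dyadic_density.

(** * Bounding the Carnot-Caratheodory distance *)

Section poly_curve.
Context {R : realType}.

Lemma horner_itv_bound (P : {poly R}) :
  exists2 M : R, 0 <= M & forall s, `|s| <= 1 -> `|P.[s]| <= M.
Proof.
exists (\sum_(i < size P) `|P`_i|); first exact: sumr_ge0.
move=> s s1; rewrite horner_coef (le_trans (ler_norm_sum _ _ _))//.
apply: ler_sum => i _; rewrite normrM normrX ler_piMr// exprn_ile1//.
Qed.

Lemma horner_lipschitz (P : {poly R}) : exists2 M : R, 0 <= M &
  forall u v : R, -1 <= u -> u <= v -> v <= 1 -> `|P.[v] - P.[u]| <= M * (v - u).
Proof.
have [M M0 HM] := horner_itv_bound P^`(); exists M => // u v u1 uv v1.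
have [|c cuv ->] := @MVT_segment R (horner P) (horner P^`()) u v uv.
  by apply: continuous_subspaceT; exact: continuous_horner.
rewrite normrM (ger0_norm (_ : 0 <= v - u)) ?subr_ge0// ler_wpM2r ?subr_ge0//.
apply: HM; rewrite ler_norml; move: cuv; rewrite in_itv/= => /andP[? ?]; apply/andP; split; lra.
Qed.

(** With polynomial coordinates, being horizontal and having the right endpoints become polynomial
    identities, and absolute continuity follows from a Lipschitz bound. *)
Definition poly_curve m (P : 'I_m -> {poly R}) (s : R) : 'rV[R]_m := \row_l (P l).[s].

Lemma poly_curve_derivable m (P : 'I_m -> {poly R}) s : derivable (poly_curve P) s 1.
Proof.
apply/derivable_mxP => i j.
have -> : (fun x => poly_curve P x i j) = horner (P j) by apply/funext => x; rewrite mxE.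
exact: derivable_horner.
Qed.

Lemma poly_curve_derive1 m (P : 'I_m -> {poly R}) s :
  derive1 (poly_curve P) s = poly_curve (fun l => (P l)^`()) s.
Proof.
rewrite derive1E derive_mx; last exact: poly_curve_derivable.
apply/rowP => j; rewrite !mxE derivE derive1E; congr ('D_1 _ s).
by apply/funext => x; rewrite mxE.
Qed.

Lemma poly_curve_ac m (P : 'I_m.+1 -> {poly R}) : absolutely_continuous (-1) 1 (poly_curve P).
Proof.
have [M M0 HM] : exists2 M : R, 0 < M & forall u v : R, -1 <= u -> u <= v -> v <= 1 ->
    `|poly_curve P v - poly_curve P u| <= M * (v - u).
  have /choice[M HM] (l : 'I_m.+1) : exists M : R, 0 <= M /\
      forall u v : R, -1 <= u -> u <= v -> v <= 1 -> `|(P l).[v] - (P l).[u]| <= M * (v - u).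
    by have [M ? ?] := horner_lipschitz (P l); exists M.
  have S0 : 0 <= \sum_l M l by apply: sumr_ge0 => l _; exact: (HM l).1.
  exists (\sum_l M l + 1); first by rewrite ltr_wpDl.
  move=> u v u1 uv v1; rewrite [ `|_| ]mx_normrE; apply/bigmax_leP; split.
    by rewrite mulr_ge0 ?subr_ge0 ?addr_ge0.
  move=> [i l] _; rewrite !mxE/= (le_trans ((HM l).2 _ _ u1 uv v1))//.
  rewrite ler_wpM2r ?subr_ge0// (bigD1 l)//= -addrA lerDl addr_ge0//.
  by apply: sumr_ge0 => i' _; exact: (HM i').1.
move=> e e0; exists (e / M); first exact: divr_gt0.
move=> N u v uv _ S; rewrite (@le_lt_trans _ _ (\sum_i (M * (v i - u i))))//.
  by apply: ler_sum => i _; have [] := uv i; exact: HM.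
by rewrite -mulr_sumr mulrC -ltr_pdivlMr.
Qed.

Lemma continuous_horner_sqr_sum n (P Q : 'I_n -> {poly R}) :
  continuous (fun s : R => Num.sqrt (\sum_(j < n) ((P j).[s] ^+ 2 + (Q j).[s] ^+ 2))).
Proof.
move=> s; have -> : (fun s : R => Num.sqrt (\sum_(j < n) ((P j).[s] ^+ 2 + (Q j).[s] ^+ 2))) =
   Num.sqrt \o horner (\sum_(j < n) (P j ^+ 2 + Q j ^+ 2)).
  apply/funext => x /=; rewrite horner_sum; congr Num.sqrt.
  by apply: eq_bigr => j _; rewrite hornerD !horner_exp.
by apply: continuous_comp; [exact: continuous_horner|exact: sqrt_continuous].
Qed.

End poly_curve.

Section dcc_bound.
Context {R : realType} {n : nat}.
Implicit Types (p q w : heis R n).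

Let ixE (j : 'I_n) : ix j = j.*2 :> nat.
Proof. by rewrite inordK// ltnS leq_double ltnW. Qed.

Let iyE (j : 'I_n) : iy j = j.*2.+1 :> nat.
Proof. by rewrite inordK// ltnS ltn_double. Qed.

Lemma ix_eq (i j : 'I_n) : (ix i == ix j) = (i == j).
Proof. by rewrite -val_eqE/= !ixE (inj_eq double_inj). Qed.

Lemma iy_eq (i j : 'I_n) : (iy i == iy j) = (i == j).
Proof. by rewrite -val_eqE/= !iyE eqSS (inj_eq double_inj). Qed.

Lemma ix_iy_eqF (i j : 'I_n) : (ix i == iy j) = false.
Proof.
by apply/eqP => /(congr1 val)/(congr1 odd); rewrite /= ixE iyE/= !odd_double.
Qed.

Lemma ix_it_neq (i : 'I_n) : ix i != it n.
Proof. by rewrite -val_eqE/= ixE (inj_eq double_inj) ltn_eqF. Qed.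

Lemma iy_it_neq (i : 'I_n) : iy i != it n.
Proof.
by apply/eqP => /(congr1 val)/(congr1 odd); rewrite /= iyE/= !odd_double.
Qed.

Lemma dcc_poly_curve (P : 'I_n.*2.+1 -> {poly R}) (B : R) : 0 <= B ->
  (forall s, contact_form (poly_curve P s) (poly_curve (fun l => (P l)^`()) s) = 0) ->
  (forall s l, `|s| <= 1 -> l != it n -> `|(P l)^`().[s]| <= B) ->
  (dcc (poly_curve P (-1)) (poly_curve P 1) <= (4 * n%:R * B)%:E)%E.
Proof.
move=> B0 HP HB; rewrite /dcc; have l1 : (-1 : R) < 1 by lra.
apply: (@le_trans _ _ (curve_length (-1) 1 (poly_curve P))).
  apply: ereal_inf_lbound; exists (-1), 1, (poly_curve P); split => //.
  split; first exact: poly_curve_ac.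
  apply: aeW => s _; split; first exact: poly_curve_derivable.
  by rewrite horizontal_spaceE poly_curve_derive1 HP.
pose h s := Num.sqrt (\sum_(j < n) ((P (ix j))^`().[s] ^+ 2 + (P (iy j))^`().[s] ^+ 2)).
have hE s : horizontal_norm (poly_curve P s) (derive1 (poly_curve P) s) = h s.
  rewrite poly_curve_derive1 horizontal_normE//; congr Num.sqrt.
  by apply: eq_bigr => j _; rewrite !mxE.
pose I : set R := `[(-1 : R), 1]%classic.
have -> : curve_length (-1) 1 (poly_curve P) = (\int[lebesgue_measure]_(s in I) (h s)%:E)%E.
  by apply: eq_integral => s _; rewrite hE.
have mh : measurable_fun I (EFin \o h).
  apply/measurable_EFinP; apply: measurable_funTS; apply: continuous_measurable_fun.
  exact: continuous_horner_sqr_sum.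
(* The speed is at most [sqrt (2 n) B], hence at most [2 n B] since [n] is a natural number; the
   parameter interval has length 2. *)
rewrite (@le_trans _ _ (\int[lebesgue_measure]_(s in I) (2 * n%:R * B)%:E)%E)//.
  apply: (ge0_le_integral lebesgue_measure (measurable_itv _) _ mh (measurable_cst _)).
    by move=> s _; rewrite lee_fin sqrtr_ge0.
  move=> s; rewrite /= in_itv/= => s1; rewrite lee_fin.
  have s1' : `|s| <= 1 by rewrite ler_norml.
  have sB (l : 'I_n.*2.+1) : l != it n -> (P l)^`().[s] ^+ 2 <= B ^+ 2.
    by move=> lt; rewrite -[leLHS]real_normK ?num_real// lerXn2r ?nnegrE// HB.
  rewrite -[leRHS]ger0_norm ?mulr_ge0// -sqrtr_sqr ler_wsqrtr//.
  rewrite (@le_trans _ _ (\sum_(j < n) (2 * B ^+ 2)))//.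
    by apply: ler_sum => j _; rewrite mulr_natl mulr2n; apply: lerD; exact: sB (ix_it_neq j) || exact: sB (iy_it_neq j).
  rewrite sumr_const card_ord -[leLHS]mulr_natl; have : (n%:R : R) <= n%:R ^+ 2.
    by rewrite -natrX ler_nat; case: n => // N; rewrite expnS leq_pmulr// expn_gt0.
  by have := sqr_ge0 B; nra.
rewrite integral_cst; last exact: measurable_itv.
rewrite [X in (_ * X)%E](_ : _ = 2%:E).
  by rewrite -EFinM lee_fin; nra.
by rewrite [LHS]lebesgue_measure_itv/= lte_fin l1 -EFinB; congr EFin; ring.
Qed.

Lemma eq_omega p p' w w' : (forall l, l != it n -> p 0 l = p' 0 l) ->
  (forall l, l != it n -> w 0 l = w' 0 l) -> omega p w = omega p' w'.
Proof.
by move=> pp ww; apply: eq_bigr => j _; rewrite !pp ?ww ?ix_it_neq ?iy_it_neq.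
Qed.

Lemma omega_xy (j : 'I_n) : omega (delta_mx 0 (ix j) : heis R n) (delta_mx 0 (iy j)) = 1.
Proof.
rewrite /omega (bigD1 j)//= big1 => [|i ij]; rewrite !mxE/= ?eqxx ?ix_eq ?iy_eq ?ix_iy_eqF ?[iy _ == ix _]eq_sym ?ix_iy_eqF.
  by rewrite mulr1 mulr0 subr0 addr0.
by rewrite (negPf ij) !mulr0 subr0.
Qed.

(* The loop added to the segment is [(c (s - s^3), d (1 - 6 s^2 + 5 s^4))] on
   [-1, 1]: it is closed, has mean zero, and sweeps the area [-32/35 c d]. *)
Lemma dcc_bound p q (W : R) : (0 < n)%N ->
  (forall l, l != it n -> `|q 0 l - p 0 l| <= W) ->
  (dcc p q <= (4 * n%:R * (W + 34 * Num.sqrt `|gap p q|))%:E)%E.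
Proof.
move=> n0 HW; pose j0 := Ordinal n0; pose S := Num.sqrt `|gap p q|.
have [w wE] : exists w, w = q - p by eexists.
have S0 : 0 <= S by exact: sqrtr_ge0.
have SS : S ^+ 2 = `|gap p q| by rewrite sqr_sqrtr.
have W0 : 0 <= W by apply: le_trans (HW (ix j0) (ix_it_neq _)).
(* Lifting the loop changes the last coordinate by -4 times the area, that is, by [128/35 c d]. With
   [c = S] and [d] of absolute value [35/128 S], this is the gap, whose sign is given to [d]. *)
pose c := S; have [d dS cd] : exists2 d : R, `|d| <= S & 128 / 35 * (c * d) = gap p q.
  have S' : 0 <= 35 / 128 * S by rewrite mulr_ge0// divr_ge0.
  exists (Num.sg (gap p q) * (35 / 128 * S)).
    rewrite normrM (ger0_norm S') normr_sg; case: (_ != 0); rewrite ?mul0r// mul1r.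
    by move: S'; lra.
  by rewrite [RHS]numEsg -SS /c; field.
pose simp := (poly.derivE, derivXn, derivC, hornerE, hornerXn, hornerMn).
(* The loop is [(c a, d b)]. [A] and [B] are the antiderivatives of [a] and [b] vanishing at both
   ends, [K] is the antiderivative of a b' - b a' vanishing at -1, and [la] runs from 0 to 1 along
   the segment. *)
have [a aE a'E] : exists2 a : {poly R}, forall s, a.[s] = s - s ^+ 3 &
    forall s, a^`().[s] = 1 - 3 * s ^+ 2.
  by exists ('X - 'X^3) => s; rewrite !simp /=; field.
have [b bE b'E] : exists2 b : {poly R}, forall s, b.[s] = 1 - 6 * s ^+ 2 + 5 * s ^+ 4 &
    forall s, b^`().[s] = - 12 * s + 20 * s ^+ 3.
  by exists (1 - 6 *: 'X^2 + 5 *: 'X^4) => s; rewrite !simp /=; field.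
have [A AE A'E] : exists2 A : {poly R}, forall s, A.[s] = s ^+ 2 / 2 - s ^+ 4 / 4 - 1 / 4 &
    forall s, A^`().[s] = s - s ^+ 3.
  by exists ((1 / 2) *: 'X^2 - (1 / 4) *: 'X^4 - (1 / 4)%:P) => s; rewrite !simp /=; field.
have [B BE B'E] : exists2 B : {poly R}, forall s, B.[s] = s - 2 * s ^+ 3 + s ^+ 5 &
    forall s, B^`().[s] = 1 - 6 * s ^+ 2 + 5 * s ^+ 4.
  by exists ('X - 2 *: 'X^3 + 'X^5) => s; rewrite !simp /=; field.
have [K KE K'E] : exists2 K : {poly R}, forall s, K.[s] = - s - s ^+ 3 + 9 / 5 * s ^+ 5 - 5 / 7 * s ^+ 7 - 32 / 35 &
    forall s, K^`().[s] = - 1 - 3 * s ^+ 2 + 9 * s ^+ 4 - 5 * s ^+ 6.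
  by exists (- 'X - 'X^3 + (9 / 5) *: 'X^5 - (5 / 7) *: 'X^7 - (32 / 35)%:P) => s; rewrite !simp /=; field.
have [la laE la'E] : exists2 la : {poly R}, forall s, la.[s] = s / 2 + 1 / 2 &
    forall s, la^`().[s] = 1 / 2.
  by exists ((1 / 2) *: 'X + (1 / 2)%:P) => s; rewrite !simp /=; field.
pose ex : heis R n := delta_mx 0 (ix j0); pose ey : heis R n := delta_mx 0 (iy j0).
pose u := omega w ey; pose v := omega ex w.
pose L := (d * u) *: b - (c * v) *: a.
(* [T] is the horizontal lift in closed form, the antiderivative of [- 2 omega] of position and
   velocity. The segment and the loop interact through la L' - la' L, integrated by parts; as the
   loop has mean zero, this contributes nothing at the end. *)
pose T := (p 0 (it n))%:P - 2 *: (omega p w *: la + (c * omega p ex) *: a + (d * omega p ey) *: b)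
  - 2 *: (la * L - ((d * u) *: B - (c * v) *: A) + (c * d) *: K).
pose P l := if l == it n then T else
  (p 0 l)%:P + w 0 l *: la + (c * ex 0 l) *: a + (d * ey 0 l) *: b.
have Pt : P (it n) = T by rewrite /P eqxx.
have PN l : l != it n -> P l = (p 0 l)%:P + w 0 l *: la + (c * ex 0 l) *: a + (d * ey 0 l) *: b.
  by rewrite /P => /negPf ->.
pose evE := (aE, bE, AE, BE, KE, laE); pose evE' := (a'E, b'E, A'E, B'E, K'E, la'E).
have Pm : poly_curve P (-1) = p.
  apply/rowP => l; rewrite mxE; have [->|lt] := eqVneq l (it n).
    by rewrite Pt /T /L !hornerE !evE; field.
  by rewrite PN// !hornerE !evE; field.
have pw : omega p w = omega p q.
  by rewrite wE omegaDr -scaleN1r omegaZr omega_self; ring.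
have Pp : poly_curve P 1 = q.
  apply/rowP => l; rewrite mxE; have [->|lt] := eqVneq l (it n).
    rewrite Pt /T /L !hornerE !evE.
    transitivity (p 0 (it n) - 2 * omega p w + 128 / 35 * (c * d)); first by field.
    by rewrite cd /gap pw; ring.
  by rewrite PN// !hornerE !evE wE !mxE; field.
rewrite -{1}Pm -{1}Pp; apply: (le_trans (dcc_poly_curve (B := W + 34 * S) _ _ _)) => //.
- by rewrite addr_ge0 ?mulr_ge0.
- move=> s; rewrite contact_formE mxE Pt.
  have -> : omega (poly_curve P s) (poly_curve (fun l => (P l)^`()) s) =
      omega (p + la.[s] *: w + (c * a.[s]) *: ex + (d * b.[s]) *: ey)
        ((1 / 2) *: w + (c * a^`().[s]) *: ex + (d * b^`().[s]) *: ey).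
    apply: eq_omega => l lt; rewrite !mxE PN// !(poly.derivE, derivC, hornerE) ?la'E.
      by rewrite /ex /ey !mxE; ring.
    by rewrite /ex /ey !mxE; ring.
  rewrite !(omegaDl, omegaDr, omegaZl, omegaZr) !omega_self (omegaC ey ex) (omegaC ey w) (omegaC w ex) ?opprK.
  by rewrite omega_xy -/u -/v /T /L !(poly.derivE, derivC, hornerE) !(evE, evE') /=; field.
- move=> s l s1 lt; rewrite PN// !(poly.derivE, derivC, hornerE) !evE'.
  have := HW _ lt; have -> : q 0 l - p 0 l = w 0 l by rewrite wE !mxE.
  have mul3 (x y z X Y Z : R) : `|x| <= X -> `|y| <= Y -> `|z| <= Z -> `|x * y * z| <= X * Y * Z.
    by move=> xX yY zZ; rewrite !normrM ler_pM ?mulr_ge0// ler_pM.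
  have bool1 (x : bool) : `|(x%:R : R)| <= 1 by case: x; rewrite ?normr0 ?normr1.
  have := bool1 (l == iy j0); have := bool1 (l == ix j0).
  have s2 : `|s ^+ 2| <= 1 by rewrite normrX exprn_ile1.
  have s3 : `|s ^+ 3| <= 1 by rewrite normrX exprn_ile1.
  (* The bounds 2 and 32 for the two velocity components of the loop add up to the constant 34. *)
  have a2 : `|1 - 3 * s ^+ 2| <= 2.
    by move: s2 (sqr_ge0 s); rewrite !ler_norml => /andP[? ?] ?; apply/andP; split; lra.
  have b2 : `|- 12 * s + 20 * s ^+ 3| <= 32.
    by move: s1 s3; rewrite !ler_norml => /andP[? ?] /andP[? ?]; apply/andP; split; lra.
  rewrite /ex /ey !mxE/= => xb yb wb.
  have h1 : `|c * (l == ix j0)%:R * (1 - 3 * s ^+ 2)| <= S * 1 * 2.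
    by apply: mul3; rewrite // ger0_norm.
  have h2 : `|d * (l == iy j0)%:R * (- 12 * s + 20 * s ^+ 3)| <= S * 1 * 32.
    exact: mul3.
  rewrite ?add0r (le_trans (ler_normD _ _))// (le_trans (lerD (ler_normD _ _) (lexx _)))//.
  have h3 : `|w 0 l * (1 / 2)| <= W.
    by rewrite normrM (ger0_norm (_ : 0 <= 1 / 2))//; move: (normr_ge0 (w 0 l)) wb; lra.
  by move: h1 h2 h3; lra.
Qed.

End dcc_bound.

(** * Covering the image of a cell *)

Section hausdorff_null.
Context {R : realType} {T : Type}.
Variables (d : T -> T -> \bar R) (k : nat).
Hypothesis k0 : (0 < k)%N.

(** The sets carry upper bounds [r i] of their diameters, which are easier to sum than the
    diameters. No separate mesh condition is imposed: each [r i ^ k] is at most [e], so that a small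
    [e] forces a small mesh. *)
Definition fcover (e : R) (A : set T) := exists (I : finType) (C : I -> set T) (r : I -> R),
  [/\ A `<=` \bigcup_i C i,
      forall i, 0 <= r i /\ forall x y, C i x -> C i y -> (d x y <= (r i)%:E)%E
    & \sum_i r i ^+ k <= e].

Lemma fcover_sub e A B : A `<=` B -> fcover e B -> fcover e A.
Proof. by move=> AB [I [C [r [BC H S]]]]; exists I, C, r; split => //; exact: subset_trans BC. Qed.

Lemma fcover_le e e' A : e <= e' -> fcover e A -> fcover e' A.
Proof. by move=> ee [I [C [r [BC H S]]]]; exists I, C, r; split => //; exact: le_trans ee. Qed.

Lemma fcover_bigcup (J : finType) (e : J -> R) (A : J -> set T) :
  (forall j, fcover (e j) (A j)) -> fcover (\sum_j e j) (\bigcup_j A j).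
Proof.
move=> H.
have /choice[F HF] (j : J) : exists X : {I : finType & ((I -> set T) * (I -> R))%type},
  [/\ A j `<=` \bigcup_i (projT2 X).1 i,
      forall i, 0 <= (projT2 X).2 i /\ forall x y, (projT2 X).1 i x -> (projT2 X).1 i y -> (d x y <= ((projT2 X).2 i)%:E)%E
    & \sum_i (projT2 X).2 i ^+ k <= e j].
  by have [I [C [r HC]]] := H j; exists (existT _ I (C, r)).
exists {j : J & projT1 (F j)}, (fun x => (projT2 (F (tag x))).1 (tagged x)),
  (fun x => (projT2 (F (tag x))).2 (tagged x)); split.
- move=> x [j _ Ajx]; have [/(_ _ Ajx)[i _ Ci] _ _] := HF j.
  by exists (Tagged (fun j => projT1 (F j)) i).
- by move=> [j i] /=; have [_ + _] := HF j; apply.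
- rewrite -(@sig_big_dep _ _ _ _ _ xpredT (fun=> xpredT)
    (fun j i => (projT2 (F j)).2 i ^+ k)).
  by apply: ler_sum => j _; have [] := HF j.
Qed.

Lemma diameter_ge0 (A : set T) : (0 <= diameter d A)%E.
Proof. by apply: ereal_sup_ubound; left. Qed.

Lemma diameter_le (A : set T) (r : R) : 0 <= r ->
  (forall x y, A x -> A y -> (d x y <= r%:E)%E) -> (diameter d A <= r%:E)%E.
Proof.
move=> r0 H; apply: ge_ereal_sup => _ [->|[x [y [Ax Ay ->]]]]; first by rewrite lee_fin.
exact: H.
Qed.

Lemma hausdorff_weight_ge0 (A : set T) : (0 <= hausdorff_weight d k A)%E.
Proof. by rewrite /hausdorff_weight; case: ifP => // _; apply: expe_ge0; exact: diameter_ge0. Qed.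

Lemma hausdorff_weight_le (A : set T) (r : R) : 0 <= r ->
  (forall x y, A x -> A y -> (d x y <= r%:E)%E) -> (hausdorff_weight d k A <= (r ^+ k)%:E)%E.
Proof.
move=> r0 H; rewrite /hausdorff_weight; case: ifP => _; first by rewrite lee_fin exprn_ge0.
have := diameter_le r0 H; have := diameter_ge0 A; case: (diameter d A) => [s| |]//.
by rewrite !lee_fin => s0 sr; rewrite -EFin_expe lee_fin lerXn2r.
Qed.

Lemma fcover_seq e A : fcover e A -> exists C : nat -> set T,
  [/\ A `<=` \bigcup_i C i,
      forall i, exists2 r : R, 0 <= r & r ^+ k <= e /\ (diameter d (C i) <= r%:E)%E
    & (\sum_(i <oo) hausdorff_weight d k (C i) <= e%:E)%E].
Proof.
move=> [I [C [r [AC H S]]]].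
pose X (i : nat) : set T := if insub i is Some j then C (enum_val (j : 'I_#|I|)) else set0.
have e0 : 0 <= e by apply: le_trans S; apply: sumr_ge0 => i _; rewrite exprn_ge0// (H i).1.
have XE (i : 'I_#|I|) : X i = C (enum_val i) by rewrite /X valK.
have X0 i : (#|I| <= i)%N -> X i = set0 by move=> h; rewrite /X insubF// ltnNge h.
exists X; split.
- move=> x /AC[i _ Cix]; exists (enum_rank i) => //.
  by rewrite XE enum_rankK.
- move=> i; case: (ltnP i #|I|) => h.
    have [r0 Hr] := H (enum_val (Ordinal h)); exists (r (enum_val (Ordinal h))) => //; split.
      apply: le_trans S; rewrite (bigD1 (enum_val (Ordinal h)))//= lerDl.
      by apply: sumr_ge0 => l _; rewrite exprn_ge0// (H l).1.
    by rewrite (XE (Ordinal h)); exact: diameter_le.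
  exists 0 => //; rewrite X0// expr0n gtn_eqF//; split => //.
  by apply: diameter_le.
- apply: lime_le; first by apply: is_cvg_nneseries => i _ _; exact: hausdorff_weight_ge0.
  exists #|I| => // K /= IK; rewrite (big_cat_nat _ IK)//= [X in (_ + X)%E]big1_seq ?adde0; last first.
    move=> i /andP[_]; rewrite mem_index_iota => /andP[h _].
    by rewrite X0// /hausdorff_weight; case: asboolP.
  rewrite big_mkord; apply: (@le_trans _ _ (\sum_(i < #|I|) (r (enum_val i) ^+ k)%:E)%E).
    by apply: lee_sum => i _; rewrite XE; have [? ?] := H (enum_val i); exact: hausdorff_weight_le.
  rewrite sumEFin lee_fin; apply: le_trans S.
  rewrite le_eqVlt; apply/orP; left; apply/eqP.
  by rewrite -(big_enum_val (fun i => r i ^+ k)).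
Qed.

Lemma nneseries_prod (a : nat * nat -> \bar R) (f : nat -> nat * nat) :
  set_bij [set: nat] [set: nat * nat] f -> (forall x, (0 <= a x)%E) ->
  (\sum_(i <oo) a (f i) = \sum_(i <oo) \sum_(j <oo) a (i, j))%E.
Proof.
move=> bf a0; rewrite nneseries_esumT// -(reindex_esum _ _ _ a bf).
have -> : [set: nat * nat] = [set: nat] `*`` (fun=> [set: nat]) by apply/seteqP; split.
rewrite (eq_esum (b := fun x => (fun i j => a (i, j)) x.1 x.2)); last by move=> [].
rewrite -(@esum_esum _ _ _ _ _ (fun i j => a (i, j)))// nneseries_esumT => [|i].
  by apply: eq_esum => i _; rewrite nneseries_esumT.
by apply: nneseries_ge0.
Qed.

Lemma hausdorff_measure_bigcup (A : nat -> set T) :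
  (forall m (e : R), 0 < e -> fcover e (A m)) -> hausdorff_measure d k (\bigcup_m A m) = 0%E.
Proof.
move=> HA.
suff H (delta : R) : 0 < delta -> hausdorff_content d k delta (\bigcup_m A m) = 0%E.
  apply/eqP; rewrite eq_le; apply/andP; split.
    by apply: ge_ereal_sup => _ [delta /= d0 <-]; rewrite H.
  apply: ereal_sup_ubound; exists 1 => //=; exact: H.
move=> d0; apply/eqP; rewrite eq_le; apply/andP; split; last first.
  apply: le_ereal_inf_tmp => _ [C [_ _ ->]].
  by apply: nneseries_ge0 => i _ _; exact: hausdorff_weight_ge0.
apply/lee_addgt0Pr => e e0; rewrite add0e.
(* The first bound makes the total weight at most [e]; the second keeps each diameter below
   [delta]. *)
pose em m := Num.min (e / (2 ^ m.+1)%:R) (delta ^+ k).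
have em0 m : 0 < em m by rewrite lt_min divr_gt0 ?exprn_gt0// ltr0n expn_gt0.
have /choice[C HC] m := fcover_seq (HA m _ (em0 m)).
have /card_esym/ppcard_eqP[f] := card_nat2.
have bf : set_bij [set: nat] [set: nat * nat] f by rewrite setTT_bijective; exact: bijTT.
apply: (@le_trans _ _ (\sum_(i <oo) hausdorff_weight d k (C (f i).1 (f i).2))%E).
  apply: ereal_inf_lbound; exists (fun i => C (f i).1 (f i).2); split => //.
  - move=> x [m _ Amx]; have [/(_ _ Amx)[i _ Cx] _ _] := HC m.
    have [_ _ /(_ (m, i) I)[z _ fz]] := bf.
    by exists z => //; rewrite fz.
  - move=> i; have [_ /(_ (f i).2)[r r0 [rk dr]] _] := HC (f i).1.
    apply: (le_trans dr); rewrite lee_fin -(@ler_pXn2r _ k)// ?nnegrE ?(ltW d0)//.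
    by apply: (le_trans rk); rewrite /em ge_min lexx orbT.
rewrite (nneseries_prod (a := fun x => hausdorff_weight d k (C x.1 x.2)))//; last first.
  by move=> x; exact: hausdorff_weight_ge0.
apply: le_trans (epsilon_trick0 xpredT (ltW e0)).
apply: lee_nneseries => [m _ _|m _].
  by apply: nneseries_ge0 => i _ _; exact: hausdorff_weight_ge0.
have [_ _ h] := HC m; apply: (le_trans h); rewrite lee_fin /em ge_min lexx//.
Qed.

End hausdorff_null.

(** * A direction in which a nearly isotropic matrix is small *)

Section isotropic_direction.
Context {R : realType} {n k : nat}.
Implicit Types (A : 'M[R]_(k, n.*2.+1)) (u v w : 'rV[R]_k).

Lemma ord_heis (l : 'I_n.*2.+1) : l != it n -> exists j, l = ix j \/ l = iy j.
Proof.
move=> lt; have ln : (l < n.*2)%N.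
  by rewrite ltn_neqAle -ltnS ltn_ord andbT; apply: contra lt => /eqP lE; apply/eqP/val_inj.
have l2 : (l./2 < n)%N by rewrite ltn_half_double.
exists (Ordinal l2); case ol : (odd l); [right|left]; apply/val_inj => /=; rewrite inordK/=.
- by rewrite -[LHS]odd_double_half ol.
- by rewrite ltnS ltn_double.
- by rewrite -[LHS]odd_double_half ol.
- by rewrite ltnS leq_double ltnW.
Qed.

Lemma omega_mulmx u v A (D : R) : (forall b c, `|omega (row b A) (row c A)| <= D) ->
  (forall i, `|u 0 i| <= 1) -> (forall i, `|v 0 i| <= 1) ->
  `|omega (u *m A) (v *m A)| <= k%:R ^+ 2 * D.
Proof.
move=> HD u1 v1; rewrite !row_mulE omega_suml (le_trans (ler_norm_sum _ _ _))//.
rewrite (@le_trans _ _ (\sum_(i < k) \sum_(i < k) D))//; last first.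
  by rewrite !sumr_const !card_ord -mulrnA -[leLHS]mulr_natl natrM.
apply: ler_sum => b _; rewrite omega_sumr (le_trans (ler_norm_sum _ _ _))//.
apply: ler_sum => c _; rewrite omegaZl omegaZr !normrM -[leRHS]mul1r.
apply: ler_pM => //; rewrite ?mulr_ge0// -[leRHS]mul1r; exact: ler_pM.
Qed.

(* The [2 k > 2 n] unknowns (v, w) satisfy the [2 n] equations [v A = J (w A)]. *)
Lemma isotropic_pair A : (n < k)%N -> exists v w, (v, w) != 0 /\
  forall j, (v *m A) 0 (ix j) = - (w *m A) 0 (iy j) /\ (v *m A) 0 (iy j) = (w *m A) 0 (ix j).
Proof.
move=> nk; pose B : 'M[R]_(k + k, n + n) := block_mx
  (\matrix_(b, j) A b (ix j)) (\matrix_(b, j) A b (iy j))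
  (\matrix_(b, j) A b (iy j)) (\matrix_(b, j) (- A b (ix j))).
have kB : kermx B != 0.
  rewrite kermx_eq0; apply: contraL nk => /eqP rB; rewrite -leqNgt.
  by have := rank_leq_col B; rewrite rB !addnn leq_double.
pose u := nz_row (kermx B).
have u0 : u != 0 by rewrite nz_row_eq0.
have uB : u *m B = 0 by apply/sub_kermxP; exact: nz_row_sub.
exists (lsubmx u), (rsubmx u); split.
  apply: contra u0 => /eqP[l0 r0].
  by rewrite -(hsubmxK u) l0 r0 row_mx0.
move: uB; rewrite -{1}(hsubmxK u) /B mul_row_block -[0]row_mx0 => /eq_row_mx[/rowP E1 /rowP E2] j.
split.
  have := E1 j; rewrite !mxE => /eqP; rewrite addr_eq0 => /eqP; congr (_ = - _);
  by apply: eq_bigr => i _; rewrite [X in _ * X]mxE.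
have := E2 j; rewrite !mxE => /eqP; rewrite addr_eq0 => /eqP; under eq_bigr do rewrite [X in _ * X]mxE.
by move=> ->; rewrite -sumrN; apply: eq_bigr => i _; rewrite [X in _ * X]mxE mulrN opprK.
Qed.

(** For the pair of [isotropic_pair], [omega (w A) (v A)] is the sum of the squares of the
    horizontal coordinates of [v A], which agree up to order and sign with those of [w A]. After
    division by the largest coordinate of the pair, whichever of [v] and [w] contains that
    coordinate is the direction. *)
Lemma isotropic_direction A (D : R) : (n < k)%N ->
  (forall b c, `|omega (row b A) (row c A)| <= D) ->
  exists v i0, [/\ v 0 i0 = 1, forall i, `|v 0 i| <= 1 &
    forall l, l != it n -> `|(v *m A) 0 l| <= k%:R * Num.sqrt D].
Proof.
move=> nk HD.
have D0 : 0 <= D.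
  by case: k nk A HD => // k' _ A HD; apply: le_trans (HD ord0 ord0).
have [v [w [vw0 E]]] := isotropic_pair A nk.
pose z (x : 'I_k + 'I_k) := match x with inl i => v 0 i | inr i => w 0 i end.
have [x0 zx0] : exists x, z x != 0.
  apply/existsP; apply: contraNT vw0; rewrite negb_exists => /forallP z0.
  rewrite -[(0 : _ * _)]/(0, 0) xpair_eqE; apply/andP; split; apply/eqP/rowP => i; rewrite mxE; apply/eqP.
    by have := z0 (inl i); rewrite negbK.
  by have := z0 (inr i); rewrite negbK.
have [x _ xmax] : exists2 x, true & forall y, `|z y| <= `|z x|.
  by case: (@arg_maxP _ _ _ x0 xpredT (fun x => `|z x|)) => // x _ H; exists x => // y; exact: H.
have zx : z x != 0 by rewrite -normr_gt0 (lt_le_trans _ (xmax x0))// normr_gt0.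
pose v' := (z x)^-1 *: v; pose w' := (z x)^-1 *: w.
have z1 y : `|(z x)^-1 * z y| <= 1.
  by rewrite normrM normfV mulrC ler_pdivrMr ?normr_gt0// mul1r.
have v1 i : `|v' 0 i| <= 1 by rewrite mxE; exact: (z1 (inl i)).
have w1 i : `|w' 0 i| <= 1 by rewrite mxE; exact: (z1 (inr i)).
have E' j : (v' *m A) 0 (ix j) = - (w' *m A) 0 (iy j) /\ (v' *m A) 0 (iy j) = (w' *m A) 0 (ix j).
  by rewrite -!scalemxAl !mxE; have := E j; rewrite !mxE => -[-> ->]; rewrite mulrN.
have O : \sum_(j < n) ((v' *m A) 0 (ix j) ^+ 2 + (v' *m A) 0 (iy j) ^+ 2) <= k%:R ^+ 2 * D.
  rewrite (le_trans _ (omega_mulmx HD w1 v1))// (le_trans _ (ler_norm _))//.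
  by rewrite le_eqVlt; apply/orP; left; apply/eqP/eq_bigr => j _; have [-> ->] := E' j; ring.
have bound (a : R) : a ^+ 2 <= k%:R ^+ 2 * D -> `|a| <= k%:R * Num.sqrt D.
  move=> h; rewrite -sqrtr_sqr (le_trans (ler_wsqrtr h))// sqrtrM ?sqr_ge0//.
  by rewrite sqrtr_sqr ger0_norm.
have Oj j : (v' *m A) 0 (ix j) ^+ 2 + (v' *m A) 0 (iy j) ^+ 2 <= k%:R ^+ 2 * D.
  apply: le_trans O; rewrite (bigD1 j)//= lerDl; apply: sumr_ge0 => i _.
  by rewrite addr_ge0 ?sqr_ge0.
have Vb l : l != it n -> `|(v' *m A) 0 l| <= k%:R * Num.sqrt D.
  move=> /ord_heis[j [|] ->]; apply: bound; apply: le_trans (Oj j).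
    by rewrite lerDl sqr_ge0.
  by rewrite lerDr sqr_ge0.
have Wb l : l != it n -> `|(w' *m A) 0 l| <= k%:R * Num.sqrt D.
  move=> /ord_heis[j [|] ->]; apply: bound; apply: le_trans (Oj j); have [-> ->] := E' j.
    by rewrite lerDr sqr_ge0.
  by rewrite sqrrN lerDl sqr_ge0.
case: x zx z1 @v' @w' v1 w1 Vb Wb {xmax E' O Oj} => i zx z1 v' w' v1 w1 Vb Wb.
  by exists v', i; split => //; rewrite mxE mulVf.
by exists w', i; split => //; rewrite mxE mulVf.
Qed.

End isotropic_direction.

Lemma exprD_le (R : realFieldType) (x y : R) k : 0 <= x -> 0 <= y ->
  (x + y) ^+ k <= 2 ^+ k * (x ^+ k + y ^+ k).
Proof.
move=> x0 y0; have [xy|xy] := leP x y.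
- rewrite (@le_trans _ _ ((2 * y) ^+ k))//.
    by rewrite lerXn2r ?nnegrE ?addr_ge0 ?mulr_ge0// mulr_natl mulr2n lerD2r.
  by rewrite exprMn ler_wpM2l ?exprn_ge0// lerDr exprn_ge0.
- rewrite (@le_trans _ _ ((2 * x) ^+ k))//.
    by rewrite lerXn2r ?nnegrE ?addr_ge0 ?mulr_ge0// mulr_natl mulr2n lerD2l ltW.
  by rewrite exprMn ler_wpM2l ?exprn_ge0// lerDl exprn_ge0.
Qed.

Lemma floor_eq_dist (R : archiRealFieldType) (x y : R) : Num.floor x = Num.floor y -> `|x - y| <= 1.
Proof.
move=> E; have /andP[] : (Num.floor x)%:~R <= x < (Num.floor x + 1)%:~R by rewrite -floor_eq.
have /andP[] : (Num.floor y)%:~R <= y < (Num.floor y + 1)%:~R by rewrite -floor_eq.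
by rewrite E !intrD ler_norml => *; apply/andP; split; lra.
Qed.

Lemma slab_radius_le (R : realFieldType) (C M r Z K S s b : R) :
  0 <= C -> 0 <= r -> 0 <= K -> M <= Z -> b <= Z -> S <= 2 * (1 + C) * Z -> s <= r * S ->
  C * M * r + K * (r * b) + r * (K * S) + 34 * s <=
    r * Z * (C + K + 2 * K * (1 + C) + 68 * (1 + C)).
Proof.
move=> C0 r0 K0 MZ bZ SZ sS.
have rM : r * M <= r * Z by exact: ler_wpM2l.
have rb : r * b <= r * Z by exact: ler_wpM2l.
have rS : r * S <= r * (2 * (1 + C) * Z) by exact: ler_wpM2l.
have e1 : C * (r * M) <= C * (r * Z) by exact: ler_wpM2l.
have e2 : K * (r * b) <= K * (r * Z) by exact: ler_wpM2l.
have e3 : K * (r * S) <= K * (r * (2 * (1 + C) * Z)) by exact: ler_wpM2l.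
lra.
Qed.

Section cell_cover.
Context {R : realType} {n k' : nat}.
Notation k := k'.+1.
Notation lam := (lebesgue_rV R k).
Implicit Types (x y : 'rV[R]_k) (j : 'rV[int]_k) (m N : nat).

(* The fibres of [g] cut the cell into slabs parallel to [v]. *)
Lemma slab_index m j (v : 'rV[R]_k) (i0 : 'I_k) N : (0 < N)%N ->
  v 0 i0 = 1 -> (forall i, `|v 0 i| <= 1) ->
  exists g : 'rV[R]_k -> {ffun 'I_k' -> 'I_(3 * N).-1.+1},
    forall x y, cell m j x -> cell m j y -> g x = g y ->
    exists t : R, `|t| <= 2 ^- m /\ forall i, `|(y - x) 0 i - t * v 0 i| <= 2 ^- m / N%:R.
Proof.
move=> N0 vi0 v1; have p2 : 0 < (2 : R) ^+ m by exact: exprn_gt0.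
have N0' : 0 < N%:R :> R by rewrite ltr0n.
pose c i : R := (j 0 i)%:~R / 2 ^+ m.
(* Coordinates relative to the corner of the cell, projected along [v] onto the hyperplane where
   coordinate [i0] vanishes, in units of [2 ^- m / N]. They lie between [- N] and [2 N], so their
   floors take at most [3 N] values, and [k - 1] of them suffice as coordinate [i0] is 0. *)
pose x' (x : 'rV[R]_k) i := N%:R * 2 ^+ m * (x 0 i - c i - (x 0 i0 - c i0) * v 0 i).
pose h x i := absz (Num.floor (x' x i) + N%:Z).
have hb x i : cell m j x -> - N%:R <= x' x i < 2 * N%:R.
  move=> /cellP jx; have /andP[a1 a2] := jx i; have /andP[b1 b2] := jx i0.
  have A1 : 0 <= x 0 i - c i by rewrite subr_ge0.
  have A2 : x 0 i - c i < 2 ^- m by rewrite ltrBlDl -[2 ^- m]mul1r -mulrDl.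
  have B1 : 0 <= x 0 i0 - c i0 by rewrite subr_ge0.
  have B2 : x 0 i0 - c i0 < 2 ^- m by rewrite ltrBlDl -[2 ^- m]mul1r -mulrDl.
  have B : `|(x 0 i0 - c i0) * v 0 i| <= 2 ^- m.
    rewrite normrM (ger0_norm B1) -[leRHS]mulr1; apply: ler_pM => //; exact: ltW.
  move: B; rewrite ler_norml => /andP[C1 C2].
  have q2 : 0 < (2 : R) ^- m by rewrite invr_gt0.
  have E : N%:R = N%:R * 2 ^+ m * 2 ^- m :> R by rewrite -mulrA divff ?mulr1// gt_eqF.
  have NP : 0 < N%:R * 2 ^+ m :> R by exact: mulr_gt0.
  have -> : - N%:R = N%:R * 2 ^+ m * (- 2 ^- m) :> R by rewrite mulrN -E.
  have -> : 2 * N%:R = N%:R * 2 ^+ m * (2 * 2 ^- m) :> R by rewrite mulrCA -E.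
  rewrite /x' ler_pM2l// ltr_pM2l//; apply/andP; split; lra.
have hf x i : cell m j x -> (h x i <= (3 * N).-1)%N /\ (h x i)%:Z = Num.floor (x' x i) + N%:Z.
  move=> jx; have /andP[b1 b2] := hb x i jx.
  have f1 : (- N%:Z <= Num.floor (x' x i))%R by rewrite floor_ge_int mulrNz.
  have f2 : (Num.floor (x' x i) < 2 * N%:Z)%R by rewrite floor_lt_int intrM.
  rewrite /h; split; last by rewrite gez0_abs//; lia.
  lia.
exists (fun x => [ffun i => inord (h x (lift i0 i))]) => x y jx jy gxy.
exists (y 0 i0 - x 0 i0); split; first exact: cell_dist jy jx.
move=> i; rewrite !mxE; case: (unliftP i0 i) => [i' ->|->]; last first.
  by rewrite vi0 mulr1 subrr normr0 divr_ge0 ?invr_ge0 ?ltW.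
have /(congr1 val) : inord (h x (lift i0 i')) = inord (h y (lift i0 i')) :> 'I_(3 * N).-1.+1.
  by have /ffunP/(_ i') := gxy; rewrite !ffunE.
have [hx1 hx2] := hf x (lift i0 i') jx; have [hy1 hy2] := hf y (lift i0 i') jy.
rewrite /= !inordK ?ltnS// => hxy.
have : Num.floor (x' y (lift i0 i')) = Num.floor (x' x (lift i0 i')).
  by apply: (@addIr _ N%:Z); rewrite -hx2 -hy2 hxy.
move=> /floor_eq_dist; rewrite /x' -mulrBr normrM (ger0_norm (ltW (mulr_gt0 N0' p2))).
rewrite -ler_pdivlMl ?mulr_gt0// mulr1 invfM mulrC; congr (`|_| <= _); ring.
Qed.

Lemma cell_cover (q : R) : (0 < n)%N -> (n < k)%N -> k%:R < q ->
  exists2 K : R, 0 <= K &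
  forall (f : 'rV[R]_k -> heis R n) (Df : 'rV[R]_k -> 'M[R]_(k, n.*2.+1)) m j (A : 'M[R]_(k, n.*2.+1)) (a M : R) N,
    (forall l x, cell m j x -> {for x, continuous (fun y : 'rV[R]_k => f y 0 l)}) ->
    (forall i l, wk (cell m j) i (fun x => f x 0 l) (fun x => Df x i l)) ->
    {ae lam, forall x, cell m j x -> forall i, contact_form (f x) (row i (Df x)) = 0} ->
    (forall i l, `|A i l| <= a) -> 0 < M ->
    (forall i l, lam.-integrable (cell m j) (EFin \o (fun x => `|Df x i l - A i l| `^ q)) /\
      \int[lam]_(x in cell m j) (`|Df x i l - A i l| `^ q) <= M `^ q * vol (R := R) (k := k) m) ->
    (0 < N)%N ->
  fcover dcc k (K * (vol (R := R) (k := k) m * (a ^+ k / N%:R + N%:R ^+ (k' + k) * M ^+ k))) (f @` cell m j).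
Proof.
move=> n0 nk kq; have [C C0 HC] := @cell_estimate R n k q (ltn0Sn _) kq.
pose K1 : R := 4 * n%:R * (C + k%:R + 2 * k%:R * (1 + C) + 68 * (1 + C)).
have K10 : 0 <= K1 by rewrite !mulr_ge0 ?addr_ge0 ?mulr_ge0 ?addr_ge0.
exists (3 ^+ k' * K1 ^+ k * 2 ^+ k); first by rewrite !mulr_ge0 ?exprn_ge0.
move=> f Df m j A a M N cf wf contact Aa M0 HM N0.
have [Hom Hf] := HC f Df m j A a M cf wf contact Aa M0 HM.
have a0 : 0 <= a by apply: le_trans (Aa ord0 ord0).
have N0' : 0 < N%:R :> R by rewrite ltr0n.
have Nw : 0 <= N%:R :> R by [].
have Mw : 0 <= M by exact: ltW.
have N1' : 1 <= N%:R :> R by rewrite ler1n.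
have [v [i0 [vi0 v1 vA]]] := isotropic_direction nk Hom.
have [g Hg] := @slab_index m j v i0 N N0 vi0 v1.
pose r : R := 2 ^- m; have r0 : 0 < r by rewrite invr_gt0 exprn_gt0.
have rw : 0 <= r by exact: ltW.
pose S := Num.sqrt (C * (M * (a + M))).
pose Z := a / N%:R + N%:R * M.
have Z0 : 0 <= Z by rewrite addr_ge0 ?divr_ge0 ?mulr_ge0.
have aZ : a / N%:R <= Z by rewrite lerDl mulr_ge0.
have MNM : M <= N%:R * M by rewrite ler_pMl.
have MZ : M <= Z by rewrite (le_trans MNM)// lerDr divr_ge0.
have SZ : S <= 2 * (1 + C) * Z.
  have Z1 : 0 <= 2 * (1 + C) * Z by rewrite mulr_ge0// mulr_ge0// addr_ge0.
  rewrite -[leRHS](ger0_norm Z1) -sqrtr_sqr ler_wsqrtr//.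
  (* [M (a + M)] is the product of [X] and [Y], so its square root is at most [X + Y], which is
     comparable to [Z]. *)
  pose X := (a + M) / N%:R; pose Y := N%:R * M.
  have X0 : 0 <= X by rewrite divr_ge0 ?addr_ge0.
  have Y0 : 0 <= Y by rewrite mulr_ge0.
  have -> : M * (a + M) = X * Y by rewrite /X /Y; field; rewrite gt_eqF.
  have MN : M / N%:R <= N%:R * M by rewrite (le_trans _ MNM)// ler_piMr ?(ltW M0)// invf_le1.
  have XYZ : X + Y <= 2 * Z by rewrite /X /Y /Z mulrDl; move: MN aZ (divr_ge0 a0 (ltW N0')); lra.
  have XY : X * Y <= (2 * Z) ^+ 2.
    apply: (@le_trans _ _ ((X + Y) ^+ 2)); last exact: lerXn2r (addr_ge0 X0 Y0) (mulr_ge0 (ler0n _ 2) Z0) XYZ.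
    by nra.
  have -> : (2 * (1 + C) * Z) ^+ 2 = (1 + C) ^+ 2 * (2 * Z) ^+ 2 by ring.
  by apply: ler_pM => //; [rewrite mulr_ge0|nra].
have S0 : 0 <= S by exact: sqrtr_ge0.
exists _, (fun i => f @` [set x | cell m j x /\ g x = i]), (fun=> r * Z * K1); split.
- by move=> _ [x jx <-]; exists (g x) => //; exists x.
- move=> i; split; first exact: mulr_ge0 (mulr_ge0 rw Z0) K10.
  move=> _ _ [x [jx gx] <-] [y [jy gy] <-].
  have [t [tr Ht]] := Hg x y jx jy (etrans gx (esym gy)).
  have [F1 F2] := Hf x y jx jy.
  have W l : l != it n -> `|f y 0 l - f x 0 l| <= C * M * r + k%:R * (a * (r / N%:R)) + r * (k%:R * S).
    (* Three contributions: the deviation of [f] from affine, the thickness of the slab transported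
       by [A], and the long displacement along [v], where [A] is nearly zero. *)
    move=> lt; have -> : f y 0 l - f x 0 l = (f y - f x - (y - x) *m A) 0 l +
       ((y - x - t *: v) *m A) 0 l + t * (v *m A) 0 l.
      rewrite (mulmxBl (y - x)) -scalemxAl; move: ((y - x) *m A) (v *m A) => B V.
      by rewrite !mxE; ring.
    rewrite (le_trans (ler_normD _ _))// lerD//; last by rewrite normrM ler_pM// vA.
    rewrite (le_trans (ler_normD _ _))// lerD//.
    rewrite mxE (le_trans (ler_norm_sum _ _ _))//.
    rewrite (@le_trans _ _ (\sum_(i < k) (a * (r / N%:R))))//; last first.
      by rewrite sumr_const card_ord mulr_natl.
    apply: ler_sum => b _; rewrite normrM mulrC; apply: ler_pM => //.
    by have := Ht b; rewrite !mxE.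
  apply: (le_trans (dcc_bound n0 W)); rewrite lee_fin.
  have sg : Num.sqrt `|gap (f x) (f y)| <= r * S.
    rewrite (le_trans (ler_wsqrtr F2))// mulrC -/r sqrtrM ?sqr_ge0// sqrtr_sqr.
    by rewrite ger0_norm ?(ltW r0).
  have -> : r * Z * K1 = 4 * n%:R * (r * Z * (C + k%:R + 2 * k%:R * (1 + C) + 68 * (1 + C))) by rewrite /K1; ring.
  apply: ler_wpM2l; first by rewrite mulr_ge0.
  by rewrite [a * _]mulrCA; exact: slab_radius_le.
- rewrite sumr_const card_ffun !card_ord prednK ?muln_gt0// -[leLHS]mulr_natl natrX natrM.
  rewrite [(r * Z * K1) ^+ k]exprMn [(r * Z) ^+ k]exprMn exprMn.
  have Zk := exprD_le k (divr_ge0 a0 (ltW N0')) (mulr_ge0 (ltW N0') (ltW M0)).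
  apply: (@le_trans _ _ (3 ^+ k' * N%:R ^+ k' * (r ^+ k * (2 ^+ k * ((a / N%:R) ^+ k + (N%:R * M) ^+ k)) * K1 ^+ k))).
    apply: ler_wpM2l; first by rewrite mulr_ge0 ?exprn_ge0.
    by apply: ler_wpM2r; [exact: exprn_ge0|apply: ler_wpM2l => //; exact: exprn_ge0].
  rewrite le_eqVlt; apply/orP; left; apply/eqP.
  have -> : vol (R := R) (k := k) m = r ^+ k by [].
  have -> : a ^+ k / N%:R = N%:R ^+ k' * (a / N%:R) ^+ k.
    by rewrite expr_div_n [N%:R ^+ k]exprS; field; rewrite expf_neq0 gt_eqF.
  rewrite exprD [(N%:R * M) ^+ k]exprMn.
  move: (N%:R ^+ k) (N%:R ^+ k') (M ^+ k) (K1 ^+ k) (r ^+ k) ((a / N%:R) ^+ k) (2 ^+ k) (3 ^+ k') => *.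
  ring.
Qed.

End cell_cover.

(** * Summing over the cells *)

Section children.
Context {R : realType} {k : nat}.
Notation lam := (lebesgue_rV R k).
Implicit Types (x y : 'rV[R]_k) (j : 'rV[int]_k) (m l : nat).

(** The digits range over [2 ^ l] values; the successor form of the bound makes [inord]
    available. *)
Definition child j l (b : {ffun 'I_k -> 'I_((2 ^ l).-1.+1)}) : 'rV[int]_k :=
  \row_i (2 ^+ l * j 0 i + (b i : nat)%:Z).

Lemma child_inj j l : injective (@child j l).
Proof.
move=> b c /rowP bc; apply/ffunP => i; apply/val_inj.
by have := bc i; rewrite !mxE => /addrI [].
Qed.

Lemma child_sub m l j b : (cell (m + l) (@child j l b) : set 'rV[R]_k) `<=` cell m j.
Proof.
move=> x xb; rewrite /cell/=; apply/rowP => i; rewrite mxE; apply/eqP; rewrite floor_eq.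
have := congr1 (fun v : 'rV[int]_k => v 0 i) xb; rewrite !mxE => /eqP.
have p2 : 0 < (2 : R) ^+ l by exact: exprn_gt0.
have bl : ((b i : nat)%:R + 1 <= (2 : R) ^+ l).
  rewrite -[1 in X in X <= _]/(1%:R) -natrD -natrX ler_nat addn1.
  by apply: (leq_trans (ltn_ord _)); rewrite prednK ?expn_gt0.
rewrite floor_eq exprD [2 ^+ m * _]mulrC -mulrA !intrD intrM => /andP[h1 h2].
have E : ((2 : int) ^+ l)%:~R = (2 : R) ^+ l by rewrite rmorphXn.
rewrite E in h1 h2; set t := 2 ^+ m * x 0 i in h1 h2 *.
have b0 : 0 <= (b i : nat)%:R :> R by [].
rewrite -(ler_pM2l p2) -(ltr_pM2l p2) mulrDr mulr1; apply/andP; split.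
  by apply: le_trans h1; rewrite lerDl.
by apply: (lt_le_trans h2); rewrite -addrA lerD2l.
Qed.

Lemma cell_child m l j x : cell m j x -> exists b, cell (m + l) (@child j l b) x.
Proof.
move=> jx; have p2 : 0 < (2 : R) ^+ l by exact: exprn_gt0.
pose q i := Num.floor (2 ^+ (m + l) * x 0 i).
have E : ((2 : int) ^+ l)%:~R = (2 : R) ^+ l by rewrite rmorphXn.
have hq i : (2 ^+ l * j 0 i <= q i)%R /\ (q i < 2 ^+ l * j 0 i + 2 ^+ l)%R.
  have := congr1 (fun v : 'rV[int]_k => v 0 i) jx; rewrite !mxE => /eqP.
  rewrite floor_eq intrD => /andP[h1 h2]; rewrite /q exprD [2 ^+ m * _]mulrC -mulrA; split.
    by rewrite floor_ge_int intrM E ler_pM2l.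
  rewrite floor_lt_int intrD intrM E; apply: (lt_le_trans (y := 2 ^+ l * ((j 0 i)%:~R + 1))).
    by rewrite ltr_pM2l.
  by rewrite mulrDr mulr1.
exists [ffun i : 'I_k => inord (absz (q i - 2 ^+ l * j 0 i)%R)]; rewrite /cell/=.
apply/rowP => i; rewrite !mxE ffunE; have [h1 h2] := hq i.
have H : (absz (q i - 2 ^+ l * j 0 i)%R < (2 ^ l).-1.+1)%N.
  rewrite prednK ?expn_gt0// -ltz_nat gez0_abs ?subr_ge0//.
  by rewrite ltrBlDl (_ : ((2 ^ l)%N : int) = 2 ^+ l)// -natz natrX.
by rewrite inordK// gez0_abs ?subr_ge0// addrC subrK.
Qed.

Lemma Rintegral_children m l j (g : 'rV[R]_k -> R) :
  lam.-integrable (cell m j) (EFin \o g) -> (forall x, 0 <= g x) ->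
  \sum_b \int[lam]_(x in cell (m + l) (@child j l b)) g x <= \int[lam]_(x in cell m j) g x.
Proof.
move=> ig g0; have mc b := @measurable_cell R k (m + l) (@child j l b).
have ib b : lam.-integrable (cell (m + l) (@child j l b)) (EFin \o g).
  by apply: integrableS ig => //; [exact: measurable_cell|exact: child_sub].
have mU : measurable (\big[setU/set0]_(b <- index_enum _) cell (m + l) (@child j l b) : set 'rV[R]_k).
  by apply: bigsetU_measurable => b _.
have sub : \big[setU/set0]_(b <- index_enum _) (cell (m + l) (@child j l b) : set 'rV[R]_k) `<=` cell m j.
  by elim/big_ind: _ => // [A B hA hB x [/hA|/hB]|b _] //; exact: child_sub.
have mg : measurable_fun (cell m j) (EFin \o g) by have /integrableP[] := ig.
rewrite -lee_fin -sumEFin.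
rewrite (eq_bigr (fun b => \int[lam]_(x in cell (m + l) (@child j l b)) (g x)%:E)%E) => [|b _]; last first.
  by rewrite fineK// integrable_fin_num.
rewrite -(ge0_integral_bigsetU _ mc) ?index_enum_uniq//.
- rewrite /Rintegral fineK; last by apply: integrable_fin_num => //; exact: measurable_cell.
  by apply: ge0_subset_integral => //; [exact: measurable_cell|move=> x _; rewrite lee_fin].
- move=> b c _ _ [x [xb xc]]; apply: (@child_inj j l).
  by move: xb xc; rewrite /cell/= => -> ->.
- by apply: measurable_funS sub mg; exact: measurable_cell.
- by move=> x _; rewrite lee_fin.
Qed.

Lemma sum_vol_children m l : \sum_(b : {ffun 'I_k -> 'I_((2 ^ l).-1.+1)}) vol (R := R) (k := k) (m + l) = vol (R := R) (k := k) m.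
Proof.
rewrite sumr_const card_ffun !card_ord prednK ?expn_gt0// /vol -[LHS]mulr_natl natrX natrX -exprMn.
congr (_ ^+ _); rewrite exprD invfM mulrCA divff ?mulr1//.
Qed.

(** An open set is the union of the dyadic cells that it contains, and there are only countably many
    cells. *)
Lemma open_measurable_rV (U : set 'rV[R]_k) : open U -> measurable U.
Proof.
move=> oU; have -> : U = \bigcup_(p : nat * 'rV[int]_k) (if `[< cell p.1 p.2 `<=` U >] then cell p.1 p.2 else set0).
  apply/seteqP; split => [x Ux|x [p _]]; last by case: asboolP => // pU /pU.
  have [m0 /(_ _ (leqnn _)) h] := nbhs_cell (open_nbhs_nbhs (conj oU Ux)).
  by exists (m0, cellof m0 x) => //=; case: asboolP.
apply: countable_bigcupT_measurable => // p; case: asboolP => // _; exact: measurable_cell.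
Qed.

End children.

Section real_inequalities.
Context {R : realType}.

Lemma powR_sum_le (I : finType) (t : I -> R) (q : R) : 0 < q -> (forall i, 0 <= t i) ->
  (\sum_i t i) `^ q <= #|I|%:R `^ q * \sum_i t i `^ q.
Proof.
move=> q0 t0; case: (pickP (@predT I)) => [i0 _|I0]; last first.
  by rewrite !big_pred0// mulr0 powR0 ?gt_eqF.
have [i _ imax] : exists2 i, true & forall j, t j <= t i.
  by case: (@arg_maxP _ _ _ i0 xpredT t) => // i _ H; exists i => // j; exact: H.
apply: (@le_trans _ _ ((#|I|%:R * t i) `^ q)).
  rewrite ge0_ler_powR ?nnegrE ?sumr_ge0 ?mulr_ge0 ?(ltW q0)//.
  by rewrite -sum1_card natr_sum mulr_suml; apply: ler_sum => j _; rewrite mul1r.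
rewrite powRM// ler_wpM2l ?powR_ge0// (bigD1 i)//= lerDl.
by apply: sumr_ge0 => j _; exact: powR_ge0.
Qed.

Lemma exprn_le1DpowR (a q : R) (k : nat) : 0 <= a -> k%:R <= q -> a ^+ k <= 1 + a `^ q.
Proof.
move=> a0 kq; have [a1|a1] := leP a 1.
  by rewrite (le_trans (exprn_ile1 _ a0 a1))// lerDl powR_ge0.
rewrite -powR_mulrn// (le_trans (ler_powR (ltW a1) kq))//.
by rewrite lerDr.
Qed.

(** Below [mu] the power is at most [lambda]; above it, [M ^ (k - q)] is at most [mu ^ (k - q)]
    since [k < q]. Smallness of a sum of [M ^ q] thus becomes smallness of a sum of [M ^ k]. *)
Lemma exprn_le_powR (q lambda : R) (k : nat) : (0 < k)%N -> k%:R < q -> 0 < lambda ->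
  exists2 C : R, 0 <= C & forall M, 0 <= M -> M ^+ k <= lambda + C * M `^ q.
Proof.
move=> k0 kq l0; pose mu := Num.min 1 lambda.
have mu0 : 0 < mu by rewrite lt_min ltr01.
exists (mu `^ (k%:R - q)); first exact: powR_ge0.
move=> M M0; have [Mmu|muM] := leP M mu.
  apply: (@le_trans _ _ lambda); last by rewrite lerDl mulr_ge0// powR_ge0.
  apply: (@le_trans _ _ (mu ^+ k)); first by rewrite lerXn2r ?nnegrE ?(ltW mu0).
  apply: (@le_trans _ _ mu); last by rewrite /mu ge_min lexx orbT.
  rewrite -[leRHS]expr1; apply: ler_wiXn2l => //; first exact: ltW.
  by rewrite /mu ge_min lexx.
have Mp : 0 < M by exact: lt_trans muM.
apply: (@le_trans _ _ (mu `^ (k%:R - q) * M `^ q)); last by rewrite lerDr ltW.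
have -> : M ^+ k = M `^ (k%:R - q) * M `^ q.
  by rewrite -powRD ?subrK ?powR_mulrn// (gt_eqF Mp) implybT.
rewrite ler_wpM2r ?powR_ge0// -[k%:R - q]opprK !(powRN _ (- (_ - _))) opprB.
by rewrite lef_pV2 ?posrE ?powR_gt0// ge0_ler_powR ?nnegrE ?subr_ge0 ?(ltW kq) ?(ltW mu0) ?(ltW muM).
Qed.

Lemma exists_mul_le (P e : R) : 0 <= P -> 0 < e -> exists2 x, 0 < x & P * x <= e.
Proof.
move=> P0 e0; have P1 : 0 < P + 1 by rewrite ltr_wpDl.
exists (e / (P + 1)); first exact: divr_gt0.
by rewrite mulrA ler_pdivrMr// [leRHS]mulrC ler_wpM2r ?(ltW e0)// lerDl.
Qed.

End real_inequalities.

Section null_cell.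
Context {R : realType} {n k' : nat}.
Notation k := k'.+1.
Notation lam := (lebesgue_rV R k).
Implicit Types (x y : 'rV[R]_k) (j : 'rV[int]_k) (m N : nat).

(** The sum of the individual levels is a common refinement, to which the step functions are
    transported by iterated parents. *)
Lemma common_level (I : finType) (m0 : nat) (D : set 'rV[R]_k) (q : R) (g : I -> 'rV[R]_k -> R) :
  measurable D -> (lam D < +oo)%E -> 1 <= q ->
  (forall i, measurable_fun D (g i)) -> (forall i, (Lq D q (g i) < +oo)%E) ->
  forall e : R, 0 < e -> exists L (tau : I -> 'rV[int]_k -> R), forall i,
    measurable_fun D (fun x => tau i (cellof (m0 + L) x)) /\
    (Lq D q (fun x => (g i x - tau i (cellof (m0 + L) x))%R) <= e%:E)%E.
Proof.
move=> mD Dfin q1 mg Lg e e0.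
have /choice[F HF] i : exists X : nat * ('rV[int]_k -> R), (Lq D q (fun x => (g i x - X.2 (cellof X.1 x))%R) <= e%:E)%E.
  have [_ /(_ _ e0)[m [tau H]]] := cell_approx_Lq mD Dfin q1 (mg i) (Lg i).
  by exists (m, tau).
pose L := (\sum_i (F i).1)%N.
exists L, (fun i j => (F i).2 (iter (m0 + L - (F i).1) parent j)) => i.
have E : (fun x : 'rV[R]_k => (F i).2 (iter (m0 + L - (F i).1) parent (cellof (m0 + L) x))) =
   (fun x => (F i).2 (cellof (F i).1 x)).
  apply/funext => x; congr ((F i).2 _).
  rewrite (cellof_iter (F i).1 (m0 + L - (F i).1)) subnKC//.
  by rewrite (leq_trans _ (leq_addl _ _))// /L (bigD1 i)//= leq_addr.
split.
  apply: measurable_funTS.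
  exact: (measurable_dyadic (m0 + L) (fun j => (F i).2 (iter (m0 + L - (F i).1) parent j))).
by have := congr1 (fun h => (Lq D q (fun x => (g i x - h x)%R) <= e%:E)%E) E; move=> ->; exact: HF.
Qed.

Theorem null_cell (q : R) (f : 'rV[R]_k -> heis R n) (Df : 'rV[R]_k -> 'M[R]_(k, n.*2.+1)) m j :
  (0 < n)%N -> (n < k)%N -> k%:R < q ->
  (forall l x, cell m j x -> {for x, continuous (fun y : 'rV[R]_k => f y 0 l)}) ->
  (forall i l, wk (cell m j) i (fun x => f x 0 l) (fun x => Df x i l)) ->
  {ae lam, forall x, cell m j x -> forall i, contact_form (f x) (row i (Df x)) = 0} ->
  (forall i l, measurable_fun (cell m j) (fun x => Df x i l)) ->
  (forall i l, (Lq (cell m j) q (fun x => (Df x i l)%R) < +oo)%E) ->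
  forall e : R, 0 < e -> fcover dcc k e (f @` cell m j).
Proof.
move=> n0 nk kq cf wf contact mDf LDf e e0.
have [K K0 HK] := cell_cover n0 nk kq.
have q0 : 0 < q by exact: le_lt_trans kq.
have q1 : 1 <= q by apply/ltW/le_lt_trans/kq; rewrite ler1n.
pose D : set 'rV[R]_k := cell m j.
have mD : measurable D by exact: measurable_cell.
have Dfin : (lam D < +oo)%E by exact: lebesgue_cell_fin.
pose I := ('I_k * 'I_n.*2.+1)%type.
pose g (il : I) x := Df x il.1 il.2.
pose c : R := #|{: I}|%:R.
pose V : R := vol (R := R) (k := k) m.
have V0 : 0 < V by exact: vol_gt0.
pose Li il := \int[lam]_(x in D) (`|g il x| `^ q).
have ig il : lam.-integrable D (EFin \o (fun x => `|g il x| `^ q)).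
  by apply: Lq_integrable => //; [exact: mDf|exact: LDf].
(* [H] will bound the sum of [vol a ^ k] over the subcells whatever their level and whatever the
   step function, provided its error is at most 1. Hence [N] can be fixed before the step
   function. *)
pose H := V + c `^ q * \sum_il (2 `^ q * (Li il + 1)).
have H0 : 0 <= H.
  rewrite addr_ge0 ?(ltW V0)// mulr_ge0 ?powR_ge0//; apply: sumr_ge0 => il _.
  rewrite mulr_ge0 ?powR_ge0// addr_ge0//; apply: Rintegral_ge0 => x _; exact: powR_ge0.
have [N N0 HN] : exists2 N : nat, (0 < N)%N & K * (H / N%:R) <= e / 2.
  have KH : 0 <= K * H by rewrite mulr_ge0.
  have e2 : 0 < e / 2 by rewrite divr_gt0.
  exists (Num.truncn (K * H / (e / 2))).+1 => //.
  rewrite mulrA ler_pdivrMr ?ltr0n// [leRHS]mulrC -ler_pdivrMr//; apply/ltW.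
  exact: truncnS_gt.
pose P := K * N%:R ^+ (k' + k).
have P0 : 0 <= P by rewrite mulr_ge0 ?exprn_ge0.
have e6 : 0 < e / 6 by rewrite divr_gt0.
(* [lambda], [eta] and the approximation error [e1] are chosen after [N] and account for [e / 6]
   each; the term with [1 / N] has [e / 2]. *)
have [lambda l0 Hl] := exists_mul_le (mulr_ge0 P0 (ltW V0)) e6.
have [C C0 HC] := exprn_le_powR (ltn0Sn k') kq l0.
have [eta eta0 Heta] := exists_mul_le (mulr_ge0 (mulr_ge0 P0 C0) (ltW V0)) e6.
have c0 : 0 <= c by [].
have [e1' e10' He1'] := exists_mul_le (mulr_ge0 (mulr_ge0 P0 C0) c0) e6.
pose e1 := Num.min 1 e1'.
have e10 : 0 < e1 by rewrite lt_min ltr01.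
have e1le : e1 <= 1 by rewrite ge_min lexx.
have He1 : P * C * c * e1 <= e / 6.
  by apply: le_trans He1'; rewrite ler_wpM2l ?mulr_ge0// ge_min lexx orbT.
have [L [tau Htau]] := common_level m (g := g) mD Dfin q1 (fun il => mDf il.1 il.2) (fun il => LDf il.1 il.2) e10.
pose d il x := g il x - tau il (cellof (m + L) x).
have md il : measurable_fun D (d il) by apply: measurable_funB; [exact: mDf|exact: (Htau il).1].
have id_ il : lam.-integrable D (EFin \o (fun x => `|d il x| `^ q)).
  by apply: Lq_integrable => //; apply: le_lt_trans (Htau il).2 (ltry _).
have Id il : \int[lam]_(x in D) (`|d il x| `^ q) <= e1.
  rewrite -lee_fin /Rintegral fineK; last exact: (integrable_fin_num mD (id_ il)).
  exact: (Htau il).2.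
pose B := {ffun 'I_k -> 'I_((2 ^ L).-1.+1)}.
pose Q (b : B) : set 'rV[R]_k := cell (m + L) (child j b).
have QD b : Q b `<=` D by exact: child_sub.
have mQ b : measurable (Q b) by exact: measurable_cell.
pose v : R := vol (R := R) (k := k) (m + L).
have v0 : 0 < v by exact: vol_gt0.
have Bv : \sum_(b : B) v = V by exact: sum_vol_children.
pose A (b : B) : 'M[R]_(k, n.*2.+1) := \matrix_(i, l) tau (i, l) (child j b).
pose a (b : B) : R := \sum_il `|tau il (child j b)|.
pose E b il := \int[lam]_(x in Q b) (`|d il x| `^ q).
have E0 b il : 0 <= E b il by apply: Rintegral_ge0 => x _; exact: powR_ge0.
(* [eta] keeps [M b] positive, as [cell_cover] demands, even on a subcell where [Df] agrees with the
   step function. *)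
pose s b := eta + (\sum_il E b il) / v.
have s0 b : 0 < s b.
  by rewrite ltr_wpDr// divr_ge0 ?(ltW v0)//; exact: sumr_ge0.
pose M b := s b `^ q^-1.
have M0 b : 0 < M b by exact: powR_gt0.
have Mq b : M b `^ q = s b by rewrite /M -powRrM mulVf ?gt_eqF// powRr1// ltW.
have cover b : fcover dcc k (K * (v * (a b ^+ k / N%:R + N%:R ^+ (k' + k) * M b ^+ k))) (f @` Q b).
  apply: (HK f Df (m + L)%N (child j b) (A b) (a b) (M b) N) => //.
  - by move=> l x /QD; exact: cf.
  - move=> i l; exact: wkS mD (mQ b) (@QD b) (wf i l).
  - by apply: filterS contact => x Hx /QD; exact: Hx.
  - move=> i l; rewrite mxE /a (bigD1 (i, l))//= lerDl; exact: sumr_ge0.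
  - move=> i l.
    have eqd x : Q b x -> `|Df x i l - A b i l| `^ q = `|d (i, l) x| `^ q.
      by move=> Qx; rewrite mxE /d /g (Qx : cellof _ _ = _).
    have ib := integrableS mD (mQ b) (@QD b) (id_ (i, l)).
    split.
      by apply: eq_integrable ib => // x; rewrite inE => Qx /=; rewrite eqd.
    rewrite (@eq_Rintegral _ _ _ lam (Q b) (fun x => `|d (i, l) x| `^ q)); last by move=> x; rewrite inE; exact: eqd.
    rewrite Mq /s mulrDl divfK ?gt_eqF// -/(E b (i, l)).
    apply: (@le_trans _ _ (\sum_il E b il)); last by rewrite lerDr mulr_ge0 ?ltW.
    by rewrite [leRHS](bigD1 (i, l))//= lerDl; exact: sumr_ge0.
apply: fcover_le (fcover_sub _ (fcover_bigcup cover)); last first.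
  by move=> _ [x /(cell_child L)[b Qx] <-]; exists b => //; exists x.
have sumE : \sum_b v * s b <= eta * V + c * e1.
  rewrite (eq_bigr (fun b => eta * v + \sum_il E b il)) => [|b _]; last first.
    by rewrite /s mulrDr [v * (_ / v)]mulrC divfK ?gt_eqF// mulrC.
  rewrite big_split/= -mulr_sumr Bv lerD2l exchange_big/=.
  rewrite /c -sum1_card natr_sum mulr_suml; apply: ler_sum => il _; rewrite mul1r.
  apply: le_trans (Id il); apply: Rintegral_children => // x; exact: powR_ge0.
(* On a subcell the value of [tau] is the difference of the entry of [Df] and its deviation, so its
   [q]-th power is bounded by averages of both, and these sum to integrals over the whole cell. *)
have suma : \sum_b v * a b ^+ k <= H.
  have ab b : v * a b ^+ k <= v + c `^ q * \sum_il (2 `^ q * (\int[lam]_(x in Q b) (`|g il x| `^ q) + E b il)).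
    apply: (@le_trans _ _ (v * (1 + c `^ q * \sum_il `|tau il (child j b)| `^ q))).
      rewrite ler_pM2l// (le_trans (exprn_le1DpowR _ (ltW kq)))//; first exact: sumr_ge0.
      by rewrite lerD2l powR_sum_le.
    rewrite mulrDr mulr1 lerD2l mulrCA ler_wpM2l ?powR_ge0// mulr_sumr.
    apply: ler_sum => il _; rewrite [leLHS]mulrC -(Rintegral_cell_cst (m + L) (child j b)).
    have ib1 := integrableS mD (mQ b) (@QD b) (ig il).
    have ib2 := integrableS mD (mQ b) (@QD b) (id_ il).
    have ib : lam.-integrable (Q b) (EFin \o (fun x => `|g il x| `^ q + `|d il x| `^ q)).
      by apply: eq_integrable (integrableD (mQ b) ib1 ib2).
    rewrite -(RintegralD (mQ b) ib1 ib2) -(RintegralZl (2 `^ q) (mQ b) ib).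
    apply: (le_Rintegral (mQ b)).
    + exact: integrable_cell_cst.
    + by apply: eq_integrable (integrableZl (mQ b) (2 `^ q) ib).
    move=> x Qx; have -> : tau il (child j b) = g il x + - d il x.
      by rewrite /d (Qx : cellof _ _ = _); ring.
    by rewrite (le_trans (powR_normD _ _ (ltW q0)))// normrN.
  apply: (le_trans (ler_sum _ (fun b _ => ab b))).
  rewrite big_split/= Bv /H lerD2l -[leLHS]mulr_sumr ler_wpM2l ?powR_ge0// exchange_big/=.
  apply: ler_sum => il _; rewrite -mulr_sumr ler_wpM2l ?powR_ge0// big_split/=; apply: lerD.
    by apply: Rintegral_children => // x; exact: powR_ge0.
  apply: le_trans e1le; apply: le_trans (Id il); apply: Rintegral_children => // x; exact: powR_ge0.
have sumM : \sum_b v * M b ^+ k <= lambda * V + C * (eta * V + c * e1).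
  apply: (@le_trans _ _ (\sum_b (lambda * v + C * (v * s b)))).
    apply: ler_sum => b _; rewrite [C * _]mulrCA [lambda * v]mulrC -mulrDr ler_pM2l//.
    by rewrite -Mq HC// ltW.
  rewrite big_split/= -[X in X + _ <= _]mulr_sumr -[X in _ + X <= _]mulr_sumr Bv lerD2l.
  exact: ler_wpM2l.
rewrite (eq_bigr (fun b => K * (v * a b ^+ k) / N%:R + P * (v * M b ^+ k))) => [|b _]; last first.
  by rewrite /P; ring.
rewrite big_split/= -[X in X + _ <= _]mulr_suml -[X in X / _ + _ <= _]mulr_sumr.
rewrite -[X in _ + X <= _]mulr_sumr.
have t1 : K * (\sum_b v * a b ^+ k) / N%:R <= e / 2.
  apply: le_trans HN; rewrite mulrA ler_wpM2r ?invr_ge0// ler_wpM2l//.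
have t2 : P * (\sum_b v * M b ^+ k) <= P * (lambda * V + C * (eta * V + c * e1)) by rewrite ler_wpM2l.
apply: (le_trans (lerD t1 t2)).
have -> : P * (lambda * V + C * (eta * V + c * e1)) = P * V * lambda + P * C * V * eta + P * C * c * e1 by ring.
lra.
Qed.

End null_cell.

(** * From local Sobolev functions to single cells *)

Section sobolev_cell.
Context {R : realType} {k : nat}.
Notation lam := (lebesgue_rV R k).
Implicit Types (x y : 'rV[R]_k) (j : 'rV[int]_k) (m : nat).

(** Local integrability speaks of compact subsets of [Omega]; the closure of a cell transfers it to
    the half-open cell. *)
Definition closed_cell m j : set 'rV[R]_k :=
  cbox (fun i => (j 0 i)%:~R / 2 ^+ m) (fun i => ((j 0 i)%:~R + 1) / 2 ^+ m).

Lemma cell_closed_cell m j : cell m j `<=` closed_cell m j.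
Proof. by move=> x /cellP jx i; have /andP[-> /ltW ->] := jx i. Qed.

Lemma measurable_closed_cell m j : measurable (closed_cell m j).
Proof.
have := @measurable_box R k (fun i => `[(j 0 i)%:~R / 2 ^+ m, ((j 0 i)%:~R + 1) / 2 ^+ m]%classic) (fun i => measurable_itv _).
by congr measurable; apply/seteqP; split => x xj i; have := xj i; rewrite /= in_itv/=.
Qed.

Lemma closed_cell_sub Omega x : open Omega -> Omega x ->
  exists m, closed_cell m (cellof m x) `<=` Omega.
Proof.
move=> oO Ox; have /nbhs_ballP[e /= e0 xeO] := open_nbhs_nbhs (conj oO Ox).
have [m me] := expr2N_lt e0; exists m => y xy; apply: xeO; rewrite mx_norm_ball /ball_/=.
apply: ltr_mx_norm => // i; rewrite !mxE; apply: le_lt_trans me.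
have /cellP/(_ i)/andP[x1 x2] : cell m (cellof m x) x by [].
have /andP[y1 y2] := xy i.
move: x2 y2; rewrite !mulrDl !mul1r => x2 y2.
by rewrite ler_norml; apply/andP; split; lra.
Qed.

(* The exponent used in place of [p]: [L^oo] is contained in [L^(k + 1)] on
   bounded sets. *)
Definition real_exponent (p : \bar R) : R := if p is r%:E then r else k.+1%:R.

Lemma lt_real_exponent p : (k%:R%:E < p)%E -> k%:R < real_exponent p.
Proof. by case: p => [r| |] //=; rewrite ?lte_fin// => _; rewrite ltr_nat. Qed.

Lemma locally_Lp_measurable Omega p u m j : open Omega -> closed_cell m j `<=` Omega ->
  locally_Lp Omega p u -> measurable_fun (cell m j) u.
Proof.
move=> oO jO [mu _]; apply: measurable_funS mu; first exact: open_measurable_rV.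
exact: subset_trans (@cell_closed_cell m j) jO.
Qed.

Lemma locally_Lp_Lq Omega p u m j : open Omega -> (k%:R%:E < p)%E ->
  closed_cell m j `<=` Omega -> locally_Lp Omega p u ->
  (Lq (cell m j) (real_exponent p) u < +oo)%E.
Proof.
move=> oO kp jO lu; have mu := locally_Lp_measurable oO jO lu.
have mD := @measurable_cell R k m j.
have := lu.2 _ (@compact_cbox R k _ _) jO; rewrite -/(closed_cell m j) => NK.
have muK : measurable_fun setT (u \_ (closed_cell m j)).
  apply: (measurable_restrictT _ (measurable_closed_cell m j)).1.
  exact: measurable_funS (open_measurable_rV oO) jO lu.1.
have uKE x : cell m j x -> (u \_ (closed_cell m j)) x = u x.
  by move=> /cell_closed_cell jx; rewrite patchE mem_set.
have q0 := le_lt_trans (ler0n R k) (lt_real_exponent kp).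
have LE : Lq (cell m j) (real_exponent p) u = Lq (cell m j) (real_exponent p) (u \_ (closed_cell m j)).
  by apply: eq_integral => x; rewrite inE => jx; rewrite uKE.
have mq : measurable_fun setT (fun x => (`|(u \_ (closed_cell m j)) x| `^ real_exponent p)%:E).
  exact: (measurable_Lq _ muK).
rewrite LE; case: p kp NK lu q0 LE mq => [r| |]// kp NK lu q0 LE mq.
  have r0 : 0 < r := q0.
  rewrite unlock /= in NK.
  have {}NK := lty_poweRy (invr_neq0 (lt0r_neq0 r0)) NK.
  apply: le_lt_trans NK; apply: (@le_trans _ _ (\int[lam]_x (`|(u \_ (closed_cell m j)) x| `^ r)%:E)%E).
    by apply: ge0_subset_integral => // x _; rewrite lee_fin powR_ge0.
  by rewrite le_eqVlt; apply/orP; left; apply/eqP; apply: eq_integral => x _; rewrite /= ?poweR_EFin.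
rewrite unlock /= in NK.
(* The norm at [+oo] distinguishes whether the whole space has positive measure; in that case it is
   the essential supremum, which bounds the function almost everywhere on a cell of finite
   volume. *)
have T0 : (0 < lam setT)%E.
  rewrite (lt_le_trans (y := lam (cell m j)))//.
    by rewrite lebesgue_cell lte_fin vol_gt0.
  by apply: le_measure; rewrite ?inE.
rewrite T0 in NK.
have [b0 [b00 Hb]] : exists b : R, 0 <= b /\ {ae lam, forall x, `|(u \_ (closed_cell m j)) x| <= b}.
  have := ess_sup_ge lam (abse \o (EFin \o (u \_ (closed_cell m j)))).
  move: NK; case: (ess_sup _ _) => [y _ Hy|//|_ Hy].
    exists (Num.max y 0); split; first by rewrite le_max lexx orbT.
    by apply: filterS Hy => x /=; rewrite lee_fin => h; rewrite le_max h.
  by exists 0; split => //; apply: filterS Hy => x /=; rewrite leeNy_eq.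
apply: (@le_lt_trans _ _ (\int[lam]_(x in cell m j) (b0 `^ k.+1%:R)%:E)%E).
  apply: (ae_ge0_le_integral mD _ (measurable_funTS mq) _ (measurable_cst _)).
  - by move=> x _; rewrite lee_fin powR_ge0.
  - by move=> x _; rewrite lee_fin powR_ge0.
  - by apply: filterS Hb => x h _; rewrite lee_fin ge0_ler_powR ?nnegrE.
rewrite integral_cst//; apply: lte_mul_pinfty => //; first by rewrite lee_fin powR_ge0.
exact: lebesgue_cell_fin.
Qed.

Lemma Lq_integrable1 D (q : R) u : measurable D -> (lam D < +oo)%E -> 1 <= q ->
  measurable_fun D u -> (Lq D q u < +oo)%E -> lam.-integrable D (EFin \o u).
Proof.
move=> mD Dfin q1 mu Lu.
have i1 : lam.-integrable D (EFin \o cst (1 : R)).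
  by apply: measurable_bounded_integrable => //; exact: bounded_cst.
apply: le_integrable (integrableD mD i1 (Lq_integrable mu Lu)) => //.
  exact/measurable_EFinP.
move=> x _ /=; rewrite lee_fin [leRHS]ger0_norm ?addr_ge0 ?powR_ge0//.
have [a1|a1] := leP `|u x| 1; first by rewrite (le_trans a1)// lerDl powR_ge0.
by rewrite (le_trans _ (_ : `|u x| `^ q <= _)) ?lerDr// -[leLHS]powRr1// ler_powR// ltW.
Qed.

End sobolev_cell.

Theorem corollary1p8 (R : realType) (n k : nat) (p : \bar R)
    (Omega : set 'rV[R]_k) (f : 'rV[R]_k -> heis R n)
    (Df : 'rV[R]_k -> 'M[R]_(k, n.*2.+1)) :
  (0 < n)%N -> (n < k)%N -> open Omega -> (k%:R%:E < p)%E ->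
  {within Omega, continuous f} ->
  sobolev_loc Omega p f Df ->
  {ae lebesgue_rV R k, forall x, Omega x ->
    range (fun v : 'rV[R]_k => v *m Df x) `<=`
      [set w | contact_form (f x) w = 0]} ->
  hausdorff_measure dcc k (f @` Omega) = 0%E.
Proof.
case: k Omega f Df => // k' Omega f Df n0 nk oO kp cf [lf lDf] contact.
have kq := lt_real_exponent kp; set q := real_exponent p in kq.
have q1 : 1 <= q by apply/ltW/le_lt_trans/kq; rewrite ler1n.
(* Pairs of a level and an index are countable and enumerated by [unpickle]; a cell whose closure
   leaves [Omega] is replaced by the empty set. *)
pose A (i : nat) : set (heis R n) :=
  if unpickle i is Some (m, j) then
    if `[< closed_cell m j `<=` Omega >] then f @` cell m (j : 'rV[int]_k'.+1) else set0
  else set0.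
have -> : f @` Omega = \bigcup_i A i.
  apply/seteqP; split => [_ [x Ox <-]|y [i _]].
    have [m mO] := closed_cell_sub oO Ox.
    exists (pickle (m, cellof m x)) => //; rewrite /A pickleK; case: asboolP => // _.
    by exists x.
  rewrite /A; case: (unpickle i) => [[m j]|]//; case: asboolP => // jO [x jx <-].
  by exists x => //; exact/jO/cell_closed_cell.
apply: hausdorff_measure_bigcup => // i e e0.
have fcover0 : fcover dcc k'.+1 e (set0 : set (heis R n)).
  by exists 'I_0, (fun=> set0), (fun=> 0); split => //; rewrite big_ord0 ltW.
rewrite /A; case: (unpickle i) => [[m j]|]//; case: asboolP => // jO.
have jO' := subset_trans (@cell_closed_cell R _ m j) jO.
have mD := @measurable_cell R _ m j; have Dfin := @lebesgue_cell_fin R _ m j.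
have int u : locally_Lp Omega p u -> (lebesgue_rV R k'.+1).-integrable (cell m j) (EFin \o u).
  move=> lu; apply: (Lq_integrable1 mD Dfin q1); first exact: locally_Lp_measurable lu.
  exact: locally_Lp_Lq lu.
apply: (null_cell (q := q) (Df := Df)) => //.
- move=> l x /jO' Ox.
  have cx : {for x, continuous f}.
    by move: cf; rewrite continuous_open_subspace// => /(_ x); apply; rewrite inE.
  exact: (continuous_comp cx (@coord_continuous _ _ _ 0 l _)).
- move=> i' l; have [lD wD] := lDf i' l.
  by apply: (weak_partial_wk jO') wD; exact: int.
- apply: filterS contact => x Hx /jO' Ox i'.
  by apply: (Hx Ox); exists (delta_mx 0 i') => //; rewrite -rowE.
- by move=> i' l; have [lD _] := lDf i' l; exact: locally_Lp_measurable lD.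
- by move=> i' l; have [lD _] := lDf i' l; exact: locally_Lp_Lq lD.
Qed.
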